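(* Adopt the setting of the context. Fix $R>0$, independent of $h$ and $\varepsilon$, and set $p_R(x)=\min\{\mathrm{dist}(x,\overline\Omega),R\}$, $q_R(x)=p_R(x)^2$. Let $C_*,h_0$ be the leakage constants for $p_R$. In the discrete estimates (ii), (iii) and the localization estimate take $0<h\le h_0$. Then $q_R$ is bounded and Lipschitz, vanishes exactly on $\overline\Omega$, and: (i) The continuous penalized values $u^{q_R}_\varepsilon$ converge uniformly on $\overline\Omega$ to the state-constraint value $u$ as $\varepsilon\downarrow0$. (ii) If $\pi$ is a policy, $x\in\mathbb R^d$ and $S^{q_R}_{\varepsilon,h}(\pi)(x)\le C_0$, then for every $\delta>0$, $$\frac1\mu\mathbb E_x^\pi\sum_{m=0}^\infty\gamma_h^m\mathbf 1_{\{\mathrm{dist}(Y_m,\overline\Omega)\ge\delta\}}\le\frac{\varepsilon C_0}{c_\delta},\qquad c_\delta=\min\{\delta,R\}^2 .$$ (iii) For all $x\in\overline\Omega$, $$w_{\bar\pi}[q_R](x)\le RC_*h,\qquad S^{q_R}_{\varepsilon,h}(\bar\pi)(x)\le\frac{\|f\|_\infty}{\lambda}+\frac{RC_*h}{\varepsilon}.$$ Localization. Suppose in addition that $0<\delta\le R$, that the geometric margin condition of the context holds with $\delta$, $D_L>0$ and a compact $K\subset\overline\Omega$, that $h\le\min\{h_0,\varepsilon\}$, $\varepsilon\le1$, $\lambda h\le2dN$, and that $D_L^h:=\mathrm{dist}(\{\mathrm{dist}(\cdot,\overline\Omega)\le\delta/2\},\mathbb R^d\setminus Q_L^h)$ satisfies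 $D_L^h-2h>0$ and $\exp(\lambda(D_L^h-2h)/(4dN))\ge2$. Set $$C^{(q)}_{\rm ext}:=\frac{2\sqrt d\,M_b(\|f\|_\infty+R^2)}{\lambda}+2\|f\|_\infty .$$ If $$e^{-\lambda D_L/(4dN)}\le\frac{c_{\delta/2}h^2}{12\,C^{(q)}_{\rm ext}},\qquad(\mathrm{SM})$$ then for all $x\in K$ $$0\le v_L^{*,q_R}(x)-v^{q_R}_{\varepsilon,h}(x)\le h\Bigl(\frac{\|f\|_\infty}{\lambda}+RC_*\Bigr).\qquad(\mathrm{LOC})$$ Remaining estimates. The comparison, policy-iteration and residual estimates known for the truncated distance penalty hold for $q_R$ with the penalty bound $R^2$, and the refinement results hold with (LOC) and (SM) in place of their distance-penalty counterparts. Explicitly, write $S=S^{q_R}_{\varepsilon,h}$, $v_L^*=v_L^{*,q_R}$, $M^{(q)}_\varepsilon=(\|f\|_\infty+R^2/\varepsilon)/\lambda$, and let $\mathcal L^\pi_{\varepsilon,h},\mathcal F_{\varepsilon,h},\Gamma$ be formed with $p=q_R$. (a) Comparison. $0\le S(\pi)\le M^{(q)}_\varepsilon$ for every policy $\pi$, and $0\le v^{q_R}_{\varepsilon,h}\le v_L^*\le M^{(q)}_\varepsilon$. If $z$ is bounded Borel and $\mathcal A^\pi z\le g$ on $\mathbb R^d$ with $\sup g<\infty$, then $\sup z\le\lambda^{-1}\sup g$. For $\pi,\pi'\in\Pi_L$, $\|S(\pi)-S(\pi')\|_\infty\le\lambda^{-1}\|\mathcal L^\pi_{\varepsilon,h}S(\pi')\|_{\infty,Q_L^h}$,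 and the supremum norms over $\mathbb R^d$ and over $Q_L$ of $S(\pi)-S(\pi')$ coincide; likewise for $S(\pi)-v_L^*$. (b) Policy iteration. Let $\pi_j\in\Pi_L$ and let $v_j$ be bounded Borel functions ($j\ge0$); put $w_j=S(\pi_j)$, $e_j=\|w_j-v_L^*\|_{\infty,\mathbb R^d}$, $\xi_j=\|v_j-w_j\|_{\infty,Q_L}$, $g_j=\sup_{Q_L^h}\Gamma(w_j,\pi_{j+1})$, $G_j=\sup_{Q_L^h}\Gamma(v_j,\pi_{j+1})$. Then $g_j\le G_j+\frac{2\sqrt d\,M_b}{h}\xi_j$, $e_{j+1}\le\gamma_he_j+g_j/\lambda$, and for $n\ge1$ $$e_n\le\gamma_h^ne_0+\frac1\lambda\sum_{j=0}^{n-1}\gamma_h^{n-1-j}\Bigl[G_j+\frac{2\sqrt d\,M_b}{h}\xi_j\Bigr].$$ (c) Residuals. Let $v$ be bounded Borel, $\pi$ a policy, $E$ a compact subset of the interior of $Q_L^h$, $d_E=\mathrm{dist}(E,\partial_hQ_L)$. Then $$\|v-S(\pi)\|_{\infty,E}\le\lambda^{-1}\|\mathcal L^\pi_{\varepsilon,h}v\|_{\infty,Q_L^h}+\gamma_h^{\lceil d_E/h\rceil}\|v-S(\pi)\|_{\infty,\partial_hQ_L},$$ and $\gamma_h^{\lceil d_E/h\rceil}\le e^{-\lambda d_E/(4dN)}$ if $\lambda h\le2dN$. If $Q_L$ lies in the interior of $Q_{L'}^h$ and $\lambda h\le2dN$, then with $d_{L,L'}=\mathrm{dist}(Q_L,\partial_hQ_{L'})$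 $$\|v-S(\pi)\|_{\infty,Q_L}\le\lambda^{-1}\|\mathcal L^\pi_{\varepsilon,h}v\|_{\infty,Q_{L'}^h}+e^{-\lambda d_{L,L'}/(4dN)}\bigl(\|v\|_{\infty,\partial_hQ_{L'}}+M^{(q)}_\varepsilon\bigr).$$ If $L'>L$, $E$ is a compact subset of the interior of $Q_{L'}^h$, and $\mathcal R_L[v]$ equals $\mathcal F_{\varepsilon,h}[v]$ on $Q_L^h$ and $\mathcal L^{\bar\pi}_{\varepsilon,h}v$ elsewhere, then with $d'_E=\mathrm{dist}(E,\partial_hQ_{L'})$ $$\|v-v_L^*\|_{\infty,E}\le\lambda^{-1}\|\mathcal R_L[v]\|_{\infty,Q_{L'}^h}+\gamma_h^{\lceil d'_E/h\rceil}\bigl(\|v\|_{\infty,\partial_hQ_{L'}}+M^{(q)}_\varepsilon\bigr).$$ (d) Total error. Under the localization hypotheses including (SM), with the notation of (b), for every $n\ge1$ $$\|u-v_n\|_{\infty,K}\le\|u-u^{q_R}_\varepsilon\|_{\infty,K}+\|u^{q_R}_\varepsilon-v^{q_R}_{\varepsilon,h}\|_{\infty,K}+h\Bigl(\frac{\|f\|_\infty}\lambda+RC_*\Bigr)+\gamma_h^ne_0+\frac1\lambda\sum_{j=0}^{n-1}\gamma_h^{n-1-j}\Bigl[G_j+\frac{2\sqrt d\,M_b}{h}\xi_j\Bigr]+\xi_n .$$ (e) Refinement. Let $\varepsilon_k\downarrow0$, $h_k\downarrow0$, $L_k\to\infty$, $n_k\to\infty$ with $N$, $R$ and $\delta\in(0,R]$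 fixed; let $K\subset\overline\Omega$ be compact and assume the geometric margin condition for $(\delta,D_{L_k},K)$ at $(h_k,L_k)$ for all large $k$. Let $\pi_{k,j}\in\Pi_{L_k}$ (with $h=h_k$), $v_{k,j}$ bounded Borel ($0\le j\le n_k$), and let $w_{k,j},\xi_{k,j},G_{k,j}$ be as in (b) at $(\varepsilon_k,h_k,L_k)$. Suppose: (R1) $h_k\le\min\{h_0,\varepsilon_k\}$ and $\lambda h_k\le2dN$; (R2) $D_{L_k}\ge\frac{4dN}{\lambda}\log\bigl(\frac{12\,C^{(q)}_{\rm ext}}{c_{\delta/2}h_k^2}\bigr)$; (R3) $\gamma_{h_k}^{n_k}\|w_{k,0}-v^{*}_{L_k}\|_{\infty,\mathbb R^d}\to0$ (for which $\gamma_{h_k}^{n_k}/\varepsilon_k\to0$ is sufficient); (R4) $h_k^{-2}\sup_{0\le j\le n_k}\xi_{k,j}\to0$ and $h_k^{-1}\sup_{0\le j<n_k}G_{k,j}\to0$; (R5) $\|u-u^{q_R}_{\varepsilon_k}\|_{\infty,K}\to0$ and $\|u^{q_R}_{\varepsilon_k}-v^{q_R}_{\varepsilon_k,h_k}\|_{\infty,K}\to0$. Then $v_{k,n_k}\to u$ in $L^\infty(K)$ and in $L^2(K)$. The first condition in (R4) may be replaced by either of the following, where $Q_{L_k}$ lies in the interior of $Q_{L'_k}^{h_k}$, $d_k=\mathrm{dist}(Q_{L_k},\partial_{h_k}Q_{L'_k})$, $r_{k,j}=\mathcal L^{\pi_{k,j}}_{\varepsilon_k,h_k}v_{k,j}$,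 and $a_k^{\rm strip}=\sup_{0\le j\le n_k}\|v_{k,j}\|_{\infty,\partial_{h_k}Q_{L'_k}}$: - with $\mathcal E_k=\sup_{0\le j\le n_k}\|r_{k,j}\|_{\infty,Q_{L'_k}^{h_k}}$, $$h_k^{-2}\Bigl[\mathcal E_k/\lambda+e^{-\lambda d_k/(4dN)}\bigl(a_k^{\rm strip}+M^{(q)}_{\varepsilon_k}\bigr)\Bigr]\to0;$$ - each $r_{k,j}$ ($0\le j\le n_k$) is Lipschitz with constant at most $\Lambda_k$ on $\overline{D_k}$, where $D_k$ is the interior of $Q_{L'_k}^{h_k}$; $\rho_k$ is a sampling density on $D_k$ with $\rho_k\ge\rho_{\min,k}>0$; and with $a_k=\rho_{\min,k}^{-1/2}\sup_{0\le j\le n_k}\bigl(\int_{D_k}|r_{k,j}|^2\rho_k\,dx\bigr)^{1/2}$ and $E_k^{(2)}=C_{D_k}\bigl(\Lambda_k^{d/(d+2)}a_k^{2/(d+2)}+a_k\bigr)$, the previous display holds with $E_k^{(2)}$ in place of $\mathcal E_k$.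
   Context: Setting. $|\cdot|$ is the Euclidean norm; $\|z\|_{\infty,D}=\sup_D|z|$ is the pointwise supremum, and $\|\cdot\|_\infty$ is the supremum over the full domain; $L^\infty(K)$ is understood in this pointwise sense. $\Omega\subset\mathbb R^d$ is a bounded domain with $C^2$ boundary and outward unit normal $n$; $A\subset\mathbb R^m$ is compact; $\lambda>0$; $b:\mathbb R^d\times A\to\mathbb R^d$ and $f:\mathbb R^d\times A\to[0,\infty)$ are continuous, bounded, and Lipschitz in $x$ uniformly in $a$, with $\mathrm{Lip}_x(b)<\lambda$; $M_b:=\sup|b|$. There is $\nu>0$ such that for each $x\in\partial\Omega$ some $a\in A$ satisfies $b(x,a)\cdot n(x)\le-\nu$. The Hamiltonian $H(x,p)=\sup_{a\in A}\{-b(x,a)\cdot p-f(x,a)\}$ tends to $\infty$ as $|p|\to\infty$ uniformly in $x\in\overline\Omega$. $N>0$ is fixed with $N\ge\frac12\sup_{x,a}\max_i|b_i(x,a)|$; $h,\varepsilon>0$. Continuous values. For measurable $\alpha:[0,\infty)\to A$, $X^{x,\alpha}$ solves $\dot X=b(X,\alpha)$, $X(0)=x$. The state-constraint value is $u(x)=\inf\int_0^\infty e^{-\lambda t}f(X^{x,\alpha}(t),\alpha(t))\,dt$ over $\alpha$ with $X^{x,\alpha}(t)\in\overline\Omega$ for all $t\ge0$ ($x\in\overline\Omega$). For a penalty $p$, $u^p_\varepsilon(x)=\inf_\alpha\int_0^\infty e^{-\lambda t}\bigl(f(X^{x,\alpha},\alpha)+\frac1\varepsilon p(X^{x,\alpha})\bigr)dt$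 over all measurable controls. It is a known theorem (Capuzzo-Dolcetta--Lions) that for the truncated distance penalty $p_R$, $u^{p_R}_\varepsilon\to u$ uniformly on $\overline\Omega$ as $\varepsilon\downarrow0$. Scheme with penalty $p$. $(\nabla_hv)_i(x)=\frac{v(x+he_i)-v(x-he_i)}{2h}$, $\Delta_hv(x)=\sum_{i=1}^d\frac{v(x+he_i)-2v(x)+v(x-he_i)}{h^2}$, $\nu_h=Nh$. A policy is a Borel map $\pi:\mathbb R^d\to A$; $\mathcal A^\pi v=\lambda v-b(\cdot,\pi)\cdot\nabla_hv-\nu_h\Delta_hv$; $\mathcal L^\pi_{\varepsilon,h}v=\mathcal A^\pi v-f(\cdot,\pi)-p/\varepsilon$; $\mathcal F_{\varepsilon,h}[v]=\lambda v+H(x,\nabla_hv)-\nu_h\Delta_hv-p/\varepsilon$; the greedy gap is $\Gamma(v,\pi)=\mathcal F_{\varepsilon,h}[v]-\mathcal L^\pi_{\varepsilon,h}v\ge0$. $S^p_{\varepsilon,h}(\pi)$ is the unique bounded Borel zero of $\mathcal L^\pi_{\varepsilon,h}$, and $v^p_{\varepsilon,h}$ the unique bounded Borel zero of $\mathcal F_{\varepsilon,h}$. Jump chain. $\Lambda_h=2dN/h$, $\mu=\lambda+\Lambda_h$, $\gamma_h=\Lambda_h/\mu$. Given $\pi$ and $x$, $(Y_m)$ is the Markov chain on $x+h\mathbb Z^d$ with $Y_0=x$ jumping from $y$ to $y\pm he_i$ with probability $\frac{N\pm b_i(y,\pi(y))/2}{2dN}$; $\mathbb E_x^\pi$ is its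 expectation. $w_{\bar\pi}[p](x)=\mu^{-1}\mathbb E_x^{\bar\pi}\sum_{m\ge0}\gamma_h^mp(Y_m)$. Inward feedback. Constants $r_1\in(0,1]$, $\nu_0\in(0,1]$, $C_\Omega\ge1$, a function $\tilde d\in C^{1,1}(\mathbb R^d)$ and a Borel feedback $\bar\pi:\mathbb R^d\to A$ are fixed (they exist) such that: (V1) $|\nabla\tilde d|\le1$ and $\|D^2\tilde d\|_{L^\infty}\le C_\Omega$; (V2) $\tilde d\le0$ on $\overline\Omega$ and $\tilde d(x)\ge\frac12\min\{\mathrm{dist}(x,\overline\Omega),r_1\}$ for $x\notin\overline\Omega$; (V3) $b(x,\bar\pi(x))\cdot\nabla\tilde d(x)\le-\nu_0$ whenever $|\tilde d(x)|\le r_1$. Leakage constants for $p_R$. $C_*\ge1$ (depending only on $\lambda,\nu_0,d,N,M_b,C_\Omega$) and $h_0\in(0,1]$ (depending additionally on $R,r_1$) are constants, which exist, such that $w_{\bar\pi}[p_R]\le C_*h$ on $\overline\Omega$ for all $h\in(0,h_0]$. Boxes and localized class. $0<h<L$; $Q_L=[-L,L]^d$ contains $\overline\Omega$ in its interior; $Q_L^h=[-L+h,L-h]^d$; $\partial_hQ_L=Q_L\setminus Q_L^h$ (same notation for $L'$). $\Pi_L$ is the set of policies equal to $\bar\pi$ on $\mathbb R^d\setminus Q_L^h$; $v_L^{*,p}(x)=\inf_{\pi\in\Pi_L}S^p_{\varepsilon,h}(\pi)(x)$. Geometric margin condition (for $\delta,D_L,K$): $\{y\in Q_L:\mathrm{dist}(y,\mathbb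 R^d\setminus Q_L)\le D_L+h\}\subset\{\mathrm{dist}(\cdot,\overline\Omega)\ge\delta\}$, $\mathrm{dist}(K,\mathbb R^d\setminus Q_L)>D_L+h$, and $\{\mathrm{dist}(\cdot,\overline\Omega)\le\delta\}\subset Q_L$. Lifting constant. For a bounded Lipschitz domain $D$, $C_D$ is a constant depending only on $D$ and $d$ (it exists) such that every $r$ that is Lipschitz on $\overline D$ with constant at most $\Lambda$ satisfies $\|r\|_{\infty,D}\le C_D\Lambda^{d/(d+2)}\|r\|_{L^2(D)}^{2/(d+2)}+C_D\|r\|_{L^2(D)}$. *)

(* Defs.v *)
From HB Require Import structures.
From mathcomp Require Import all_boot all_order all_algebra.
From mathcomp Require Import all_classical all_reals all_analysis.
Set Implicit Arguments.
Unset Strict Implicit.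
Unset Printing Implicit Defensive.
Import Order.TTheory GRing.Theory Num.Theory.
Import numFieldNormedType.Exports.
Local Open Scope classical_set_scope.
Local Open Scope ring_scope.

Notation Borel T := (g_sigma_algebraType (@open T)).

Section Euclid.
Context {R : realType} {d : nat}.
Implicit Types (x y : 'rV[R]_d) (A B : set 'rV[R]_d).

Definition dotv x y : R := \sum_(i < d) x 0 i * y 0 i.

(* Euclidean norm; the library norm `|x| on row vectors is the sup norm. *)
Definition enorm x : R := Num.sqrt (dotv x x).

Definition dist x A : R := inf [set enorm (x - y) | y in A].

(* Extended-valued, so that the distance to the empty set is +oo. *)
Definition dist_set A B : \bar R :=
  ereal_inf [set (enorm (x - y))%:E | x in A & y in B].

(* Real-valued, hence meaningful only for z bounded on D; 0 when D is empty. *)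
Definition supn (D : set 'rV[R]_d) (z : 'rV[R]_d -> R) : R :=
  sup [set `|z x| | x in D].

Definition cube (L : R) : set 'rV[R]_d := [set x | forall i, - L <= x 0 i <= L].

Definition strip (h L : R) : set 'rV[R]_d := cube L `\` cube (L - h).

End Euclid.

Section Lebesgue.
Context {R : realType} {d : nat}.

(* Lebesgue measure on R^d: Caratheodory restriction of the outer measure
   obtained from countable covers by closed boxes. *)
Definition box (c : 'rV[R]_d * 'rV[R]_d) : set 'rV[R]_d :=
  [set x | forall i, c.1 0 i <= x 0 i <= c.2 0 i].

Definition box_vol (c : 'rV[R]_d * 'rV[R]_d) : \bar R :=
  (\prod_(i < d) Num.max 0 (c.2 0 i - c.1 0 i))%:E.

Definition box_cover (A : set 'rV[R]_d) :=
  [set F : set nat * (nat -> 'rV[R]_d * 'rV[R]_d) |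
    A `<=` \bigcup_(k in F.1) box (F.2 k)].

Definition lebesgue_outer (A : set 'rV[R]_d) : \bar R :=
  ereal_inf [set (\esum_(k in F.1) box_vol (F.2 k))%E | F in box_cover A].

Lemma box_vol_ge0 c : (0 <= box_vol c)%E.
Proof. by rewrite lee_fin; apply: prodr_ge0 => i _; rewrite le_max lexx. Qed.

Lemma lebesgue_outer_ge0 A : (0 <= lebesgue_outer A)%E.
Proof.
by apply: le_ereal_inf_tmp => _ [F _ <-]; apply: esum_ge0 => k _; exact: box_vol_ge0.
Qed.

Lemma lebesgue_outer0 : lebesgue_outer set0 = 0%E.
Proof.
apply/eqP; rewrite eq_le lebesgue_outer_ge0 andbT.
apply: ereal_inf_lbound; exists (set0, fun=> (0, 0)) => //=.
by rewrite esum_set0.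
Qed.

Lemma le_lebesgue_outer :
  {homo lebesgue_outer : A B / A `<=` B >-> (A <= B)%E}.
Proof.
move=> A B AB; apply: ereal_inf_le_tmp => _ [F FB <-]; exists F => //.
exact: subset_trans FB.
Qed.

Lemma lebesgue_outer_sigma_subadditive : sigma_subadditive lebesgue_outer.
Proof.
move=> A.
have [[i ioo]|] := pselect (exists i, lebesgue_outer (A i) = +oo%E).
  rewrite (eseries_pinfty _ _ ioo) ?leey// => n _.
  by rewrite -ltNye (lt_le_trans _ (lebesgue_outer_ge0 _)).
rewrite -forallNE => Aoo.
suff add2e (e : {posnum R}) : (lebesgue_outer (\bigcup_n A n) <=
    \sum_(i <oo) lebesgue_outer (A i) + e%:num%:E)%E.
  by apply/lee_addgt0Pr => _/posnumP[].
rewrite (le_trans _ (epsilon_trick _ _ _))//; last first.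
  by move=> n; exact: lebesgue_outer_ge0.
pose P n (F : set nat * (nat -> 'rV[R]_d * 'rV[R]_d)) := box_cover (A n) F /\
  (\esum_(k in F.1) box_vol (F.2 k) <=
   lebesgue_outer (A n) + (e%:num / (2 ^ n.+1)%:R)%:E)%E.
have [G PG] : {G & forall n, P n (G n)}.
  apply: (@choice _ _ P) => n; rewrite /P.
  have en1 : (0 < e%:num / (2 ^ n.+1)%:R)%R by [].
  have fA : lebesgue_outer (A n) \is a fin_num.
    by rewrite ge0_fin_numE ?lebesgue_outer_ge0// ltey; apply/eqP; exact: Aoo.
  have [_ [F AF <-] FS] := lb_ereal_inf_adherent en1 fA.
  by exists F; split => //; exact: ltW.
have /card_esym/ppcard_eqP[f] := card_nat2.
pose J : set (nat * nat) := [set p | (G p.1).1 p.2].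
apply: (@le_trans _ _ (\esum_(p in J) box_vol ((G p.1).2 p.2))%E).
  apply: ereal_inf_lbound.
  exists (f @^-1` J, fun k => (G (f k).1).2 (f k).2) => /=.
    move=> x [n _ /(PG n).1 [k Gk xk]].
    by exists (f^-1%FUN (n, k)) => /=; rewrite ?/J/= invK ?inE.
  rewrite -(reindex_esum (f @^-1` J) J f (fun p => box_vol ((G p.1).2 p.2)))//.
  split=> [//|p q _ _|p Jp]; first exact: (@bij_inj _ _ f).
  by exists (f^-1%FUN p); rewrite /= invK ?inE.
rewrite (_ : J = setT `*`` (fun n => (G n).1)); last first.
  by apply/seteqP; split=> -[n k] //= [].
rewrite -(esum_esum (a := fun n k => box_vol ((G n).2 k))); last first.
  by move=> n k _ _; exact: box_vol_ge0.
rewrite -nneseries_esumT; last first.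
  by move=> n; apply: esum_ge0 => k _; exact: box_vol_ge0.
apply: lee_nneseries => n *; last exact: (PG n).2.
by apply: esum_ge0 => k _; exact: box_vol_ge0.
Qed.

HB.instance Definition _ := isOuterMeasure.Build R 'rV[R]_d lebesgue_outer
  lebesgue_outer0 lebesgue_outer_ge0 le_lebesgue_outer
  lebesgue_outer_sigma_subadditive.

End Lebesgue.

Definition outer_leb (R : realType) (d : nat) :
  {outer_measure set 'rV[R]_d -> \bar R} := (@lebesgue_outer R d).

Definition leb (R : realType) (d : nat) :
    {measure set (caratheodory_type (outer_leb R d)) -> \bar R} :=
  [the measure _ _ of
   (outer_leb R d : set (caratheodory_type (outer_leb R d)) -> \bar R)].


Section Calculus.
Context {R : realType} {d : nat}.
Implicit Types (g : 'rV[R]_d -> R) (U : set 'rV[R]_d).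

Definition pd (i : 'I_d) g : 'rV[R]_d -> R := fun x => 'D_(delta_mx 0 i) g x.

Definition grad g (x : 'rV[R]_d) : 'rV[R]_d := \row_i pd i g x.

Definition hess g (x : 'rV[R]_d) : 'M[R]_d := \matrix_(i, j) pd j (pd i g) x.

Definition C1_on U g := forall x i, U x ->
  derivable g x (delta_mx 0 i) /\ {for x, continuous (pd i g)}.

Definition C2_on U g := C1_on U g /\ forall i, C1_on U (pd i g).

Definition lipschitz_in U (k : R) g :=
  forall x y, U x -> U y -> `|g x - g y| <= k * enorm (x - y).

Definition C11 g := (forall x, differentiable g x) /\
  exists k, forall x y, enorm (grad g x - grad g y) <= k * enorm (x - y).

Definition bdry U := closure U `\` U°.

(* The boundary is C^2, with outward unit normal n: near each boundary point, U
   is the sublevel set {rho < 0} of a C^2 function with nonzero gradient. *)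
Definition C2_boundary U (n : 'rV[R]_d -> 'rV[R]_d) :=
  forall x, bdry U x -> exists (V : set 'rV[R]_d) (rho : 'rV[R]_d -> R),
    [/\ open V /\ V x, C2_on V rho, grad rho x != 0,
        forall y, V y -> (U y <-> rho y < 0) &
        n x = (enorm (grad rho x))^-1 *: grad rho x].

Definition bounded_borel (v : 'rV[R]_d -> R) :=
  measurable_fun setT (v : Borel 'rV[R]_d -> R) /\
  exists c, forall x, `|v x| <= c.

Definition L2norm U g : R := Num.sqrt (\int[leb R d]_(x in U) (g x ^+ 2)).

(* C is admissible as the constant C_D in the sup/L^2 interpolation. *)
Definition lifting_constant (D : set 'rV[R]_d) (C : R) :=
  forall (r : 'rV[R]_d -> R) (k : R), 0 <= k -> lipschitz_in (closure D) k r ->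
    supn D r <= C * (k `^ (d%:R / d.+2%:R)) * (L2norm D r `^ (2 / d.+2%:R))
                + C * L2norm D r.

Definition sampling_density (D : set 'rV[R]_d) (rho : 'rV[R]_d -> R) :=
  [/\ measurable_fun (D : set (caratheodory_type (outer_leb R d)))
        (rho : caratheodory_type (outer_leb R d) -> R),
      forall x, D x -> 0 <= rho x &
      (\int[leb R d]_(x in D) (rho x)%:E = 1)%E].

End Calculus.

Record model (R : realType) (d m : nat) := Model {
  Om : set 'rV[R]_d;
  nml : 'rV[R]_d -> 'rV[R]_d;  (* only its values on the boundary of Om matter *)
  Act : set 'rV[R]_m;
  lam : R;
  drift : 'rV[R]_d -> 'rV[R]_m -> 'rV[R]_d;  (* b; only its values for a in Act matter *)
  rcost : 'rV[R]_d -> 'rV[R]_m -> R;         (* f; idem *)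
  Nv : R
}.

Section Control.
Context {R : realType} {d m : nat} (M : model R d m).
Local Notation Rd := 'rV[R]_d.
Local Notation Rm := 'rV[R]_m.
Local Notation Om := (Om M).
Local Notation A := (Act M).
Local Notation lam := (lam M).
Local Notation b := (drift M).
Local Notation f := (rcost M).
Local Notation N := (Nv M).
Local Notation dR := (d%:R : R).
Implicit Types (x y : Rd) (p v : Rd -> R) (pi : Rd -> Rm) (eps h L : R).

Definition hamiltonian x (q : Rd) : R :=
  sup [set - dotv (b x a) q - f x a | a in A].

Definition supb : R := sup [set enorm (b x a) | x in setT & a in A].

Definition supf : R := sup [set `|f x a| | x in setT & a in A].

Record standing : Prop := Standing {
  dom_open : open Om;
  dom_nonempty : Om !=set0;
  dom_connected : connected Om;
  dom_bounded : bounded_set Om;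
  dom_C2 : C2_boundary Om (nml M);
  act_compact : compact A;
  lam_gt0 : 0 < lam;
  drift_cont : {within [set z : Rd * Rm | A z.2],
                  continuous (fun z : Rd * Rm => b z.1 z.2)};
  rcost_cont : {within [set z : Rd * Rm | A z.2],
                  continuous (fun z : Rd * Rm => f z.1 z.2)};
  rcost_ge0 : forall x a, A a -> 0 <= f x a;
  drift_bounded : exists c, forall x a, A a -> enorm (b x a) <= c;
  rcost_bounded : exists c, forall x a, A a -> f x a <= c;
  drift_lipschitz : exists2 k, k < lam & forall a x y, A a ->
    enorm (b x a - b y a) <= k * enorm (x - y);
  rcost_lipschitz : exists k, forall a x y, A a ->
    `|f x a - f y a| <= k * enorm (x - y);
  inward : exists2 nu : R, 0 < nu & forall x, bdry Om x ->
    exists2 a, A a & dotv (b x a) (nml M x) <= - nu;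
  coercive : forall c, exists r, forall x q,
    closure Om x -> r <= enorm q -> c <= hamiltonian x q;
  visc_gt0 : 0 < N;
  visc_bound : forall x a i, A a -> `|b x a 0 i| / 2 <= N
}.

Definition control (al : R -> Rm) :=
  measurable_fun (`[0, +oo[ : set R) (al : R -> Borel Rm) /\
  forall t, 0 <= t -> A (al t).

Definition trajectory x (al : R -> Rm) (X : R -> Rd) :=
  [/\ X 0 = x, {within (`[0, +oo[ : set R), continuous X} &
      forall t i, 0 <= t -> X t 0 i =
        x 0 i + \int[lebesgue_measure]_(s in `[0, t]) (b (X s) (al s) 0 i)].

Definition cost (g : Rd -> Rm -> R) (al : R -> Rm) (X : R -> Rd) : R :=
  \int[lebesgue_measure]_(t in `[0, +oo[) (expR (- lam * t) * g (X t) (al t)).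

Definition sc_value x : R :=
  inf [set J | exists al X, [/\ control al, trajectory x al X,
    forall t, 0 <= t -> closure Om (X t) & J = cost f al X]].

Definition pen_value p eps x : R :=
  inf [set J | exists al X, [/\ control al, trajectory x al X &
    J = cost (fun y a => f y a + eps^-1 * p y) al X]].

Definition gradh h v x : Rd :=
  \row_i ((v (x + h *: delta_mx 0 i) - v (x - h *: delta_mx 0 i)) / (2 * h)).

Definition lapl h v x : R :=
  \sum_(i < d) (v (x + h *: delta_mx 0 i) - 2 * v x
                + v (x - h *: delta_mx 0 i)) / h ^+ 2.

Definition policy pi :=
  measurable_fun setT (pi : Borel Rd -> Borel Rm) /\ forall x, A (pi x).

Definition opA h pi v x : R :=
  lam * v x - dotv (b x (pi x)) (gradh h v x) - N * h * lapl h v x.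

Definition opL p eps h pi v x : R :=
  opA h pi v x - f x (pi x) - p x / eps.

Definition opF p eps h v x : R :=
  lam * v x + hamiltonian x (gradh h v x) - N * h * lapl h v x - p x / eps.

Definition gap p eps h v pi x : R := opF p eps h v x - opL p eps h pi v x.

(* The bounded Borel zero of L^pi (it exists and is unique). *)
Definition polval p eps h pi : Rd -> R :=
  get [set v | bounded_borel v /\ forall x, opL p eps h pi v x = 0].

(* The bounded Borel zero of F (it exists and is unique). *)
Definition discval p eps h : Rd -> R :=
  get [set v | bounded_borel v /\ forall x, opF p eps h v x = 0].

Definition Lamh h : R := 2 * dR * N / h.
Definition muh h : R := lam + Lamh h.
Definition gamh h : R := Lamh h / muh h.

Definition jump_prob h pi y z : R :=
  \sum_(i < d)
    ((z == y + h *: delta_mx 0 i)%:R * ((N + b y (pi y) 0 i / 2) / (2 * dR * N))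
   + (z == y - h *: delta_mx 0 i)%:R * ((N - b y (pi y) 0 i / 2) / (2 * dR * N))).

(* The chain lives on the countable lattice x + h Z^d, so that its law and the
   Markov property are given by the probabilities of the finite paths. *)
Definition jump_chain (dT : measure_display) (T : measurableType dT)
    (P : probability T R) (Y : nat -> T -> Rd) h pi x :=
  [/\ forall k, measurable_fun setT (Y k : T -> Borel Rd),
      P [set w | Y 0%N w = x] = 1%E &
      forall k (y : nat -> Rd),
        P [set w | forall j, (j <= k.+1)%N -> Y j w = y j] =
        (P [set w | forall j, (j <= k)%N -> Y j w = y j] *
         (jump_prob h pi (y k) (y k.+1))%:E)%E].

Definition discounted (dT : measure_display) (T : measurableType dT)
    (P : probability T R) (Y : nat -> T -> Rd) h (phi : Rd -> R) : \bar R :=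
  (((muh h)^-1)%:E *
   \int[P]_w (\sum_(k <oo) (gamh h ^+ k * phi (Y k w))%:E))%E.

Record feedback (r1 nu0 COm : R) (dt : Rd -> R) (pib : Rd -> Rm) : Prop :=
  Feedback {
    fb_r1 : 0 < r1 <= 1;
    fb_nu0 : 0 < nu0 <= 1;
    fb_COm : 1 <= COm;
    fb_C11 : C11 dt;
    fb_policy : policy pib;
    fb_V1_grad : forall x, enorm (grad dt x) <= 1;
    fb_V1_hess : {ae leb R d, forall x,
      forall q : Rd, enorm (q *m hess dt x) <= COm * enorm q};
    fb_V2_in : forall x, closure Om x -> dt x <= 0;
    fb_V2_out : forall x, ~ closure Om x ->
      2^-1 * Num.min (dist x (closure Om)) r1 <= dt x;
    fb_V3 : forall x, `|dt x| <= r1 ->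
      dotv (b x (pib x)) (grad dt x) <= - nu0
  }.

Definition pen_dist (rad : R) : Rd -> R :=
  fun x => Num.min (dist x (closure Om)) rad.

Definition pen_sq (rad : R) : Rd -> R := fun x => pen_dist rad x ^+ 2.

Definition cdel (rad delta : R) : R := Num.min delta rad ^+ 2.

Definition good_box h L :=
  [/\ 0 < h, h < L & closure Om `<=` (cube L)°].

Definition loc_policy (pib : Rd -> Rm) h L : set (Rd -> Rm) :=
  [set pi | policy pi /\ forall x, ~ cube (L - h) x -> pi x = pib x].

Definition locval p eps (pib : Rd -> Rm) h L x : R :=
  inf [set polval p eps h pi x | pi in loc_policy pib h L].

Definition margin (delta DL h L : R) (K : set Rd) :=
  [/\ forall y, cube L y -> dist y (~` cube L) <= DL + h ->
        delta <= dist y (closure Om),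
      ((DL + h)%:E < dist_set K (~` cube L))%E &
      [set x | dist x (closure Om) <= delta] `<=` cube L].

Definition DLh (delta h L : R) : R :=
  fine (dist_set [set x | dist x (closure Om) <= delta / 2] (~` cube (L - h))).

Definition Cext (rad : R) : R :=
  2 * Num.sqrt dR * supb * (supf + rad ^+ 2) / lam + 2 * supf.

Definition decay (D : R) : R := expR (- lam * D / (4 * dR * N)).

Record localization (rad h0 eps h L delta DL : R) (K : set Rd) : Prop :=
  Localization {
    loc_box : good_box h L;
    loc_eps : 0 < eps <= 1;
    loc_h : h <= Num.min h0 eps;
    loc_lamh : lam * h <= 2 * dR * N;
    loc_delta : 0 < delta <= rad;
    loc_DL : 0 < DL;
    loc_K : compact K;
    loc_KOm : K `<=` closure Om;
    loc_margin : margin delta DL h L K;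
    loc_DLh : 0 < DLh delta h L - 2 * h;
    loc_exp : 2 <= expR (lam * (DLh delta h L - 2 * h) / (4 * dR * N));
    loc_SM : decay DL <= cdel rad (delta / 2) * h ^+ 2 / (12 * Cext rad)
  }.

Definition Meps (rad eps : R) : R := (supf + rad ^+ 2 / eps) / lam.

(* xi_j and e_j of approximate policy iteration, for v_j = v and pi_j = pi. *)
Definition eval_err p eps h L pi v : R := supn (cube L) (v \- polval p eps h pi).

Definition opt_err p eps (pib : Rd -> Rm) h L pi : R :=
  supn setT (polval p eps h pi \- locval p eps pib h L).

Definition sup_gap p eps h L v pi : R :=
  sup [set gap p eps h v pi x | x in cube (L - h)].

Definition opR p eps (pib : Rd -> Rm) h L v x : R :=
  if `[< cube (L - h) x >] then opF p eps h v x else opL p eps h pib v x.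

End Control.

(* Main.v *)
(* Writing [A^pi v = mu v - Lam P^pi v] with [P^pi] the step of the jump chain, every
   discrete estimate is an instance of the comparison principle for [A^pi], a strict
   contraction of ratio [gam = Lam / mu].  A function with small residual on a box is
   controlled inside by [gam] to the number of steps needed to reach the strip.

   On the penalty: [p^2 <= R p] gives the upper bounds from those for [p], and
   [p^2 >= 2 s p - s^2] with [s] of order [eps] bounds the value for [p^2] at [eps]
   from below by the value for [p] at a fixed small parameter, up to a term of order
   [eps]; hence (i) follows from the convergence known for [p].

   For (LOC), use the policy that is nearly greedy for the discrete value [vF] inside
   the box and [pib] outside.  Its value exceeds [vF] by at most
   [Cext / (h eps)] times the discounted occupation of the outside.  The chain must
   cross the region far from the domain for about [D_L / h] steps before leaving, so
   this occupation is at most [4 exp(-lam D_L / (4 d N))] times the occupation of the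
   far region, which the penalty bounds by [eps / c] times the value itself.  Under
   (SM) the excess is therefore at most [h / 3] times the value. *)

(* The policy operator, the Bellman operator and the localized one are cases of a single pointwise
   supremum of affine operators, [mixR], so existence, comparison and propagation are proved once.
   Expectations enter only where the statement speaks of the chain: elsewhere a discounted sum of
   [phi] along the chain is the bounded Borel solution V of opA V = phi, and [discounted_le] and
   [le_discounted] translate between the two.

   In (LOC) the factor 1/eps of the excess cancels against the eps of the occupation bound, so (SM)
   is free of eps. Its 12 is 2 * 2 * 3: a 2 because from outside the inner box the far region
   collects at least half of the total discounted time 1/lam, a 2 for rounding D_L / h down to an
   integer, and a 3 so that S <= v + (h/3) S can be solved for S when h <= 1. The outcome is
   relative, h times the discrete value; the leakage bound for [pib] with h <= eps makes it
   absolute.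

   On the continuous side the integrands along trajectories are not known to be measurable and the
   sets of costs may be empty, which dictates the form of the integral lemmas and of the bounds on
   values. *)
Require Import Defs.
From HB Require Import structures.
From mathcomp Require Import all_boot all_order all_algebra.
From mathcomp Require Import all_classical all_reals all_analysis.
From mathcomp Require Import measurable_realfun ring lra.
Set Implicit Arguments.
Unset Strict Implicit.
Unset Printing Implicit Defensive.
Import Order.TTheory GRing.Theory Num.Theory.
Import numFieldNormedType.Exports.
Local Open Scope classical_set_scope.
Local Open Scope ring_scope.

(** * Euclidean norm, distances and cubes *)

Section EuclideanNorm.
Context {R : realType} {d : nat}.
Implicit Types (x y z : 'rV[R]_d) (A B : set 'rV[R]_d).

Lemma dotvC x y : dotv x y = dotv y x.
Proof. by apply: eq_bigr => i _; rewrite mulrC. Qed.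

Lemma dotvDl x y z : dotv (x + y) z = dotv x z + dotv y z.
Proof. by rewrite -big_split; apply: eq_bigr => i _; rewrite mxE mulrDl. Qed.

Lemma dotvZl k x y : dotv (k *: x) y = k * dotv x y.
Proof. by rewrite mulr_sumr; apply: eq_bigr => i _; rewrite mxE mulrA. Qed.

Lemma dotvNl x y : dotv (- x) y = - dotv x y.
Proof. by rewrite -scaleN1r dotvZl mulN1r. Qed.

Lemma dotvBr x y z : dotv x (y - z) = dotv x y - dotv x z.
Proof. by rewrite dotvC dotvDl dotvNl ![dotv _ x]dotvC. Qed.

Lemma dotv_ge0 x : 0 <= dotv x x.
Proof. by apply: sumr_ge0 => i _; rewrite -expr2 sqr_ge0. Qed.

Lemma enorm_ge0 x : 0 <= enorm x.
Proof. exact: sqrtr_ge0. Qed.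

Lemma enorm_sqr x : enorm x ^+ 2 = dotv x x.
Proof. by rewrite sqr_sqrtr ?dotv_ge0. Qed.

Lemma ler_coord_enorm x i : `|x 0 i| <= enorm x.
Proof.
rewrite -sqrtr_sqr ler_sqrt ?dotv_ge0// /dotv (bigD1 i)//= -expr2 lerDl.
by apply: sumr_ge0 => j _; rewrite -expr2 sqr_ge0.
Qed.

Lemma enorm_eq0 x : enorm x = 0 -> x = 0.
Proof.
move=> x0; apply/rowP => i; rewrite mxE; apply/eqP; rewrite -normr_eq0.
by rewrite eq_le normr_ge0 -x0 ler_coord_enorm.
Qed.

(** Cauchy-Schwarz, by expanding the square of [enorm y *: x - enorm x *: y]. *)
Lemma dotv_le x y : dotv x y <= enorm x * enorm y.
Proof.
have [/enorm_eq0->|x0] := eqVneq (enorm x) 0.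
  by rewrite -{1}(scale0r (0 : 'rV[R]_d)) dotvZl mul0r mulr_ge0 ?enorm_ge0.
have [/enorm_eq0->|y0] := eqVneq (enorm y) 0.
  by rewrite dotvC -{1}(scale0r (0 : 'rV[R]_d)) dotvZl mul0r mulr_ge0 ?enorm_ge0.
have st0 : 0 < enorm x * enorm y by rewrite mulr_gt0// lt_def enorm_ge0 ?x0 ?y0.
have := dotv_ge0 (enorm y *: x - enorm x *: y).
rewrite dotvBr dotvC (dotvC _ (enorm x *: y)) !dotvBr !dotvZl.
rewrite !(dotvC _ (_ *: _)) !dotvZl -!enorm_sqr (dotvC y x) => H.
by rewrite -(ler_pM2l st0); move: H; set s := enorm x; set t := enorm y; nra.
Qed.

Lemma normr_dotv_le x y : `|dotv x y| <= enorm x * enorm y.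
Proof.
rewrite ler_norml dotv_le andbT lerNl -dotvNl (le_trans (dotv_le _ _))//.
by rewrite /enorm dotvNl dotvC dotvNl opprK.
Qed.

Lemma enormZ k x : enorm (k *: x) = `|k| * enorm x.
Proof.
rewrite /enorm dotvZl dotvC dotvZl mulrA -expr2.
by rewrite sqrtrM ?sqr_ge0// sqrtr_sqr.
Qed.

Lemma enormN x : enorm (- x) = enorm x.
Proof. by rewrite -scaleN1r enormZ normrN1 mul1r. Qed.

Lemma enormB x y : enorm (x - y) = enorm (y - x).
Proof. by rewrite -enormN opprB. Qed.

Lemma enorm0 : enorm (0 : 'rV[R]_d) = 0.
Proof. by rewrite -(scale0r (0 : 'rV[R]_d)) enormZ normr0 mul0r. Qed.

Lemma enormD x y : enorm (x + y) <= enorm x + enorm y.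
Proof.
rewrite -(@ler_pXn2r _ 2) ?nnegrE ?addr_ge0 ?enorm_ge0//.
rewrite enorm_sqr dotvDl dotvC dotvDl (dotvC y (x + y)) dotvDl -!enorm_sqr.
rewrite (dotvC y x); have := dotv_le x y.
by set s := enorm x; set t := enorm y; nra.
Qed.

Lemma enorm_triangle z x y : enorm (x - y) <= enorm (x - z) + enorm (z - y).
Proof. by apply: le_trans (enormD _ _); rewrite addrA subrK. Qed.

Lemma enorm_delta (i : 'I_d) : enorm (delta_mx 0 i : 'rV[R]_d) = 1.
Proof.
rewrite /enorm /dotv (bigD1 i)//= big1 ?addr0 => [|j ji].
  by rewrite !mxE !eqxx mulr1 sqrtr1.
by rewrite !mxE eqxx (negbTE ji) mulr0.
Qed.

Lemma enorm_le_coord x c : 0 <= c -> (forall i, `|x 0 i| <= c) ->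
  enorm x <= Num.sqrt d%:R * c.
Proof.
move=> c0 xc; rewrite -(ger0_norm c0) -sqrtr_sqr -sqrtrM ?ler0n//.
rewrite ler_sqrt ?mulr_ge0 ?ler0n ?sqr_ge0// /dotv.
rewrite (@le_trans _ _ (\sum_(i < d) c ^+ 2))//; last first.
  by rewrite sumr_const card_ord mulr_natl.
apply: ler_sum => i _; rewrite -expr2 -[X in X <= _]real_normK ?num_real//.
by rewrite ler_pXn2r ?nnegrE.
Qed.

Lemma normr_le_enorm x : `|x| <= enorm x.
Proof.
rewrite [leLHS]/Num.norm /= mx_normrE; apply/bigmax_leP; split; first exact: enorm_ge0.
by move=> [i j] _ /=; rewrite (ord1 i) ler_coord_enorm.
Qed.

Lemma normr_coord_le x i : `|x 0 i| <= `|x|.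
Proof.
by rewrite [leRHS]/Num.norm /= mx_normrE; apply/bigmax_geP; right; exists (0, i).
Qed.

Lemma enorm_le_normr x : enorm x <= Num.sqrt d%:R * `|x|.
Proof. by apply: enorm_le_coord => // i; exact: normr_coord_le. Qed.

Lemma lipschitz_continuous (g : 'rV[R]_d -> R) k : 0 <= k ->
  (forall x y, `|g x - g y| <= k * enorm (x - y)) -> continuous g.
Proof.
move=> k0 gk x B /nbhs_ballP[e /= e0 eB].
pose c := k * Num.sqrt d%:R + 1.
have c0 : 0 < c by rewrite ltr_wpDl// mulr_ge0// sqrtr_ge0.
apply/nbhs_ballP; exists (e / c) => [/=|y]; first by rewrite divr_gt0.
rewrite mx_norm_ball /ball_ /= ltr_pdivlMr// => xy; apply: eB.
rewrite /ball/= (le_lt_trans (gk _ _))//.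
rewrite (le_lt_trans (ler_wpM2l k0 (enorm_le_normr _)))//.
by rewrite mulrA (le_lt_trans _ xy)// [leRHS]mulrC ler_wpM2r// lerDl.
Qed.

(** The topology on row vectors is that of the sup norm; equivalence of the two norms transfers it
    to Euclidean distances. The [+ 1] in the proof keeps the divisor positive even for d = 0. *)
Lemma closure_enorm A x :
  closure A x <-> forall e, 0 < e -> exists2 y, A y & enorm (x - y) < e.
Proof.
split=> [Ax e e0|H B /nbhs_ballP[e /= e0 eB]].
  have c0 : 0 < Num.sqrt d%:R + 1 :> R by rewrite ltr_wpDl ?sqrtr_ge0.
  have e1 : 0 < e / (Num.sqrt d%:R + 1) by rewrite divr_gt0.
  have [y [Ay]] := Ax _ (nbhsx_ballx x _ e1).
  rewrite mx_norm_ball /ball_ /= ltr_pdivlMr// => xy; exists y => //.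
  rewrite (le_lt_trans (enorm_le_normr _))//.
  rewrite (le_lt_trans _ xy)// mulrC ler_wpM2l// lerDl//.
have [y Ay xy] := H e e0; exists y; split => //; apply: eB.
by rewrite mx_norm_ball /ball_ /= (le_lt_trans (normr_le_enorm _)).
Qed.

Section Dist.
Variable (A : set 'rV[R]_d).
Hypothesis A0 : A !=set0.

Lemma dist_ge0 x : 0 <= dist x A.
Proof.
have [a Aa] := A0; apply: lb_le_inf; first by exists (enorm (x - a)), a.
by move=> _ [y _ <-]; exact: enorm_ge0.
Qed.

Lemma dist_le x y : A y -> dist x A <= enorm (x - y).
Proof.
move=> Ay; apply: ge_inf; last by exists y.
by exists 0 => _ [z _ <-]; exact: enorm_ge0.
Qed.

Lemma dist_ge x c : (forall y, A y -> c <= enorm (x - y)) -> c <= dist x A.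
Proof.
have [a Aa] := A0 => H; apply: lb_le_inf; first by exists (enorm (x - a)), a.
by move=> _ [y Ay <-]; exact: H.
Qed.

Lemma dist_leD x y : dist x A <= dist y A + enorm (x - y).
Proof.
rewrite -lerBlDr; apply: dist_ge => z Az; rewrite lerBlDr.
rewrite (le_trans (dist_le _ Az))// (addrC (enorm _)); exact: enorm_triangle.
Qed.

Lemma dist_lipschitz x y : `|dist x A - dist y A| <= enorm (x - y).
Proof.
have := dist_leD x y; have := dist_leD y x; rewrite (enormB y x) ler_norml.
by set u := dist x A; set v := dist y A; lra.
Qed.

Lemma dist_eq0 x : dist x A = 0 <-> closure A x.
Proof.
split=> [x0|Ax].
  apply/closure_enorm => e e0.
  have hi : has_inf [set enorm (x - y) | y in A].
    split; first by have [a Aa] := A0; exists (enorm (x - a)), a.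
    by exists 0 => _ [z _ <-]; exact: enorm_ge0.
  have [_ [y Ay <-]] := inf_adherent e0 hi.
  by rewrite -/(dist x A) x0 add0r; exists y.
apply/eqP; rewrite eq_le dist_ge0 andbT; apply/ler_addgt0Pr => e e0.
have [y Ay xy] := (closure_enorm A x).1 Ax e e0.
by rewrite add0r (le_trans (dist_le _ Ay))// ltW.
Qed.

End Dist.

Section Supn.
Variables (D : set 'rV[R]_d) (z : 'rV[R]_d -> R).

Lemma supn_ge0 : 0 <= supn D z.
Proof.
(* A supremum that does not exist, of an empty or unbounded set, is 0. *)
rewrite /supn; have [hs|hs] := pselect (has_sup [set `|z x| | x in D]); last first.
  by rewrite sup_out.
have [[_ [x Dx _]] ub] := hs.
by rewrite (le_trans (normr_ge0 (z x)))// ub_le_sup//; exists x.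
Qed.

Lemma supn_le c : 0 <= c -> (forall x, D x -> `|z x| <= c) -> supn D z <= c.
Proof.
move=> c0 H; have [[x Dx]|D0] := pselect (D !=set0).
  by apply: ge_sup; [exists `|z x|, x|move=> _ [y Dy <-]; exact: H].
rewrite /supn sup_out// => -[[_ [x Dx _]]] _; by apply: D0; exists x.
Qed.

Lemma le_supn c x : (forall x, D x -> `|z x| <= c) -> D x -> `|z x| <= supn D z.
Proof.
move=> H Dx; apply: ub_le_sup; last by exists x.
by exists c => _ [y Dy <-]; exact: H.
Qed.

End Supn.

Lemma cube_le (L1 L2 : R) : L1 <= L2 -> cube L1 `<=` (cube L2 : set 'rV[R]_d).
Proof.
move=> L12 x xL i; have /andP[a b] := xL i.
by rewrite (le_trans b)// andbT (le_trans _ a)// lerN2.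
Qed.

Lemma cube0 (L : R) : 0 <= L -> cube L (0 : 'rV[R]_d).
Proof. by move=> L0 i; rewrite mxE L0 oppr_le0 L0. Qed.

Lemma cube_const (L : R) : 0 <= L -> cube L (const_mx L : 'rV[R]_d).
Proof. by move=> L0 i; rewrite mxE lexx andbT (le_trans _ L0)// oppr_le0. Qed.

Lemma cube_norm (L : R) (x : 'rV[R]_d) : cube L x <-> forall i, `|x 0 i| <= L.
Proof. by split=> H i; [rewrite ler_norml; exact: H|rewrite -ler_norml]. Qed.

Lemma closed_cube (L : R) : closed (cube L : set 'rV[R]_d).
Proof.
move=> x /closure_enorm xL; apply/cube_norm => i; apply/ler_addgt0Pr => e e0.
have [y /cube_norm yL xy] := xL e e0.
rewrite -[x](subrK y) mxE (le_trans (ler_normD _ _))// addrC lerD//.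
by rewrite (le_trans (ler_coord_enorm _ _))// ltW.
Qed.

End EuclideanNorm.

(** * The walk and its comparison principle *)

Section Walk.
Context {R : realType} {d m : nat} (M : model R d m).
Hypotheses (d_gt0 : (0 < d)%N) (st : standing M).
Local Notation Rd := 'rV[R]_d.
Local Notation b := (drift M).
Local Notation f := (rcost M).
Local Notation N := (Nv M).
Local Notation dR := (d%:R : R).
Local Notation lm := (lam M).
Implicit Types (x y : Rd) (u v z : Rd -> R).

Definition nbr (h : R) x y :=
  exists i, y = x + h *: delta_mx 0 i \/ y = x - h *: delta_mx 0 i.

(** The expectation of [v] after one jump from [x], with the action as an argument: Bellman
    operators pick it point by point. *)
Definition stepP (h : R) a v x : R :=
  \sum_(i < d) ((N + b x a 0 i / 2) / (2 * dR * N) * v (x + h *: delta_mx 0 i)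
              + (N - b x a 0 i / 2) / (2 * dR * N) * v (x - h *: delta_mx 0 i)).

Lemma nbr_dist h x y : 0 <= h -> nbr h x y -> enorm (x - y) = h.
Proof.
move=> h0 [i [->|->]].
  by rewrite opprD addrA subrr add0r enormN enormZ enorm_delta mulr1 ger0_norm.
by rewrite opprB addrC subrK enormZ enorm_delta mulr1 ger0_norm.
Qed.

Let N0 : 0 < N := visc_gt0 st.
Let dR0 : 0 < dR. Proof. by rewrite ltr0n. Qed.
Let lm0 : 0 < lm := lam_gt0 st.

(** Monotonicity of the scheme: the viscosity N h outweighs the centred drift differences because
    [N] dominates |b_i| / 2. *)
Lemma weight_ge0 x a i : Act M a -> 0 <= (N + b x a 0 i / 2) / (2 * dR * N) /\
  0 <= (N - b x a 0 i / 2) / (2 * dR * N).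
Proof.
move=> Aa; have := visc_bound st x i Aa; move: N0 => n0.
rewrite ler_pdivrMr// ler_norml => /andP[bl bu].
have w0 : 0 <= 2 * dR * N by rewrite !mulr_ge0// ltW.
by split; rewrite mulr_ge0// ?invr_ge0//; lra.
Qed.

Lemma stepP_cst h a x c : stepP h a (fun=> c) x = c.
Proof.
rewrite /stepP (eq_bigr (fun=> dR^-1 * c)).
  by rewrite sumr_const card_ord -(mulr_natl (_ * _)) mulrA divff ?mul1r ?gt_eqF.
by move=> i _; field; rewrite !gt_eqF.
Qed.

Lemma stepPD h a u v x :
  stepP h a (fun y => u y + v y) x = stepP h a u x + stepP h a v x.
Proof. by rewrite /stepP -big_split; apply: eq_bigr => i _ /=; ring. Qed.

Lemma stepPZ h a k v x : stepP h a (fun y => k * v y) x = k * stepP h a v x.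
Proof. by rewrite /stepP mulr_sumr; apply: eq_bigr => i _ /=; ring. Qed.

Lemma stepPB h a u v x :
  stepP h a (fun y => u y - v y) x = stepP h a u x - stepP h a v x.
Proof. by rewrite /stepP -sumrB; apply: eq_bigr => i _ /=; ring. Qed.

Lemma stepP_le h a u v x : Act M a -> (forall y, nbr h x y -> u y <= v y) ->
  stepP h a u x <= stepP h a v x.
Proof.
move=> Aa uv; apply: ler_sum => i _; have [w1 w2] := weight_ge0 x i Aa.
by apply: lerD; apply: ler_wpM2l => //; apply: uv; exists i; [left|right].
Qed.

Lemma stepP_eq h a u v x : Act M a -> (forall y, nbr h x y -> u y = v y) ->
  stepP h a u x = stepP h a v x.
Proof.
by move=> Aa uv; apply/eqP; rewrite eq_le !stepP_le// => y /uv->.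
Qed.

Lemma stepP_ub h a v x C : Act M a -> (forall y, nbr h x y -> v y <= C) ->
  stepP h a v x <= C.
Proof. by move=> Aa vC; rewrite -[leRHS](stepP_cst h a x) stepP_le. Qed.

Lemma stepP_lb h a v x C : Act M a -> (forall y, nbr h x y -> C <= v y) ->
  C <= stepP h a v x.
Proof. by move=> Aa vC; rewrite -[leLHS](stepP_cst h a x) stepP_le. Qed.

Lemma stepP_norm h a v x C : Act M a -> (forall y, nbr h x y -> `|v y| <= C) ->
  `|stepP h a v x| <= C.
Proof.
move=> Aa vC; rewrite ler_norml stepP_lb ?stepP_ub// => y /vC.
  by rewrite ler_norml => /andP[].
by rewrite ler_norml => /andP[].
Qed.

Section Mesh.
Variable h : R.
Hypothesis h0 : 0 < h.
Local Notation mu := (muh M h).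
Local Notation Lam := (Lamh M h).
Local Notation gam := (gamh M h).

Lemma Lamh_gt0 : 0 < Lam.
Proof. by rewrite /Lamh divr_gt0// !mulr_gt0. Qed.

Lemma muh_gt0 : 0 < mu.
Proof. by rewrite /muh addr_gt0// Lamh_gt0. Qed.

Lemma gamh_gt0 : 0 < gam.
Proof. by rewrite divr_gt0// ?Lamh_gt0 ?muh_gt0. Qed.

Lemma gamh_ge0 : 0 <= gam. Proof. exact/ltW/gamh_gt0. Qed.

Lemma gamh_lt1 : gam < 1.
Proof. by rewrite ltr_pdivrMr ?muh_gt0// mul1r /muh ltrDr. Qed.

Lemma gamh_mu : gam * mu = Lam.
Proof. by rewrite /gamh mulfVK// gt_eqF// muh_gt0. Qed.

Lemma onesub_gamh : 1 - gam = lm / mu.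
Proof.
have := muh_gt0; rewrite /gamh => mu0; rewrite -{1}(divff (lt0r_neq0 mu0)) -mulrBl.
by rewrite {1}/muh addrK.
Qed.

(** Collecting the centred differences and the viscosity gives the neighbours x + h e_i and x - h
    e_i the rates N/h + b_i/(2h) and N/h - b_i/(2h), which sum to [Lam]. *)
Lemma opA_step pi v x :
  opA M h pi v x = mu * v x - Lam * stepP h (pi x) v x.
Proof.
rewrite /opA /muh mulrDl /dotv /lapl /stepP.
have -> : Lam * v x = \sum_(i < d) (2 * N / h * v x).
  by rewrite sumr_const card_ord -(mulr_natl (_ * _)) /Lamh; ring.
rewrite -!addrA; congr (_ + _); rewrite !mulr_sumr -!sumrN -!big_split/=.
apply: eq_bigr => i _; rewrite mxE /Lamh; field.
by rewrite !gt_eqF.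
Qed.

Lemma opAB pi u v x :
  opA M h pi (fun y => u y - v y) x = opA M h pi u x - opA M h pi v x.
Proof. by rewrite !opA_step stepPB; ring. Qed.

Lemma opAD pi u v x :
  opA M h pi (fun y => u y + v y) x = opA M h pi u x + opA M h pi v x.
Proof. by rewrite !opA_step stepPD; ring. Qed.

Lemma opAZ pi k v x : opA M h pi (fun y => k * v y) x = k * opA M h pi v x.
Proof. by rewrite !opA_step stepPZ; ring. Qed.

Lemma opA_cst pi c x : opA M h pi (fun=> c) x = lm * c.
Proof. by rewrite opA_step stepP_cst /muh; ring. Qed.

Lemma opA_stepE pi v x : v x = opA M h pi v x / mu + gam * stepP h (pi x) v x.
Proof.
by rewrite opA_step mulrBl mulrAC divff ?gt_eqF ?muh_gt0// mul1r /gamh; ring.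
Qed.

Lemma opA_ub pi v x g C : Act M (pi x) -> opA M h pi v x <= g ->
  (forall y, nbr h x y -> v y <= C) -> v x <= g / mu + gam * C.
Proof.
move=> Ap vg vC; rewrite (opA_stepE pi) lerD//.
  by rewrite ler_pM2r// invr_gt0 muh_gt0.
by rewrite ler_wpM2l ?gamh_ge0// stepP_ub.
Qed.

Lemma opA_lb pi v x g C : Act M (pi x) -> g <= opA M h pi v x ->
  (forall y, nbr h x y -> C <= v y) -> g / mu + gam * C <= v x.
Proof.
move=> Ap vg vC; rewrite [leRHS](opA_stepE pi) lerD//.
  by rewrite ler_pM2r// invr_gt0 muh_gt0.
by rewrite ler_wpM2l ?gamh_ge0// stepP_lb.
Qed.

(** The supremum S of [z] satisfies S <= gam max(S, 0), hence S <= 0. The hypothesis mentions no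
    operator, so that linear differences, Bellman differences and absolute values are all
    admissible. *)
Lemma walk_max z B : (forall x, z x <= B) ->
  (forall x C, 0 <= C -> (forall y, z y <= C) -> z x <= gam * C) ->
  forall x, z x <= 0.
Proof.
move=> zB H x; pose S := sup (range z).
have zS y : z y <= S by apply: ub_le_sup; [exists B => _ [w _ <-]|exists y].
have := @ge_sup _ (range z) (gam * Num.max S 0).
rewrite -/S => SC; have {}SC : S <= gam * Num.max S 0.
  apply: SC; first by exists (z x), x.
  move=> _ [y _ <-]; apply: H; first by rewrite le_max lexx orbT.
  by move=> w; rewrite le_max zS.
rewrite (le_trans (zS x))// leNgt; apply/negP => S0; move: SC.
by rewrite (max_l (ltW S0)) leNgt -[ltRHS]mul1r ltr_pM2r// gamh_lt1.
Qed.

Lemma opA_max pi z B : (forall x, Act M (pi x)) -> (forall x, z x <= B) ->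
  (forall x, opA M h pi z x <= 0) -> forall x, z x <= 0.
Proof.
move=> Ap zB Az; apply: (walk_max zB) => x C C0 zC.
by have := opA_ub (Ap x) (Az x) (fun y _ => zC y); rewrite mul0r add0r.
Qed.

Lemma opA_comparison pi u v B : (forall x, Act M (pi x)) ->
  (forall x, `|u x| <= B) -> (forall x, `|v x| <= B) ->
  (forall x, opA M h pi u x <= opA M h pi v x) -> forall x, u x <= v x.
Proof.
move=> Ap uB vB uv x; rewrite -subr_le0.
apply: (opA_max (z := fun y => u y - v y) (B := B + B) Ap) => y.
  have := uB y; have := vB y; rewrite !ler_norml => /andP[? ?] /andP[? ?]; lra.
by rewrite opAB subr_le0.
Qed.

Lemma opA_sup_le pi z g B : (forall x, Act M (pi x)) -> (forall x, z x <= B) ->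
  (forall x, opA M h pi z x <= g) -> forall x, z x <= g / lm.
Proof.
move=> Ap zB Az x; rewrite -subr_le0.
apply: (opA_max (z := fun y => z y - g / lm) (B := B - g / lm) Ap) => y.
  by rewrite lerB.
by rewrite opAB opA_cst mulrCA divff ?gt_eqF// mulr1 subr_le0.
Qed.

End Mesh.
End Walk.

(** * Borel measurability *)

Section BorelMeasurability.
Context {R : realType}.

Lemma measurable_gt_fun d0 (T : measurableType d0) (g : T -> R) :
  (forall c, measurable [set x | c < g x]) -> measurable_fun setT g.
Proof.
move=> mg; apply: (measurability _ (RGenOInfty.measurableE R)).
by move=> _ [_ [c ->] <-]; rewrite setTI preimage_itvoy; exact: mg.
Qed.

Lemma measurable_fun_gt d0 (T : measurableType d0) (g : T -> R) c :
  measurable_fun setT g -> measurable [set x | c < g x].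
Proof.
move=> mg; rewrite -preimage_itvoy -[X in measurable X]setTI.
by apply: mg => //; exact: measurable_itv.
Qed.

Lemma open_borel (T : ptopologicalType) (U : set T) :
  open U -> measurable (U : set (Borel T)).
Proof. exact: sub_sigma_algebra. Qed.

Lemma continuous_borel (T1 T2 : ptopologicalType) (g : T1 -> T2) :
  continuous g -> measurable_fun setT (g : Borel T1 -> Borel T2).
Proof.
move=> /continuousP cg.
apply: (@measurability _ _ (Borel T1) (Borel T2) setT g (@open T2) erefl).
by move=> _ [U oU <-]; rewrite setTI; apply: open_borel; exact: cg.
Qed.

Lemma continuous_borel_real (T : ptopologicalType) (g : T -> R) :
  continuous g -> measurable_fun setT (g : Borel T -> R).
Proof.
move=> /continuousP cg; apply: measurable_gt_fun => c; apply: open_borel.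
by have := cg _ (@open_gt R c).
Qed.

Lemma measurable_countable_bigcup d0 (T : measurableType d0) (I : countType)
  (F : I -> set T) : (forall i, measurable (F i)) ->
  measurable [set x | exists i, F i x].
Proof.
move=> mF; pose G k := if unpickle k is Some i then F i else set0.
rewrite [X in measurable X](_ : _ = \bigcup_k G k).
  by apply: bigcupT_measurable => k; rewrite /G; case: unpickle.
apply/seteqP; split=> [x [i Fx]|x [k _]]; rewrite /G.
  by exists (pickle i) => //; rewrite pickleK.
by case: unpickle => // i Fx; exists i.
Qed.

Definition ratv n (q : 'rV[rat]_n) : 'rV[R]_n := map_mx ratr q.

Lemma rat_dense n (x : 'rV[R]_n) (e : R) : 0 < e ->
  exists q : 'rV[rat]_n, forall i, `|x 0 i - ratv q 0 i| < e.
Proof.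
move=> e0; have H i : exists r : rat, `|x 0 i - ratr r| < e.
  have [r] := @rat_in_itvoo R (x 0 i - e) (x 0 i + e) ltac:(lra).
  by rewrite in_itv/= => /andP[r1 r2]; exists r; rewrite ltr_norml; lra.
exists (\row_i projT1 (cid (H i))) => i.
by rewrite !mxE; case: cid.
Qed.

Lemma rat_dense_enorm n (x : 'rV[R]_n) (e : R) : 0 < e ->
  exists q : 'rV[rat]_n, enorm (x - ratv q) < e.
Proof.
move=> e0; have c0 : 0 < Num.sqrt n%:R + 1 :> R by rewrite ltr_wpDl ?sqrtr_ge0.
have [|q xq] := @rat_dense n x (e / (Num.sqrt n%:R + 1)); first by rewrite divr_gt0.
exists q; rewrite (@le_lt_trans _ _ (Num.sqrt n%:R * (e / (Num.sqrt n%:R + 1))))//.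
  apply: enorm_le_coord => [|i]; first by rewrite ltW// divr_gt0.
  by have := xq i; rewrite !mxE => /ltW.
by rewrite mulrCA gtr_pMr// ltr_pdivrMr// mul1r ltrDl.
Qed.

(* {x | c < Phi x (g x)} is the union over rational q of the sets
   {x | c + k |g x - q| < Phi x q}. *)
Lemma measurable_lipschitz_comp d0 (T : measurableType d0) n
    (Phi : T -> 'rV[R]_n -> R) (k : R) (g : T -> 'rV[R]_n) : 0 <= k ->
  (forall q, measurable_fun setT (Phi^~ q)) ->
  (forall x p q, `|Phi x p - Phi x q| <= k * enorm (p - q)) ->
  (forall i, measurable_fun setT (fun x => g x 0 i)) ->
  measurable_fun setT (fun x => Phi x (g x)).
Proof.
move=> k0 mPhi lPhi mg; apply: measurable_gt_fun => c.
pose s x q : R := k * (Num.sqrt n%:R * \sum_(i < n) `|g x 0 i - ratv q 0 i|).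
have gq x q : k * enorm (g x - ratv q) <= s x q.
  rewrite ler_wpM2l// enorm_le_coord ?sumr_ge0// => i.
  rewrite (_ : (g x - ratv q) 0 i = g x 0 i - ratv q 0 i); last by rewrite !mxE.
  by rewrite (bigD1 i)//= lerDl sumr_ge0.
rewrite [X in measurable X](_ : _ =
    [set x | exists q, 0 < Phi x (ratv q) - s x q - c]); last first.
  apply/seteqP; split=> x /=; last first.
    move=> [q cq]; have := lPhi x (g x) (ratv q); have := gq x q; rewrite ler_norml; lra.
  move=> cx; pose C := k * (Num.sqrt n%:R * n%:R) + 1.
  have C0 : 0 < C by rewrite ltr_wpDl// !mulr_ge0// sqrtr_ge0.
  have e0 : 0 < (Phi x (g x) - c) / (2 * C).
    by rewrite divr_gt0 ?mulr_gt0// subr_gt0.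
  have [q xq] := rat_dense (g x) e0; exists q.
  have sq : s x q < (Phi x (g x) - c) / 2.
    rewrite (@le_lt_trans _ _ (k * (Num.sqrt n%:R * n%:R) *
        ((Phi x (g x) - c) / (2 * C))))//.
      rewrite /s -!mulrA ler_wpM2l// ler_wpM2l ?sqrtr_ge0//.
      rewrite (@le_trans _ _ (\sum_(i < n) ((Phi x (g x) - c) / (2 * C))))//.
        by apply: ler_sum => i _; rewrite ltW.
      by rewrite sumr_const card_ord -(mulr_natl (_ * _)).
    rewrite (@lt_le_trans _ _ (C * ((Phi x (g x) - c) / (2 * C))))//.
      by rewrite ltr_pM2r// /C ltrDl.
    by rewrite invfM mulrCA (mulrCA C) divff ?gt_eqF// mulr1.
  have := lPhi x (g x) (ratv q); have := gq x q; rewrite ler_norml; lra.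
apply: measurable_countable_bigcup => q; apply: measurable_fun_gt.
apply: measurable_funB; last exact: measurable_cst.
apply: measurable_funB; first exact: mPhi.
do 2 apply: measurable_funM => //; apply: measurable_sum => i.
by apply: measurableT_comp => //; apply: measurable_funB.
Qed.

(** For each rational vector and each radius 1/(k+1), keep one point of [A] within that radius
    whenever there is one. *)
Lemma countable_dense n (A : set 'rV[R]_n) : A !=set0 ->
  exists s : nat -> 'rV[R]_n, (forall k, A (s k)) /\
    forall a (e : R), A a -> 0 < e -> exists k, enorm (a - s k) < e.
Proof.
move=> [a0 Aa0].
pose P (qk : 'rV[rat]_n * nat) a := A a /\ enorm (a - ratv qk.1) < qk.2.+1%:R^-1.
pose t qk := if pselect (exists a, P qk a) is left H then projT1 (cid H) else a0.
have At qk : A (t qk).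
  by rewrite /t; case: pselect => // H; case: cid => a [].
exists (fun k => if unpickle k is Some qk then t qk else a0); split.
  by move=> k; case: unpickle.
move=> a e Aa e0; have [k] : exists k, 0 + k.+1%:R^-1 < e / 2.
  by apply: ltr_add_invr; rewrite divr_gt0.
have k0 : 0 < k.+1%:R^-1 :> R by rewrite invr_gt0.
rewrite add0r => ke; have [q aq] := rat_dense_enorm a k0.
exists (pickle (q, k)); rewrite pickleK /t; case: pselect => [H|[]]; last by exists a.
case: cid => a' [/= Aa' a'q] /=; rewrite (le_lt_trans (enorm_triangle (ratv q) _ _))//.
by move: ke aq a'q; rewrite (enormB (ratv q)) /=; set r := _^-1; lra.
Qed.

End BorelMeasurability.

(** * Hamiltonian and near-greedy policies *)

Section Hamiltonian.
Context {R : realType} {d m : nat} (M : model R d m).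
Hypotheses (d_gt0 : (0 < d)%N) (st : standing M).
Local Notation Rd := 'rV[R]_d.
Local Notation Rm := 'rV[R]_m.
Local Notation A := (Act M).
Local Notation b := (drift M).
Local Notation f := (rcost M).
Local Notation N := (Nv M).
Implicit Types (x y q : Rd) (v p : Rd -> R) (pi : Rd -> Rm) (h eps eta e r c : R).

Lemma supb_ub x a : A a -> enorm (b x a) <= supb M.
Proof.
move=> Aa; apply: ub_le_sup; last by exists x => //; exists a.
by have [c cb] := drift_bounded st; exists c => _ [y _ [a' Aa' <-]]; exact: cb.
Qed.

Lemma supf_ub x a : A a -> f x a <= supf M.
Proof.
move=> Aa; rewrite -[leLHS]ger0_norm ?(rcost_ge0 st)//.
apply: ub_le_sup; last by exists x => //; exists a.
have [c cf] := rcost_bounded st; exists c => _ [y _ [a' Aa' <-]].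
by rewrite ger0_norm ?(rcost_ge0 st)// cf.
Qed.

Let ham_bound x q a : A a -> - dotv (b x a) q - f x a <= supb M * enorm q.
Proof.
move=> Aa; have := normr_dotv_le (b x a) q; rewrite ler_norml => /andP[+ _].
have := ler_wpM2r (enorm_ge0 q) (supb_ub x Aa); have := rcost_ge0 st x Aa; lra.
Qed.

Lemma ham_ge x q a : A a -> - dotv (b x a) q - f x a <= hamiltonian M x q.
Proof.
move=> Aa; apply: ub_le_sup; last by exists a.
by exists (supb M * enorm q) => _ [a' Aa' <-]; exact: ham_bound.
Qed.

Let large_vector (r : R) : exists q : Rd, r <= enorm q.
Proof.
exists (`|r| *: delta_mx 0 (Ordinal d_gt0)).
by rewrite enormZ enorm_delta mulr1 normr_id ler_norm.
Qed.

(** An empty action set would make the Hamiltonian the supremum of the empty set, which is 0,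
    against coercivity. *)
Lemma act_nonempty : A !=set0.
Proof.
apply: contrapT => A0; have [x Ox] := dom_nonempty st.
have [r /(_ x)] := coercive st 1; have [q rq] := large_vector r.
move=> /(_ q (subset_closure Ox) rq); rewrite /hamiltonian sup_out ?ler10//.
by move=> [[_ [a Aa _]] _]; apply: A0; exists a.
Qed.

(** The Hamiltonian is at most [supb M * enorm q], so a vanishing drift contradicts coercivity as
    well. *)
Lemma supb_gt0 : 0 < supb M.
Proof.
rewrite ltNge; apply/negP => b0; have [x Ox] := dom_nonempty st.
have [r /(_ x)] := coercive st 1; have [q rq] := large_vector r.
move=> /(_ q (subset_closure Ox) rq) /(lt_le_trans ltr01); apply/negP; rewrite -leNgt.
have [a Aa] := act_nonempty; apply: ge_sup; first by exists (- dotv (b x a) q - f x a), a.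
move=> _ [a' Aa' <-]; rewrite (le_trans (ham_bound _ _ Aa'))//.
by rewrite mulr_le0_ge0// enorm_ge0.
Qed.

Lemma supf_ge0 : 0 <= supf M.
Proof.
have [a Aa] := act_nonempty.
exact: le_trans (rcost_ge0 st 0 Aa) (supf_ub _ Aa).
Qed.

Lemma ham_adherent x q eta : 0 < eta ->
  exists2 a, A a & hamiltonian M x q < - dotv (b x a) q - f x a + eta.
Proof.
move=> e0; have [a Aa] := act_nonempty.
have hs : has_sup [set - dotv (b x a) q - f x a | a in A].
  split; first by exists (- dotv (b x a) q - f x a), a.
  by exists (supb M * enorm q) => _ [a' Aa' <-]; exact: ham_bound.
have [_ [a' Aa' <-]] := sup_adherent e0 hs.
by rewrite ltrBlDr => ?; exists a'.
Qed.

Lemma ham_lipschitz_q x q q' :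
  `|hamiltonian M x q - hamiltonian M x q'| <= supb M * enorm (q - q').
Proof.
have H (y y' : Rd) :
    hamiltonian M x y <= hamiltonian M x y' + supb M * enorm (y - y').
  apply/ler_addgt0Pr => eta e0; have [a Aa] := ham_adherent x y e0.
  move=> /ltW/le_trans; apply; have := ham_ge x y' Aa.
  have := normr_dotv_le (b x a) (y - y'); rewrite ler_norml dotvBr => /andP[+ _].
  have := ler_wpM2r (enorm_ge0 (y - y')) (supb_ub x Aa); lra.
have := H q q'; have := H q' q; rewrite (enormB q') ler_norml; lra.
Qed.

Lemma ham_continuous_x q : continuous (fun x => hamiltonian M x q).
Proof.
have [kb _ lb] := drift_lipschitz st; have [kf lf] := rcost_lipschitz st.
pose k := `|kb| * enorm q + `|kf|.
have H x y : hamiltonian M x q <= hamiltonian M y q + k * enorm (x - y).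
  apply/ler_addgt0Pr => eta e0; have [a Aa] := ham_adherent x q e0.
  move=> /ltW/le_trans; apply; have := ham_ge y q Aa.
  have := normr_dotv_le (b x a - b y a) q; rewrite dotvDl dotvNl ler_norml => /andP[+ _].
  have := ler_wpM2r (enorm_ge0 q) (lb a x y Aa).
  have := ler_wpM2r (enorm_ge0 q) (ler_wpM2r (enorm_ge0 (x - y)) (ler_norm kb)).
  have := ler_wpM2r (enorm_ge0 (x - y)) (ler_norm kf).
  have := lf a x y Aa; rewrite ler_norml /k => /andP[+ _].
  set u := enorm (x - y); set w := enorm q; set t := enorm (_ - _); lra.
apply: (@lipschitz_continuous _ _ _ k); first by rewrite addr_ge0 ?mulr_ge0 ?enorm_ge0.
by move=> x y; have := H x y; have := H y x; rewrite (enormB y) ler_norml; lra.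
Qed.

Lemma opL_le_opF p eps h pi v x : A (pi x) ->
  opL M p eps h pi v x <= opF M p eps h v x.
Proof.
by move=> Ap; have := ham_ge x (gradh h v x) Ap; rewrite /opL /opA /opF; lra.
Qed.

Lemma gap_ge0 p eps h pi v x : A (pi x) -> 0 <= gap M p eps h v pi x.
Proof. by move=> Ap; rewrite subr_ge0 opL_le_opF. Qed.

Lemma opF_adherent p eps h v x eta : 0 < eta ->
  exists2 a, A a & opF M p eps h v x < opL M p eps h (fun=> a) v x + eta.
Proof.
move=> /(ham_adherent x (gradh h v x))[a Aa ha]; exists a => //.
by move: ha; rewrite /opL /opA /opF; lra.
Qed.

Lemma gapE p eps h pi v x : gap M p eps h v pi x =
  hamiltonian M x (gradh h v x) + dotv (b x (pi x)) (gradh h v x) + f x (pi x).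
Proof. by rewrite /gap /opF /opL /opA; ring. Qed.

Lemma gap_ub p eps h pi v x : A (pi x) ->
  gap M p eps h v pi x <= 2 * supb M * enorm (gradh h v x) + supf M.
Proof.
move=> Ap; rewrite gapE; have [a Aa] := act_nonempty.
have : hamiltonian M x (gradh h v x) <= supb M * enorm (gradh h v x).
  apply: ge_sup; first by exists (- dotv (b x a) (gradh h v x) - f x a), a.
  by move=> _ [a' Aa' <-]; exact: ham_bound.
have := dotv_le (b x (pi x)) (gradh h v x); have := supf_ub x Ap.
have := ler_wpM2r (enorm_ge0 (gradh h v x)) (supb_ub x Ap); lra.
Qed.

(** The gap depends on the function only through its discrete gradient, once in the Hamiltonian and
    once in the drift term: this is the factor 2 in front of [supb M]. *)
Lemma gap_lipschitz p eps h pi u v x : A (pi x) ->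
  gap M p eps h u pi x <=
  gap M p eps h v pi x + 2 * supb M * enorm (gradh h u x - gradh h v x).
Proof.
move=> Ap; rewrite !gapE.
have := ham_lipschitz_q x (gradh h u x) (gradh h v x); rewrite ler_norml => /andP[_].
have := dotv_le (b x (pi x)) (gradh h u x - gradh h v x); rewrite dotvBr.
have := ler_wpM2r (enorm_ge0 (gradh h u x - gradh h v x)) (supb_ub x Ap); lra.
Qed.

Lemma gradh_bound h v x C : 0 < h -> 0 <= C ->
  (forall y z, nbr h x y -> nbr h x z -> `|v y - v z| <= C) ->
  enorm (gradh h v x) <= Num.sqrt d%:R * (C / (2 * h)).
Proof.
move=> h0 C0 vC; have hh : 0 < 2 * h by rewrite mulr_gt0.
apply: enorm_le_coord => [|i]; first by rewrite divr_ge0// ltW.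
rewrite mxE normrM normfV (gtr0_norm hh) ler_pM2r ?invr_gt0//.
by apply: vC; exists i; [left|right].
Qed.

Lemma gradhB h u v x :
  gradh h u x - gradh h v x = gradh h (fun y => u y - v y) x.
Proof. by apply/rowP => i; rewrite !mxE; ring. Qed.

End Hamiltonian.

Section Measurability.
Context {R : realType} {d m : nat} (M : model R d m).
Hypotheses (d_gt0 : (0 < d)%N) (st : standing M).
Local Notation Rd := 'rV[R]_d.
Local Notation Rm := 'rV[R]_m.
Local Notation A := (Act M).
Local Notation b := (drift M).
Local Notation f := (rcost M).
Local Notation borel_fun v := (measurable_fun setT ((v : Rd -> R) : Borel Rd -> R)).
Implicit Types (x y q : Rd) (v p : Rd -> R) (pi : Rd -> Rm) (h eps eta e r c : R).

Let within_continuous (V : normedModType R) (F : Rd * Rm -> V) x a e :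
  {within [set z : Rd * Rm | A z.2], continuous F} -> A a -> 0 < e ->
  exists2 r : R, 0 < r & forall a', A a' -> ball a r a' -> `|F (x, a) - F (x, a')| < e.
Proof.
move=> /subspace_continuousP cF Aa e0.
have /nbhs_ballP[r /= r0 rF] := cF (x, a) Aa _ (nbhsx_ballx (F (x, a)) _ e0).
exists r => // a' Aa' aa'; have : ball (x, a) r (x, a') by split => //; exact: ballxx.
by move=> /rF /(_ Aa'); rewrite -ball_normE.
Qed.

Let drift_near x i a e : A a -> 0 < e ->
  exists2 r : R, 0 < r & forall a', A a' -> ball a r a' -> `|b x a 0 i - b x a' 0 i| < e.
Proof.
move=> Aa e0; have [r r0 rb] := within_continuous x (drift_cont st) Aa e0.
exists r => // a' Aa' /(rb _ Aa') /=; apply: le_lt_trans.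
by rewrite (_ : _ - _ = (b x a - b x a') 0 i) ?normr_coord_le// !mxE.
Qed.

Let rcost_near x a e : A a -> 0 < e ->
  exists2 r : R, 0 < r & forall a', A a' -> ball a r a' -> `|f x a - f x a'| < e.
Proof. exact: (within_continuous x (rcost_cont st)). Qed.

Let borel_policy_comp (F : Rm -> R) pi : policy M pi ->
  (forall a e, A a -> 0 < e -> exists2 r : R, 0 < r &
    forall a', A a' -> ball a r a' -> `|F a - F a'| < e) ->
  borel_fun (F \o pi).
Proof.
move=> [mpi Api] cF; apply: measurable_gt_fun => c.
(* [F] is continuous only along [A]. The interior of the set where [A a] implies [c < F a] is open
   in the whole space and has the superlevel set as its trace on [A]. *)
have := mpi measurableT _ (open_borel (@open_interior _ [set a | A a -> c < F a])).
rewrite setTI; congr measurable; apply/seteqP; split => x /=.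
  by move=> /interior_subset; apply.
move=> cx; have [|r r0 rF] := cF (pi x) (F (pi x) - c) (Api x); first by rewrite subr_gt0.
apply/nbhs_ballP; exists r => // a' /= xa' Aa'.
by have := rF a' Aa' xa'; rewrite ltr_norml; lra.
Qed.

Lemma coord_borel i : borel_fun (fun x => x 0 i).
Proof. by apply: continuous_borel_real => x; exact: coord_continuous. Qed.

(** One of the two occurrences of the state is frozen: [b q (pi x)] is Borel in [x] for fixed [q]
    and Lipschitz in [q], so q = x may be substituted. *)
Lemma drift_borel pi i : policy M pi -> borel_fun (fun x => b x (pi x) 0 i).
Proof.
move=> mpi; have [k _ lb] := drift_lipschitz st.
apply: (@measurable_lipschitz_comp _ _ (Borel Rd) _ (fun x q => b q (pi x) 0 i)
  `|k| id) => //.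
- by move=> q; apply: (borel_policy_comp (F := fun a => b q a 0 i)) => // a e;
    exact: drift_near.
- move=> x y z; rewrite (_ : _ - _ = (b y (pi x) - b z (pi x)) 0 i); last by rewrite !mxE.
  rewrite (le_trans (ler_coord_enorm _ _))// (le_trans (lb _ _ _ (mpi.2 x)))//.
  by rewrite ler_wpM2r ?enorm_ge0// ler_norm.
- by move=> j; exact: coord_borel.
Qed.

Lemma rcost_borel pi : policy M pi -> borel_fun (fun x => f x (pi x)).
Proof.
move=> mpi; have [k lf] := rcost_lipschitz st.
apply: (@measurable_lipschitz_comp _ _ (Borel Rd) _ (fun x q => f q (pi x))
  `|k| id) => //.
- by move=> q; apply: (borel_policy_comp (F := fun a => f q a)) => // a e;
    exact: rcost_near.
- move=> x y z; rewrite (le_trans (lf _ _ _ (mpi.2 x)))//.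
  by rewrite ler_wpM2r ?enorm_ge0// ler_norm.
- by move=> j; exact: coord_borel.
Qed.

Lemma shift_borel v y : borel_fun v -> borel_fun (fun x => v (x + y)).
Proof.
move=> mv; apply: (@measurableT_comp _ _ _ (Borel Rd) (Borel Rd) R v) => //.
apply: continuous_borel => x B /nbhs_ballP[e e0 eB].
apply/nbhs_ballP; exists e => // z xz; apply: eB.
by move: xz; rewrite mx_norm_ball /ball_ /= opprD addrACA subrr addr0.
Qed.

Lemma gradh_borel h v i : borel_fun v -> borel_fun (fun x => gradh h v x 0 i).
Proof.
move=> mv; under eq_fun do rewrite mxE.
by apply: measurable_funM => //; apply: measurable_funB; exact: shift_borel.
Qed.

Lemma lapl_borel h v : borel_fun v -> borel_fun (lapl h v).
Proof.
move=> mv; apply: measurable_sum => i; apply: measurable_funM => //.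
apply: measurable_funD; last exact: shift_borel.
by apply: measurable_funB; [exact: shift_borel|exact: measurable_funM].
Qed.

Lemma opA_borel h pi v : policy M pi -> borel_fun v -> borel_fun (opA M h pi v).
Proof.
move=> mpi mv; apply: measurable_funB; last first.
  by apply: measurable_funM => //; exact: lapl_borel.
apply: measurable_funB; first exact: measurable_funM.
apply: measurable_sum => i; apply: measurable_funM; first exact: drift_borel.
exact: gradh_borel.
Qed.

Lemma opL_borel p eps h pi v : borel_fun p -> policy M pi -> borel_fun v ->
  borel_fun (opL M p eps h pi v).
Proof.
move=> mp mpi mv; apply: measurable_funB; last exact: measurable_funM.
by apply: measurable_funB; [exact: opA_borel|exact: rcost_borel].
Qed.

Lemma opF_borel p eps h v : borel_fun p -> borel_fun v ->
  borel_fun (opF M p eps h v).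
Proof.
move=> mp mv; apply: measurable_funB; last exact: measurable_funM.
apply: measurable_funB; last by apply: measurable_funM => //; exact: lapl_borel.
apply: measurable_funD; first exact: measurable_funM.
apply: (@measurable_lipschitz_comp _ _ (Borel Rd) _ (hamiltonian M) (supb M)).
- exact/ltW/supb_gt0.
- by move=> q; apply: continuous_borel_real; exact: ham_continuous_x.
- by move=> x q q'; exact: ham_lipschitz_q.
- by move=> i; exact: gradh_borel.
Qed.

Lemma policy_if (D : set Rd) pi1 pi2 : measurable (D : set (Borel Rd)) ->
  policy M pi1 -> policy M pi2 ->
  policy M (fun x => if `[< D x >] then pi1 x else pi2 x).
Proof.
move=> mD [m1 A1] [m2 A2]; split=> [|x]; last by case: asboolP.
move=> _ B mB; rewrite setTI [X in measurable X](_ : _ =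
  (D `&` pi1 @^-1` B) `|` (~` D `&` pi2 @^-1` B)).
  have m1B := m1 measurableT _ mB; have m2B := m2 measurableT _ mB.
  rewrite setTI in m1B; rewrite setTI in m2B.
  by apply: measurableU; apply: measurableI => //; exact: measurableC.
apply/seteqP; split=> x /=; case: asboolP => Dx.
- by left.
- by right.
- by case=> -[].
- by case=> -[].
Qed.

(* Dynamic programming needs Borel selections; the first near-optimal member of
   a countable dense set of actions is one. *)
Lemma greedy_policy p eps h v eta : borel_fun p -> borel_fun v -> 0 < eta ->
  exists2 pi, policy M pi & forall x, gap M p eps h v pi x <= eta.
Proof.
move=> mp mv e0; have [s [As ds]] := countable_dense (act_nonempty d_gt0 st).
pose g k x := opL M p eps h (fun=> s k) v x.
pose P k : set Rd := [set x | opF M p eps h v x - eta < g k x].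
have mP k : measurable (P k : set (Borel Rd)).
  rewrite (_ : P k = [set x | 0 < g k x - opF M p eps h v x + eta]); last first.
    by apply/seteqP; split=> x; rewrite /P /=; lra.
  apply: (@measurable_fun_gt _ _ (Borel Rd)); apply: measurable_funD => //.
  apply: measurable_funB; last exact: opF_borel.
  by apply: opL_borel => //; split => //; exact: measurable_cst.
have exP x : exists k, `[< P k x >].
  have e2 : 0 < eta / 2 by rewrite divr_gt0.
  have [a Aa Fa] := opF_adherent d_gt0 st p eps h v x e2.
  pose q := gradh h v x; pose c := Num.sqrt d%:R * enorm q + 1.
  have c0 : 0 < c by rewrite ltr_wpDl// mulr_ge0 ?sqrtr_ge0 ?enorm_ge0.
  have e4 : 0 < eta / 4 by rewrite divr_gt0.
  have [r1 r10 br] := within_continuous x (drift_cont st) Aa (divr_gt0 e4 c0).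
  have [r2 r20 fr] := rcost_near x Aa e4.
  have [k ak] := ds a (Num.min r1 r2) Aa ltac:(by rewrite lt_min r10).
  exists k; apply/asboolP; rewrite /P /g.
  have {}ak : `|a - s k| < Num.min r1 r2 by exact: le_lt_trans (normr_le_enorm _) ak.
  have := fr _ (As k); have := br _ (As k); rewrite mx_norm_ball /ball_ /=.
  move: ak; rewrite lt_min => /andP[ak1 ak2] /(_ ak1) bk /(_ ak2).
  have bq : `|dotv (b x a - b x (s k)) q| <= eta / 4.
    rewrite (le_trans (normr_dotv_le _ _))//.
    rewrite (le_trans (ler_wpM2r (enorm_ge0 q) (enorm_le_normr _)))//.
    rewrite (@le_trans _ _ (c * (eta / 4 / c)))//; last by rewrite mulrC divfK ?gt_eqF.
    rewrite mulrAC ler_pM ?mulr_ge0 ?sqrtr_ge0 ?enorm_ge0//; last exact: ltW.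
    by rewrite /c lerDl.
  move: Fa bq; rewrite /opL /opA dotvDl dotvNl -/q ler_norml ltr_norml => + /andP[+ _].
  by move=> ? ? /andP[? ?]; lra.
pose k x := ex_minn (exP x).
exists (fun x => s (k x)).
  split=> [_ B mB|x]; last exact: As.
  (* The preimage is cut according to the first admissible index [j]; on each piece, membership of
     [s j] in [B] is a constant condition. *)
  rewrite setTI [X in measurable X](_ : _ = [set x | exists j : nat,
    (P j `&` ~` [set x | exists i : 'I_j, P i x] `&` [set x | B (s j)]) x]).
    apply: measurable_countable_bigcup => j; apply: measurableI.
      by apply: measurableI => //; apply: measurableC;
        exact: measurable_countable_bigcup.
    have [Bj|Bj] := pselect (B (s j)).
      by rewrite [X in measurable X](_ : _ = setT)//; apply/seteqP; split.
    by rewrite [X in measurable X](_ : _ = set0)//; apply/seteqP; split.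
  apply/seteqP; split=> x /=; rewrite /k; case: ex_minnP => j /asboolP Pj jmin.
    move=> Bj; exists j; split => //; split => // -[[i ij] /= Pi].
    by have := jmin i; rewrite leqNgt ij => /(_ (asboolT Pi)).
  move=> [i [[Pi /= imin] Bi]]; rewrite (_ : j = i)//; apply/eqP.
  rewrite eqn_leq jmin ?asboolT//= leqNgt; apply/negP => ji.
  by apply: imin; exists (Ordinal ji).
move=> x; rewrite (_ : gap _ _ _ _ _ _ x = opF M p eps h v x - g (k x) x)// /k.
by case: (ex_minnP (exP x)) => j /asboolP + _; rewrite /P /=; lra.
Qed.

End Measurability.

(** * Values of policies and Bellman equations *)

Section Values.
Context {R : realType} {d m : nat} (M : model R d m).
Hypotheses (d_gt0 : (0 < d)%N) (st : standing M).
Local Notation Rd := 'rV[R]_d.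
Local Notation Rm := 'rV[R]_m.
Local Notation A := (Act M).
Local Notation b := (drift M).
Local Notation f := (rcost M).
Local Notation N := (Nv M).
Local Notation lm := (lam M).
Local Notation borel_fun v := (measurable_fun setT ((v : Rd -> R) : Borel Rd -> R)).
Implicit Types (x y q : Rd) (u v z : Rd -> R) (pi : Rd -> Rm) (D : set Rd)
  (eta e r c C g L : R).

(** [D] empty gives the policy operator, [D] full the Bellman operator, and [D] the inner box with
    [pi = pib] the operator [opR]. *)
Definition mixR p eps h D pi v x : R :=
  if `[< D x >] then opF M p eps h v x else opL M p eps h pi v x.

Variables (p : Rd -> R) (Bp eps h : R).
Hypotheses (p_ge0 : forall x, 0 <= p x) (p_le : forall x, p x <= Bp).
Hypotheses (p_borel : borel_fun p) (eps0 : 0 < eps) (h0 : 0 < h).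
Local Notation mu := (muh M h).
Local Notation Lam := (Lamh M h).
Local Notation gam := (gamh M h).
Local Notation opL := (opL M p eps h).
Local Notation opF := (opF M p eps h).
Local Notation mxR := (mixR p eps h).
Local Notation S := (polval M p eps h).
Local Notation vF := (discval M p eps h).

Let mu0 : 0 < mu := muh_gt0 d_gt0 st h0.
Let lm0 : 0 < lm := lam_gt0 st.
Let gam0 : 0 <= gam := gamh_ge0 d_gt0 st h0.
Let gam1 : gam < 1 := gamh_lt1 d_gt0 st h0.

Lemma le_geometric (c1 c2 : R) : (forall n, c1 <= gam ^+ n * c2) -> c1 <= 0.
Proof.
move=> H; have G : (fun n => gam ^+ n * c2) @ \oo --> 0 * c2.
  by apply: cvgM; [apply: cvg_expr; rewrite ger0_norm|exact: cvg_cst].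
rewrite mul0r in G; apply/ler_addgt0Pr => e e0; rewrite add0r.
have [n _ /(_ n (leqnn n)) Hn] := cvgr_lt _ G _ e0.
exact: le_trans (H n) (ltW Hn).
Qed.

Lemma opL_step pi v x :
  opL pi v x = mu * v x - Lam * stepP M h (pi x) v x - f x (pi x) - p x / eps.
Proof. by rewrite /Defs.opL opA_step. Qed.

Lemma opLB pi u v x : opL pi u x - opL pi v x = opA M h pi (fun y => u y - v y) x.
Proof. by rewrite opAB// /Defs.opL; ring. Qed.

(** The mixed operator is a supremum of affine ones, over all actions in [D] and over a single
    action outside. An action nearly optimal for [v] bounds the difference of the values at [u] and
    [v] from below, up to [eta], by a linear operator applied to [u - v]. *)
Lemma mixR_action D pi v x eta : A (pi x) -> 0 < eta ->
  exists2 a, A a & mxR D pi v x < opL (fun=> a) v x + eta /\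
    forall u, opL (fun=> a) u x <= mxR D pi u x.
Proof.
move=> Ap e0; rewrite /mixR; case: asboolP => Dx; last first.
  by exists (pi x) => //; split=> [|u]; rewrite ?ltrDl// /opL.
have [a Aa Fa] := opF_adherent d_gt0 st p eps h v x e0.
by exists a => //; split=> // u; exact: opL_le_opF.
Qed.

Lemma mixR_local D pi u v x g C : A (pi x) ->
  mxR D pi u x <= mxR D pi v x + g ->
  (forall y, nbr h x y -> u y - v y <= C) ->
  u x - v x <= g / mu + gam * C.
Proof.
move=> Ap uv uvC; apply/ler_addgt0Pr => eta e0.
have e1 : 0 < eta * mu by rewrite mulr_gt0.
have [a Aa [va au]] := mixR_action D v Ap e1.
have H : opA M h (fun=> a) (fun y => u y - v y) x <= g + eta * mu.
  by rewrite -opLB; have := au u; lra.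
have := opA_ub d_gt0 st h0 Aa H uvC.
by rewrite mulrDl mulfK ?gt_eqF//; lra.
Qed.

Lemma mixR_local_norm D pi u v x g C : A (pi x) ->
  `|mxR D pi u x - mxR D pi v x| <= g ->
  (forall y, nbr h x y -> `|u y - v y| <= C) ->
  `|u x - v x| <= g / mu + gam * C.
Proof.
move=> Ap; rewrite ler_norml => /andP[g1 g2] uvC; rewrite ler_norml.
apply/andP; split.
  rewrite lerNl opprB; apply: (mixR_local (D := D) Ap); first by lra.
  by move=> y /uvC; rewrite ler_norml; lra.
apply: (mixR_local (D := D) Ap); first by lra.
by move=> y /uvC; rewrite ler_norml; lra.
Qed.

Lemma divr_muh g : g / mu = (1 - gam) * (g / lm).
Proof. by rewrite onesub_gamh//; field; rewrite !gt_eqF. Qed.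

Lemma gam_mu_lm g C : g / mu + gam * (C + g / lm) = gam * C + g / lm.
Proof. by rewrite divr_muh; ring. Qed.

Lemma mixR_comparison D pi u v B g : (forall x, A (pi x)) ->
  (forall x, `|u x| <= B) -> (forall x, `|v x| <= B) ->
  (forall x, mxR D pi u x <= mxR D pi v x + g) ->
  forall x, u x <= v x + g / lm.
Proof.
move=> Ap uB vB uv x; rewrite -subr_le0.
apply: (@walk_max _ _ _ M d_gt0 st h h0 (fun y => u y - (v y + g / lm))
  (B + B - g / lm)) => [y|y C C0 zC].
  have := uB y; have := vB y; rewrite !ler_norml => /andP[? ?] /andP[? ?]; lra.
have := @mixR_local D pi u v y g (C + g / lm) (Ap y) (uv y).
rewrite gam_mu_lm => H; rewrite opprD addrA lerBlDr; apply: H => w _.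
by have := zC w; lra.
Qed.

Section FixedPoint.
Variables (D : set Rd) (pi : Rd -> Rm).
Hypotheses (D_borel : measurable (D : set (Borel Rd))) (pi_policy : policy M pi).

(** Value iteration: the zeros of the mixed operator are the fixed points of [T], a contraction of
    ratio gam because [mu * v x] is the diagonal part of every [opL]. *)
Let T v x := v x - mxR D pi v x / mu.

Let T_le u v x C : (forall y, nbr h x y -> `|u y - v y| <= C) ->
  T u x <= T v x + gam * C.
Proof.
move=> uvC; apply/ler_addgt0Pr => eta e0.
have e1 : 0 < eta * mu by rewrite mulr_gt0.
have [a Aa [va au]] := mixR_action D v (pi_policy.2 x) e1.
have C1 : stepP M h a u x - stepP M h a v x <= C.
  rewrite -stepPB; apply: stepP_ub => // y /uvC.
  by rewrite ler_norml => /andP[].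
rewrite /T; move: va (au u); rewrite !opL_step => va vu.
rewrite -(ler_pM2r mu0) !mulrDl !mulNr !divfK ?gt_eqF//.
rewrite (mulrC _ C) -mulrA gamh_mu//.
have := ler_wpM2l (ltW (Lamh_gt0 d_gt0 st h0)) C1; rewrite (mulrC Lam C); lra.
Qed.

Let T_norm u v x C : (forall y, nbr h x y -> `|u y - v y| <= C) ->
  `|T u x - T v x| <= gam * C.
Proof.
move=> uvC; have H1 := T_le uvC.
have H2 : T v x <= T u x + gam * C by apply: T_le => y /uvC; rewrite distrC.
by rewrite ler_norml; lra.
Qed.

Let B0 := (supf M + Bp / eps) / mu.

Let T0_norm x : `|T (fun=> 0) x| <= B0.
Proof.
have opL0 a : opL (fun=> a) (fun=> 0) x = - f x a - p x / eps.
  by rewrite opL_step stepP_cst//; ring.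
have pe : 0 <= p x / eps <= Bp / eps.
  by rewrite divr_ge0 ?(ltW eps0)//= ler_pM2r ?invr_gt0.
rewrite /T sub0r normrN normrM normfV (gtr0_norm mu0) ler_pM2r ?invr_gt0//.
rewrite ler_norml; have Ap := pi_policy.2 x; apply/andP; split.
  have [a Aa [_ /(_ (fun=> 0))]] := mixR_action D (fun=> 0) Ap ltr01.
  by rewrite opL0; have := supf_ub st x Aa; lra.
apply/ler_addgt0Pr => eta e0.
have [a Aa []] := mixR_action D (fun=> 0) Ap e0.
rewrite opL0; have := rcost_ge0 st x Aa; have := supf_ub st x Aa; lra.
Qed.

Let un n := iter n T (fun=> 0).
Let B1 := B0 / (1 - gam).

Let B00 : 0 <= B0. Proof. exact: le_trans (normr_ge0 _) (T0_norm 0). Qed.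

Let B10 : 0 <= B1. Proof. by rewrite divr_ge0// subr_ge0 ltW. Qed.

Let un_norm n x : `|un n x| <= B1.
Proof.
elim: n x => [|n IH] x; first by rewrite normr0.
rewrite /un iterS -/(un n); have := @T_norm (un n) (fun=> 0) x B1.
have := T0_norm x; have : B0 = B1 - gam * B1.
  by rewrite -{1}(mul1r B1) -mulrBl mulrC divfK// gt_eqF// subr_gt0.
move=> -> /= H1 H2; rewrite -(subrK (T (fun=> 0) x) (T (un n) x)).
have {}H2 : `|T (un n) x - T (fun=> 0) x| <= gam * B1.
  by apply: H2 => y _; rewrite subr0.
by rewrite (le_trans (ler_normD _ _))//; lra.
Qed.

Let un_cauchy n k x : `|un (n + k) x - un n x| <= gam ^+ n * B1.
Proof.
elim: n x => [|n IH] x; first by rewrite subr0 mul1r.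
by rewrite addSn /un !iterS -!/(un _) exprS -mulrA; apply: T_norm => y _.
Qed.

(** The limit of the iterates, written as the supremum of their lower error bounds, so that its
    superlevel sets are countable unions of Borel sets. *)
Let v x := sup [set un n x - gam ^+ n * B1 | n in setT].

Let gamX n : 0 <= gam ^+ n * B1.
Proof. by rewrite mulr_ge0// exprn_ge0. Qed.

Let un_near n k x : un k x - gam ^+ k * B1 <= un n x + gam ^+ n * B1.
Proof.
have [nk|/ltnW kn] := leqP n k.
  by have := un_cauchy n (k - n) x; have := gamX k; rewrite subnKC// ler_norml; lra.
by have := un_cauchy k (n - k) x; have := gamX n; rewrite subnKC// ler_norml; lra.
Qed.

Let v_near n x : `|v x - un n x| <= gam ^+ n * B1.
Proof.
have ub : has_ubound [set un n x - gam ^+ n * B1 | n in setT].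
  by exists (un 0 x + gam ^+ 0 * B1) => _ [k _ <-]; exact: un_near.
have H1 : un n x - gam ^+ n * B1 <= v x by apply: ub_le_sup => //; exists n.
have H2 : v x <= un n x + gam ^+ n * B1.
  by apply: ge_sup; [exists (un 0 x - gam ^+ 0 * B1), 0%N|move=> _ [k _ <-]; exact: un_near].
by rewrite ler_norml; lra.
Qed.

Let mixR_borel u : borel_fun u -> borel_fun (mxR D pi u).
Proof.
move=> mu'; apply: (@measurable_fun_ifT _ _ (Borel Rd) R).
- apply: (measurable_fun_bool true); rewrite setTI.
  by rewrite (_ : _ @^-1` _ = D)//; apply/seteqP; split=> x /asboolP.
- exact: opF_borel.
- exact: opL_borel.
Qed.

Lemma mixR_zero : exists v, bounded_borel v /\ forall x, mxR D pi v x = 0.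
Proof.
have mun n : borel_fun (un n).
  elim: n => [|n IH]; first exact: measurable_cst.
  apply: measurable_funB => //; apply: measurable_funM => //; exact: mixR_borel.
exists v; split; first split.
- apply: measurable_gt_fun => c.
  rewrite [X in measurable X](_ : _ = [set x | exists n, c < un n x - gam ^+ n * B1]).
    apply: measurable_countable_bigcup => n.
    apply: (@measurable_fun_gt _ _ (Borel Rd)); apply: measurable_funB => //.
  apply/seteqP; split=> x /=.
    move=> /sup_gt[]; first by exists (un 0 x - gam ^+ 0 * B1), 0%N.
    by move=> _ [n _ <-] ?; exists n.
  move=> [n cn]; rewrite (lt_le_trans cn)//; have := v_near n x; rewrite ler_norml; lra.
- by exists B1 => x; have := v_near 0 x; rewrite subr0 mul1r.
- move=> x.
  suff H n : `|T v x - v x| <= gam ^+ n * (2 * B1).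
    have : `|T v x - v x| <= 0.
      exact: (@le_geometric _ (2 * B1)).
    rewrite normr_le0 /T addrAC subrr sub0r oppr_eq0 mulf_eq0 invr_eq0.
    by rewrite (gt_eqF mu0) orbF => /eqP.
  have H1 := v_near n.+1 x.
  have : `|T v x - un n.+1 x| <= gam * (gam ^+ n * B1).
    by rewrite /un iterS -/(un n); apply: T_norm => y _; exact: v_near.
  have : gam * (gam ^+ n * B1) <= gam ^+ n * B1 by rewrite ler_piMl// ltW.
  by move: H1; rewrite exprS -mulrA !ler_norml; set w := gam ^+ n; lra.
Qed.

End FixedPoint.
End Values.

Section Bellman.
Context {R : realType} {d m : nat} (M : model R d m).
Hypotheses (d_gt0 : (0 < d)%N) (st : standing M).
Local Notation Rd := 'rV[R]_d.
Local Notation Rm := 'rV[R]_m.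
Local Notation A := (Act M).
Local Notation f := (rcost M).
Local Notation lm := (lam M).
Local Notation borel_fun v := (measurable_fun setT ((v : Rd -> R) : Borel Rd -> R)).
Implicit Types (x y q : Rd) (u v z : Rd -> R) (pi : Rd -> Rm) (D : set Rd)
  (eta e r c C g L : R).

Variables (p : Rd -> R) (Bp eps h : R).
Hypotheses (p_ge0 : forall x, 0 <= p x) (p_le : forall x, p x <= Bp).
Hypotheses (p_borel : borel_fun p) (eps0 : 0 < eps) (h0 : 0 < h).
Local Notation opLp := (opL M p eps h).
Local Notation opFp := (opF M p eps h).
Local Notation S := (polval M p eps h).
Local Notation vF := (discval M p eps h).

Let lm0 : 0 < lm := lam_gt0 st.
Let K := (supf M + Bp / eps) / lm.

Lemma mixR_le D pi u v (c1 c2 : R) : (forall x, A (pi x)) ->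
  (forall x, `|u x| <= c1) -> (forall x, `|v x| <= c2) ->
  (forall x, mixR M p eps h D pi u x <= mixR M p eps h D pi v x) ->
  forall x, u x <= v x.
Proof.
move=> Ap uc vc uv x; have := @mixR_comparison _ _ _ M d_gt0 st p eps h h0 D pi u v
  (Num.max c1 c2) 0 Ap _ _ _ x.
rewrite mul0r addr0; apply => y; rewrite ?addr0//.
  by rewrite le_max uc.
by rewrite le_max vc orbT.
Qed.

Lemma polval_spec pi : policy M pi ->
  bounded_borel (S pi) /\ forall x, opLp pi (S pi) x = 0.
Proof.
move=> mpi; apply: (@getPex _ [set v | bounded_borel v /\ forall x, opLp pi v x = 0]).
have [v [bv v0]] := mixR_zero d_gt0 st p_ge0 p_le p_borel eps0 h0
  (@measurable0 _ (Borel Rd)) mpi.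
by exists v; split=> // x; have := v0 x; rewrite /mixR; case: asboolP.
Qed.

Lemma polval_opA pi x : policy M pi -> opA M h pi (S pi) x = f x (pi x) + p x / eps.
Proof. by move=> /polval_spec[_ /(_ x)]; rewrite /opL; lra. Qed.

Lemma polval_ge0 pi x : policy M pi -> 0 <= S pi x.
Proof.
move=> mpi; have [[_ [c Sc]] _] := polval_spec mpi.
apply: (@opA_comparison _ _ _ M d_gt0 st h h0 pi (fun=> 0) (S pi) c mpi.2) => // y.
  by rewrite normr0 (le_trans (normr_ge0 (S pi y))).
rewrite opA_cst// mulr0 polval_opA//; apply: addr_ge0.
  exact: rcost_ge0 st _ _ (mpi.2 y).
by rewrite divr_ge0// ltW.
Qed.

Lemma polval_le pi x : policy M pi -> S pi x <= K.
Proof.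
move=> mpi; have [[_ [c Sc]] _] := polval_spec mpi.
apply: (@opA_sup_le _ _ _ M d_gt0 st h h0 pi (S pi) _ c mpi.2) => [y|y].
  by rewrite (le_trans (ler_norm _)).
rewrite polval_opA//; apply: lerD; first exact: supf_ub st _ _ (mpi.2 y).
by rewrite ler_pM2r// invr_gt0.
Qed.

Lemma discval_spec : bounded_borel vF /\ forall x, opFp vF x = 0.
Proof.
apply: (@getPex _ [set v | bounded_borel v /\ forall x, opFp v x = 0]).
have [a Aa] := act_nonempty d_gt0 st.
have mpi : policy M (fun=> a) by split => //; exact: measurable_cst.
have [v [bv v0]] := mixR_zero d_gt0 st p_ge0 p_le p_borel eps0 h0
  (@measurableT _ (Borel Rd)) mpi.
by exists v; split=> // x; have := v0 x; rewrite /mixR; case: asboolP => // -[].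
Qed.

(** The difference of two values, with penalties [phi] and 0 and parameter 1: the running cost
    cancels. [V] stands for the discounted sum of [phi] along the chain. *)
Lemma resolvent phi B pi : policy M pi -> borel_fun phi ->
  (forall x, 0 <= phi x <= B) ->
  exists V, bounded_borel V /\ forall x, opA M h pi V x = phi x.
Proof.
move=> mpi mphi phiB.
have phi0 x : 0 <= phi x by have /andP[] := phiB x.
have phi1 x : phi x <= B by have /andP[] := phiB x.
have m0 : borel_fun (fun=> 0) by exact: measurable_cst.
have H1 := mixR_zero d_gt0 st phi0 phi1 mphi ltr01 h0 (@measurable0 _ (Borel Rd)) mpi.
have H2 := mixR_zero d_gt0 st (fun=> lexx 0) (fun=> lexx 0) m0 ltr01 h0
  (@measurable0 _ (Borel Rd)) mpi.
have [V1 [[mV1 [c1 V1c]] V10]] := H1; have [V2 [[mV2 [c2 V2c]] V20]] := H2.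
exists (fun x => V1 x - V2 x); split; first split.
- exact: measurable_funB.
- by exists (c1 + c2) => x; rewrite (le_trans (ler_normB _ _))// lerD.
- move=> x; have := V10 x; have := V20 x; rewrite /mixR; case: asboolP => // _.
  by rewrite opAB// /opL; lra.
Qed.

Section Localized.
Variables (pib : Rd -> Rm) (L : R).
Hypothesis pib_policy : policy M pib.
Local Notation PiL := (loc_policy M pib h L).
Local Notation vL := (locval M p eps pib h L).
Local Notation opRp := (opR M p eps pib h L).

Lemma cube_borel c : measurable (cube c : set (Borel Rd)).
Proof.
rewrite -[X in measurable X]setCK; apply: measurableC; apply: open_borel.
by apply: closed_openC; exact: closed_cube.
Qed.

Lemma opR_polval_ge0 pi x : PiL pi -> 0 <= opRp (S pi) x.
Proof.
move=> [mpi piE]; have [_ S0] := polval_spec mpi.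
rewrite /opR; case: asboolP => xL; rewrite -(S0 x).
  by apply: opL_le_opF => //; exact: mpi.2.
by rewrite /opL /opA piE.
Qed.

Lemma greedy_loc_policy v eta : borel_fun v -> 0 < eta ->
  exists2 pi, PiL pi & forall x, cube (L - h) x -> gap M p eps h v pi x <= eta.
Proof.
move=> mv e0; have [pi mpi piv] := greedy_policy d_gt0 st eps h p_borel mv e0.
exists (fun x => if `[< cube (L - h) x >] then pi x else pib x) => [|x xL].
  split; first by apply: policy_if => //; exact: cube_borel.
  by move=> x; case: asboolP.
by have := piv x; rewrite !gapE /=; case: asboolP.
Qed.

(** Dynamic programming: the localized Bellman equation has a solution [w], which lies below every
    policy value by comparison. One policy nearly greedy for [w] comes within [eta] of it at all
    points simultaneously, so the pointwise infimum is [w]. *)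
Lemma locval_spec : bounded_borel vL /\ forall x, opRp vL x = 0.
Proof.
have [w [[mw [c wc]] w0]] := mixR_zero d_gt0 st p_ge0 p_le p_borel eps0 h0
  (cube_borel (L - h)) pib_policy.
have wS pi : PiL pi -> forall x, w x <= S pi x.
  move=> Ppi x; have [[_ [c' Sc]] _] := polval_spec Ppi.1.
  apply: (@mixR_le (cube (L - h)) pib w (S pi) c c' pib_policy.2) => // y.
  by rewrite w0; exact: opR_polval_ge0.
suff -> : vL = w by split => //; split => //; exists c.
apply/funext => x; apply/eqP; rewrite eq_le; apply/andP; split; last first.
  by apply: lb_le_inf; [exists (S pib x), pib|move=> _ [pi Ppi <-]; exact: wS].
apply/ler_addgt0Pr => eta e0; have e1 : 0 < eta * lm by rewrite mulr_gt0.
have [pi Ppi piw] := greedy_loc_policy mw e1.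
have [[_ [c' Sc]] S0] := polval_spec Ppi.1.
rewrite (@le_trans _ _ (S pi x))//.
  by apply: ge_inf; [exists (w x) => _ [pi' Ppi' <-]; exact: wS|exists pi].
rewrite -[eta](mulfK (lt0r_neq0 lm0)).
apply: (@mixR_comparison _ _ _ M d_gt0 st p eps h h0 set0 pi (S pi) w
  (Num.max c c') (eta * lm) Ppi.1.2) => y.
- by rewrite le_max Sc orbT.
- by rewrite le_max wc.
- rewrite /mixR; case: asboolP => // _; rewrite S0; have := w0 y; rewrite /mixR.
  case: asboolP => [yL|yL].
    by have := piw y yL; rewrite /gap; lra.
  by rewrite /opL /opA (Ppi.2 y yL); lra.
Qed.

Lemma discval_ge0 x : 0 <= vF x.
Proof.
have [[_ [c vc]] v0] := discval_spec.
apply: (@mixR_le setT pib (fun=> 0) vF 0 c pib_policy.2) => // y.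
  by rewrite normr0.
rewrite /mixR; case: asboolP => [_|[]//]; rewrite v0.
apply/ler_addgt0Pr => eta e0.
have [a Aa] := opF_adherent d_gt0 st p eps h (fun=> 0) y e0.
move=> /ltW/le_trans; apply; rewrite lerD2r /opL opA_cst// mulr0.
have := rcost_ge0 st y Aa; have : 0 <= p y / eps by rewrite divr_ge0// ltW.
lra.
Qed.

Lemma discval_le_polval pi x : policy M pi -> vF x <= S pi x.
Proof.
move=> mpi; have [[_ [c vc]] v0] := discval_spec.
have [[_ [c' Sc]] S0] := polval_spec mpi.
apply: (@mixR_le setT pib vF (S pi) c c' pib_policy.2) => // y.
rewrite /mixR; case: asboolP => [_|[]//]; rewrite v0 -(S0 y).
by apply: opL_le_opF => //; exact: mpi.2.
Qed.

Lemma pib_loc_policy : PiL pib. Proof. by split. Qed.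

Lemma locval_le_polval pi x : PiL pi -> vL x <= S pi x.
Proof.
move=> Ppi; apply: ge_inf; last by exists pi.
by exists 0 => _ [pi' Ppi' <-]; exact: polval_ge0 Ppi'.1.
Qed.

Lemma discval_le_locval x : vF x <= vL x.
Proof.
apply: lb_le_inf; first by exists (S pib x), pib => //; exact: pib_loc_policy.
by move=> _ [pi Ppi <-]; exact: discval_le_polval Ppi.1.
Qed.

Lemma locval_le x : vL x <= K.
Proof. exact: le_trans (locval_le_polval _ pib_loc_policy) (polval_le _ pib_policy). Qed.

Lemma locval_ge0 x : 0 <= vL x.
Proof. exact: le_trans (discval_ge0 _) (discval_le_locval _). Qed.

Lemma discval_le x : vF x <= K.
Proof. exact: le_trans (discval_le_locval _) (locval_le _). Qed.

End Localized.
End Bellman.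

(** * Residual estimates and policy iteration *)

Lemma ceil_nat (R : realType) (x : R) : 0 <= x ->
  exists n : nat, [/\ Num.ceil x = n%:Z, x <= n%:R & n%:R - 1 < x].
Proof.
move=> x0; have c0 : 0 <= Num.ceil x by rewrite ceil_ge0 (lt_le_trans _ x0)// oppr_lt0.
exists `|Num.ceil x|%N; have e : (`|Num.ceil x|%N : int) = Num.ceil x by rewrite gez0_abs.
split => //; first by rewrite pmulrn e ceil_ge.
by rewrite pmulrn e; have := ceilB1_lt x; rewrite intrB.
Qed.

Lemma geometric_recursion (R : realType) (e t : nat -> R) (g l : R) n : 0 <= g ->
  (forall j, (j < n)%N -> e j.+1 <= g * e j + t j / l) ->
  e n <= g ^+ n * e 0%N + l^-1 * \sum_(0 <= j < n) g ^+ (n - 1 - j) * t j.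
Proof.
move=> g0; elim: n => [|n IH] H; first by rewrite big_geq// mulr0 addr0 mul1r.
rewrite (le_trans (H n (ltnSn n)))// big_nat_recr//= subn1 /= subnn mul1r.
have -> : \sum_(0 <= j < n) g ^+ (n - j) * t j =
    g * \sum_(0 <= j < n) g ^+ (n - 1 - j) * t j.
  rewrite mulr_sumr; apply: eq_big_nat => j /andP[_ jn].
  rewrite mulrA -exprS; congr (_ ^+ _ * _).
  by rewrite -subnDA add1n -subSn// subSS.
have := ler_wpM2l g0 (IH (fun j jn => H j (ltnW jn))).
by rewrite exprS; set s := \sum_(_ <= _ < _) _; lra.
Qed.

Section DistSet.
Context {R : realType} {d : nat}.
Implicit Types (A B : set 'rV[R]_d).

Lemma dist_set_fin A B : A !=set0 -> B !=set0 ->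
  dist_set A B \is a fin_num /\ 0 <= fine (dist_set A B).
Proof.
move=> [a Aa] [b Bb]; have d0 : (0 <= dist_set A B)%E.
  by apply: le_ereal_inf_tmp => _ [x _ [y _ <-]]; rewrite lee_fin enorm_ge0.
have dfin : dist_set A B \is a fin_num.
  rewrite ge0_fin_numE// (@le_lt_trans _ _ (enorm (a - b))%:E) ?ltry//.
  by apply: ereal_inf_lbound; exists a => //; exists b.
by split => //; rewrite fine_ge0.
Qed.

Lemma fine_dist_set_le A B x y : A x -> B y -> fine (dist_set A B) <= enorm (x - y).
Proof.
move=> Ax By; have [df _] := @dist_set_fin A B (ex_intro _ x Ax) (ex_intro _ y By).
rewrite -lee_fin fineK//; apply: ereal_inf_lbound; exists x => //; by exists y.
Qed.

Lemma fine_dist_set_ge0 A B : B !=set0 -> 0 <= fine (dist_set A B).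
Proof.
have [[a Aa]|A0] := pselect (A !=set0).
  by move=> B0; have [] := @dist_set_fin A B (ex_intro _ a Aa) B0.
(* For empty [A] the distance is [+oo], which [fine] sends to 0. *)
suff dE : [set (enorm (x - y))%:E | x in A & y in B] = set0.
  by rewrite /dist_set dE ereal_inf0.
by apply/seteqP; split=> // t [x Ax _]; case: A0; exists x.
Qed.

Lemma strip_nonempty (h L : R) : (0 < d)%N -> 0 < h -> 0 <= L ->
  (strip h L : set 'rV[R]_d) !=set0.
Proof.
move=> d0 h0 L0; exists (const_mx L); split; first exact: cube_const.
by move=> /(_ (Ordinal d0)); rewrite mxE; lra.
Qed.

End DistSet.

Section Comparison.
Context {R : realType} {d m : nat} (M : model R d m).
Hypotheses (d_gt0 : (0 < d)%N) (st : standing M).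
Local Notation Rd := 'rV[R]_d.
Local Notation Rm := 'rV[R]_m.
Local Notation A := (Act M).
Local Notation f := (rcost M).
Local Notation lm := (lam M).
Local Notation dR := (d%:R : R).
Local Notation borel_fun v := (measurable_fun setT ((v : Rd -> R) : Borel Rd -> R)).
Implicit Types (x y q : Rd) (u v z : Rd -> R) (pi : Rd -> Rm) (D E : set Rd)
  (eta e r c C g L : R).

Variables (p : Rd -> R) (Bp eps h : R).
Hypotheses (p_ge0 : forall x, 0 <= p x) (p_le : forall x, p x <= Bp).
Hypotheses (p_borel : borel_fun p) (eps0 : 0 < eps) (h0 : 0 < h).
Local Notation mu := (muh M h).
Local Notation Lam := (Lamh M h).
Local Notation gam := (gamh M h).
Local Notation opLp := (opL M p eps h).
Local Notation opFp := (opF M p eps h).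
Local Notation S := (polval M p eps h).
Local Notation vF := (discval M p eps h).

Let lm0 : 0 < lm := lam_gt0 st.
Let mu0 : 0 < mu := muh_gt0 d_gt0 st h0.
Let gam0 : 0 <= gam := gamh_ge0 d_gt0 st h0.
Let gam1 : gam < 1 := gamh_lt1 d_gt0 st h0.
Let K := (supf M + Bp / eps) / lm.

(** With s = lam h / (4 d N) one has gam = 1 / (1 + 2 s) <= 1 - s <= exp(- s). The first inequality
    holds for s <= 1/2, which is the mesh condition; it explains the 4 in the decay rate. *)
Lemma gamh_le_expR : lm * h <= 2 * dR * Nv M ->
  gam <= expR (- (lm * h / (4 * dR * Nv M))).
Proof.
move=> lh; have n0 := visc_gt0 st; have dR0 : 0 < dR by rewrite ltr0n.
set s := lm * h / (4 * dR * Nv M).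
have s1 : 2 * s <= 1.
  rewrite /s mulrA ler_pdivrMr ?mulr_gt0// mul1r; lra.
have s0 : 0 <= s by rewrite divr_ge0// ?mulr_ge0// ltW.
have -> : gam = (1 + 2 * s)^-1.
  rewrite /gamh /muh /Lamh /s; field.
  by rewrite !gt_eqF ?addr_gt0 ?mulr_gt0.
rewrite (le_trans _ (expR_ge1Dx _))// -[leLHS]mul1r ler_pdivrMr; first by nra.
by rewrite ltr_pwDl// mulr_ge0.
Qed.

Lemma gamhX_le_decay n (D : R) : lm * h <= 2 * dR * Nv M -> D <= n%:R * h ->
  gam ^+ n <= decay M D.
Proof.
move=> lh Dn; have n0 := visc_gt0 st; have dR0 : 0 < dR by rewrite ltr0n.
rewrite (@le_trans _ _ (expR (- (lm * h / (4 * dR * Nv M))) ^+ n))//.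
  by rewrite lerXn2r ?nnegrE ?expR_ge0// gamh_le_expR.
rewrite -expRM_natl ler_expR; have c0 : 0 < (4 * dR * Nv M)^-1.
  by rewrite invr_gt0 !mulr_gt0.
have := ler_wpM2l (ltW lm0) Dn => /(ler_wpM2r (ltW c0)).
by rewrite mulrN !mulNr lerN2 mulrA; set w := _^-1; lra.
Qed.

Section Propagation.
Variables (L a B Z : R) (z : Rd -> R).
Hypotheses (a0 : 0 <= a) (B0 : 0 <= B) (zZ : forall x, `|z x| <= Z).
Hypothesis z_step : forall x C, cube (L - h) x ->
  (forall y, nbr h x y -> `|z y| <= C) -> `|z x| <= (1 - gam) * a + gam * C.
Hypothesis z_strip : forall x, strip h L x -> `|z x| <= B.

Lemma nbr_cube x y : cube (L - h) x -> nbr h x y -> cube L y.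
Proof.
move=> /cube_norm xL xy; apply/cube_norm => i.
rewrite -(subrK x y) mxE (le_trans (ler_normD _ _))//.
have := ler_coord_enorm (y - x) i; rewrite enormB (nbr_dist (ltW h0) xy).
by have := xL i; lra.
Qed.

Let in_or_strip x : cube L x -> cube (L - h) x \/ strip h L x.
Proof. by move=> xL; have [|] := pselect (cube (L - h) x); [left|right]. Qed.

(** Maximum principle on the box: the supremum s of |z| is at most [B], or else s <= (1 - gam) a +
    gam s, which means s <= a. *)
Let propagation0 x : cube L x -> `|z x| <= a + B.
Proof.
move=> xL; pose s := supn (cube L) z.
have zs y : cube L y -> `|z y| <= s by apply: le_supn => w _; exact: zZ.
have s0 : 0 <= s := supn_ge0 _ _.
have zmax y : cube L y -> `|z y| <= Num.max B ((1 - gam) * a + gam * s).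
  move=> /in_or_strip[yL|yS]; rewrite le_max; last by rewrite z_strip.
  by rewrite (z_step yL) ?orbT// => w /(nbr_cube yL)/zs.
have : s <= Num.max B ((1 - gam) * a + gam * s).
  by apply: supn_le zmax; rewrite le_max B0.
have H := zs x xL; rewrite le_max => /orP[sB|sa].
  by rewrite (le_trans H)// (le_trans sB)// lerDr.
have {}sa : s <= a by move: gam1 sa; clearbody s; nra.
by rewrite (le_trans H)// (le_trans sa)// lerDl.
Qed.

(* From distance more than (n - 1) h, the strip is at least n steps away. *)
Lemma propagation n x : cube L x ->
  (forall s, strip h L s -> n%:R * h - h < enorm (x - s)) ->
  `|z x| <= a + gam ^+ n * B.
Proof.
elim: n x => [|n IH] x xL xs; first by rewrite mul1r; exact: propagation0.
have [xL'|xS] := in_or_strip xL; last first.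
  have := xs x xS; rewrite subrr enorm0 -natr1 mulrDl mul1r addrK.
  by rewrite ltNge mulr_ge0// ltW.
have := @z_step x (a + gam ^+ n * B) xL'; rewrite exprS => H.
have {}H : `|z x| <= (1 - gam) * a + gam * (a + gam ^+ n * B).
  apply: H => y xy; apply: IH; first exact: nbr_cube xy.
  move=> s Ss; have := xs s Ss; have := enorm_triangle y x s.
  by rewrite (nbr_dist (ltW h0) xy) -natr1; lra.
by rewrite (le_trans H)//; lra.
Qed.

Lemma propagation_set E : 0 <= L -> E `<=` cube L ->
  forall x, E x -> `|z x| <= a + gam ^ Num.ceil (fine (dist_set E (strip h L)) / h) * B.
Proof.
move=> L0 EL x Ex; have S0 := @strip_nonempty R d h L d_gt0 h0 L0.
have [n [-> _ nd]] := @ceil_nat _ (fine (dist_set E (strip h L)) / h)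
  (divr_ge0 (fine_dist_set_ge0 E S0) (ltW h0)).
apply: propagation; first exact: EL.
move=> s Ss; apply: lt_le_trans (fine_dist_set_le Ex Ss).
by move: nd; rewrite ltr_pdivlMr// mulrBl mul1r.
Qed.

End Propagation.

Lemma gamh_ceil_le_decay E L : lm * h <= 2 * dR * Nv M -> 0 <= L ->
  gam ^ Num.ceil (fine (dist_set E (strip h L)) / h)
    <= decay M (fine (dist_set E (strip h L))).
Proof.
move=> lh L0; have S0 := @strip_nonempty R d h L d_gt0 h0 L0.
have [n [-> nd _]] := @ceil_nat _ (fine (dist_set E (strip h L)) / h)
  (divr_ge0 (fine_dist_set_ge0 E S0) (ltW h0)).
by apply: gamhX_le_decay => //; rewrite -ler_pdivrMr.
Qed.

(** A [sup] is an upper bound only for bounded sets; this bound makes the norms of residuals usable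
    in the estimates. *)
Lemma mixR_bounded D pi v c : (forall x, A (pi x)) -> (forall x, `|v x| <= c) ->
  exists c', forall x, `|mixR M p eps h D pi v x| <= c'.
Proof.
move=> Ap vc; exists (mu * c + Lam * c + supf M + Bp / eps + 1) => x.
have H a : A a -> `|opLp (fun=> a) v x| <= mu * c + Lam * c + supf M + Bp / eps.
  move=> Aa; rewrite opL_step//.
  have H1 : `|mu * v x| <= mu * c by rewrite normrM gtr0_norm// ler_pM2l.
  have H2 : `|Lam * stepP M h a v x| <= Lam * c.
    by rewrite normrM gtr0_norm ?ler_pM2l ?Lamh_gt0// stepP_norm.
  have H3 : 0 <= f x a <= supf M by rewrite (rcost_ge0 st)// supf_ub.
  have H4 : 0 <= p x / eps <= Bp / eps.
    by rewrite divr_ge0 ?(ltW eps0)//= ler_pM2r// invr_gt0.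
  by move: H1 H2 H3 H4; rewrite !ler_norml; lra.
have [a Aa [va /(_ v) av]] := mixR_action d_gt0 st p eps h D v (Ap x) ltr01.
by move: (H a Aa); rewrite !ler_norml; lra.
Qed.

Lemma opL_bounded pi v c : (forall x, A (pi x)) -> (forall x, `|v x| <= c) ->
  exists c', forall x, `|opLp pi v x| <= c'.
Proof.
move=> Ap vc; have [c' H] := mixR_bounded set0 Ap vc; exists c' => x.
by have := H x; rewrite /mixR; case: asboolP.
Qed.

Lemma gap_bounded pi v c : (forall x, A (pi x)) -> (forall x, `|v x| <= c) ->
  exists c', forall x, gap M p eps h v pi x <= c'.
Proof.
move=> Ap vc; have [c1 H1] := mixR_bounded setT Ap vc.
have [c2 H2] := opL_bounded Ap vc; exists (c1 + c2) => x.
have := H2 x; have := H1 x; rewrite /mixR /gap; case: asboolP => [_|[]//].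
by rewrite !ler_norml; lra.
Qed.

Lemma polval_norm_le pi x : policy M pi -> `|S pi x| <= K.
Proof.
move=> mpi; rewrite ger0_norm.
  exact: (polval_le d_gt0 st p_ge0 p_le p_borel eps0 h0).
exact: (polval_ge0 d_gt0 st p_ge0 p_le p_borel eps0 h0).
Qed.

Lemma polval_error pi u c r : policy M pi -> (forall x, `|u x| <= c) ->
  (forall x, `|opLp pi u x| <= r) -> forall x, `|S pi x - u x| <= r / lm.
Proof.
move=> mpi uc ur x.
have [_ S0] := polval_spec d_gt0 st p_ge0 p_le p_borel eps0 h0 mpi.
have SK y : `|S pi y| <= Num.max K c by rewrite le_max polval_norm_le.
have uK y : `|u y| <= Num.max K c by rewrite le_max uc orbT.
have H1 : S pi x <= u x + r / lm.
  apply: (@mixR_comparison _ _ _ M d_gt0 st p eps h h0 set0 pi _ _ _ r mpi.2 SK uK) => y.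
  by rewrite /mixR; case: asboolP => // _; rewrite S0; have := ur y; rewrite ler_norml; lra.
have H2 : u x <= S pi x + r / lm.
  apply: (@mixR_comparison _ _ _ M d_gt0 st p eps h h0 set0 pi _ _ _ r mpi.2 uK SK) => y.
  by rewrite /mixR; case: asboolP => // _; rewrite S0; have := ur y; rewrite ler_norml; lra.
by rewrite ler_norml; lra.
Qed.

(** Outside the cube [z] is gam times an average of neighbouring values, so its modulus cannot
    exceed the supremum over the cube: [walk_max] applies to |z| - s. *)
Lemma supn_setT_cube pi z c L : (forall x, A (pi x)) -> (forall x, `|z x| <= c) ->
  (forall x, ~ cube L x -> opA M h pi z x = 0) ->
  supn setT z = supn (cube L) z.
Proof.
move=> Ap zc z0; apply/eqP; rewrite eq_le; apply/andP; split; last first.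
  by apply: supn_le => [|x _]; [exact: supn_ge0|exact: le_supn].
apply: supn_le => [|x _]; first exact: supn_ge0.
set s := supn _ _; rewrite -subr_le0.
apply: (@walk_max _ _ _ M d_gt0 st h h0 (fun y => `|z y| - s) (c - s)) => [y|y C C0 zC].
  by rewrite lerB.
have [yL|/z0 yA] := pselect (cube L y).
  have H : `|z y| <= s by apply: (@le_supn _ _ _ _ c).
  by have := mulr_ge0 gam0 C0; lra.
have zs w : `|z w| <= C + s by have := zC w; lra.
have Ap' := Ap y; have H : `|z y| <= gam * (C + s).
  rewrite (opA_stepE d_gt0 st h0 pi z y) yA mul0r add0r normrM (ger0_norm gam0).
  by rewrite ler_wpM2l// stepP_norm.
have : gam * s <= s by rewrite ler_piMl ?(ltW gam1)// supn_ge0.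
lra.
Qed.

Lemma sup_gap_ub pi v c L x : (forall x, A (pi x)) -> (forall x, `|v x| <= c) ->
  cube (L - h) x -> gap M p eps h v pi x <= sup_gap M p eps h L v pi.
Proof.
move=> Ap vc xL; have [c' H] := gap_bounded Ap vc.
by apply: ub_le_sup; [exists c' => _ [y _ <-]; exact: H|exists x].
Qed.

Lemma sup_gap_ge0 pi v c L : h < L -> (forall x, A (pi x)) -> (forall x, `|v x| <= c) ->
  0 <= sup_gap M p eps h L v pi.
Proof.
move=> hL Ap vc; have c0 : cube (L - h) (0 : Rd) by apply: cube0; rewrite subr_ge0 ltW.
by apply: le_trans (sup_gap_ub Ap vc c0); exact: gap_ge0.
Qed.

Lemma sup_gap_lipschitz pi u v c c' L : h < L -> (forall x, A (pi x)) ->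
  (forall x, `|u x| <= c) -> (forall x, `|v x| <= c') ->
  sup_gap M p eps h L u pi <= sup_gap M p eps h L v pi
    + 2 * Num.sqrt dR * supb M / h * supn (cube L) (fun x => v x - u x).
Proof.
move=> hL Ap uc vc; have c0 : cube (L - h) (0 : Rd) by apply: cube0; rewrite subr_ge0 ltW.
apply: ge_sup; first by exists (gap M p eps h u pi 0), 0.
move=> _ [x xL <-]; set xi := supn _ _.
apply: le_trans (@gap_lipschitz _ _ _ M d_gt0 st p eps h pi u v x (Ap x)) _.
apply: lerD; first exact: sup_gap_ub vc xL.
have vuc y : `|v y - u y| <= c' + c by rewrite (le_trans (ler_normB _ _))// lerD.
have xi_ub y : nbr h x y -> `|v y - u y| <= xi.
  by move=> /(nbr_cube xL) yL; apply: (@le_supn _ _ _ _ (c' + c)) => // w _.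
have xi0 : 0 <= xi := supn_ge0 _ _.
(* Each entry of this gradient is a difference of two values of modulus at most [xi], over 2 h. *)
have H : enorm (gradh h u x - gradh h v x) <= Num.sqrt dR * (2 * xi / (2 * h)).
  rewrite gradhB; apply: gradh_bound => //; first by rewrite mulr_ge0.
  move=> y y' /xi_ub H1 /xi_ub H2; move: H1 H2; rewrite !ler_norml; lra.
have b0 := supb_gt0 d_gt0 st.
have := ler_wpM2l (mulr_ge0 (ler0n R 2) (ltW b0)) H; move=> /le_trans; apply.
by rewrite le_eqVlt; apply/orP; left; apply/eqP; field; rewrite gt_eqF.
Qed.

Section PolicyIteration.
Variables (pib : Rd -> Rm) (L : R).
Hypotheses (pib_policy : policy M pib) (hL : h < L).
Local Notation PiL := (loc_policy M pib h L).
Local Notation vL := (locval M p eps pib h L).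
Local Notation opRp := (opR M p eps pib h L).
Local Notation opt_err := (opt_err M p eps pib h L).

Let vL_spec : bounded_borel vL /\ forall x, opRp vL x = 0 :=
  locval_spec d_gt0 st p_ge0 p_le p_borel eps0 h0 L pib_policy.

Lemma locval_norm_le x : `|vL x| <= K.
Proof.
rewrite ger0_norm.
  exact: (locval_le d_gt0 st p_ge0 p_le p_borel eps0 h0 L pib_policy).
exact: (locval_ge0 d_gt0 st p_ge0 p_le p_borel eps0 h0 L pib_policy).
Qed.

Let SvL_norm pi x : policy M pi -> `|S pi x - vL x| <= K + K.
Proof.
by move=> mpi; rewrite (le_trans (ler_normB _ _))// lerD ?polval_norm_le ?locval_norm_le.
Qed.

Lemma opt_err_ub pi x : PiL pi -> `|S pi x - vL x| <= opt_err pi.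
Proof.
move=> Ppi; apply: (@le_supn _ _ _ (S pi \- vL) (K + K)) => // y _.
exact: SvL_norm Ppi.1.
Qed.

Lemma opt_err_le pi : PiL pi -> opt_err pi <= K.
Proof.
have K0 := le_trans (normr_ge0 _) (locval_norm_le 0).
move=> Ppi; apply: supn_le => // x _ /=.
have := polval_le d_gt0 st p_ge0 p_le p_borel eps0 h0 x Ppi.1.
have := locval_ge0 d_gt0 st p_ge0 p_le p_borel eps0 h0 L pib_policy x.
have := locval_le_polval d_gt0 st p_ge0 p_le p_borel eps0 h0 x Ppi.
by rewrite /K ler_norml; lra.
Qed.

(** Since [S pi] is a supersolution of the localized Bellman equation, passing to [pi'] raises the
    value by at most g / lam everywhere. One step then compares [pi'] with an action nearly optimal
    for the localized value and contracts by gam; the losses combine through g / mu + gam g / lam =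
    g / lam. *)
Lemma policy_improvement pi pi' : PiL pi -> PiL pi' ->
  opt_err pi' <= gam * opt_err pi + sup_gap M p eps h L (S pi) pi' / lm.
Proof.
move=> Ppi Ppi'; set g := sup_gap _ _ _ _ _ _ _; set e := opt_err pi.
have Sc y := polval_norm_le y Ppi.1.
have g0 : 0 <= g := sup_gap_ge0 hL Ppi'.1.2 Sc.
have e0 : 0 <= e := supn_ge0 _ _.
have [_ S0] := polval_spec d_gt0 st p_ge0 p_le p_borel eps0 h0 Ppi.1.
have [_ S0'] := polval_spec d_gt0 st p_ge0 p_le p_borel eps0 h0 Ppi'.1.
have RL y : opRp (S pi) y <= opLp pi' (S pi) y + g.
  rewrite /opR; case: asboolP => yL.
    by have := sup_gap_ub Ppi'.1.2 Sc yL; rewrite -/g /gap; lra.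
  by rewrite /opL /opA (Ppi'.2 y yL); lra.
have improve y : S pi' y <= S pi y + g / lm.
  apply: (@mixR_comparison _ _ _ M d_gt0 st p eps h h0 set0 pi' _ _ K g Ppi'.1.2) => w.
  - exact: polval_norm_le Ppi'.1.
  - exact: Sc.
  - rewrite /mixR; case: asboolP => // _; rewrite S0' (le_trans _ (RL w))//.
    exact: (opR_polval_ge0 d_gt0 st p_ge0 p_le p_borel eps0 h0 w Ppi).
apply: supn_le => [|x _ /=].
  by apply: addr_ge0; [exact: mulr_ge0|rewrite divr_ge0// ltW].
have := locval_le_polval d_gt0 st p_ge0 p_le p_borel eps0 h0 x Ppi'.
rewrite -subr_ge0 => /ger0_norm ->; apply/ler_addgt0Pr => eta eta0.
have eta1 : 0 < eta * mu by rewrite mulr_gt0.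
have [a Aa [va au]] := mixR_action d_gt0 st p eps h (cube (L - h)) vL
  (pib_policy.2 x) eta1.
have {va} : opRp vL x < opLp (fun=> a) vL x + eta * mu by [].
rewrite vL_spec.2 opL_step// => va.
have {au} : opLp (fun=> a) (S pi) x <= opRp (S pi) x := au _.
move=> /le_trans/(_ (RL x)); rewrite !opL_step// => au.
have := S0' x; rewrite opL_step// => Sx.
have H1 : stepP M h (pi' x) (S pi') x - stepP M h (pi' x) (S pi) x <= g / lm.
  rewrite -stepPB; apply: stepP_ub => //; first exact: Ppi'.1.2.
  by move=> y _; have := improve y; lra.
have H2 : stepP M h a (S pi) x - stepP M h a vL x <= e.
  rewrite -stepPB; apply: stepP_ub => // y _.
  exact: le_trans (ler_norm _) (opt_err_ub _ Ppi).
have Lam0 := ltW (Lamh_gt0 d_gt0 st h0).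
have := ler_wpM2l Lam0 H1; have := ler_wpM2l Lam0 H2; rewrite !mulrBr => H3 H4.
rewrite -(ler_pM2l mu0).
have -> : mu * (gam * e + g / lm + eta) = Lam * e + (g + Lam * (g / lm)) + eta * mu.
  have gE : mu * (g / lm) = g + Lam * (g / lm).
    by rewrite /muh mulrDl mulrCA divff ?gt_eqF// mulr1.
  by rewrite -gE -[in RHS]gamh_mu//; ring.
by rewrite mulrBr; lra.
Qed.

Lemma policy_iteration_error (pis : nat -> Rd -> Rm) (vs : nat -> Rd -> R) n :
  (forall j, (j <= n)%N -> PiL (pis j)) ->
  (forall j, (j <= n)%N -> bounded_borel (vs j)) ->
  opt_err (pis n) <= gam ^+ n * opt_err (pis 0%N)
    + lm^-1 * \sum_(0 <= j < n) gam ^+ (n - 1 - j) *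
        (sup_gap M p eps h L (vs j) (pis j.+1)
         + 2 * Num.sqrt dR * supb M / h * eval_err M p eps h L (pis j) (vs j)).
Proof.
move=> Ppi bv; apply: (geometric_recursion (e := fun j => opt_err (pis j)) (t := fun j =>
  sup_gap M p eps h L (vs j) (pis j.+1)
  + 2 * Num.sqrt dR * supb M / h * eval_err M p eps h L (pis j) (vs j)) (l := lm)) => //.
move=> j jn; have Pj := Ppi j (ltnW jn); have Pj1 := Ppi j.+1 jn.
rewrite (le_trans (policy_improvement Pj Pj1))// lerD2l ler_pM2r ?invr_gt0//.
have [_ [c vc]] := bv j (ltnW jn).
exact: (sup_gap_lipschitz hL Pj1.1.2 (fun x => polval_norm_le x Pj.1) vc).
Qed.

End PolicyIteration.
End Comparison.

(** * The jump chain and its occupation times *)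

Section JumpChain.
Context {R : realType} {d m : nat} (M : model R d m).
Hypotheses (d_gt0 : (0 < d)%N) (st : standing M).
Local Notation Rd := 'rV[R]_d.
Local Notation Rm := 'rV[R]_m.
Local Notation borel_fun v := (measurable_fun setT ((v : Rd -> R) : Borel Rd -> R)).
Implicit Types (x z : Rd) (v phi : Rd -> R).

Definition iterP h (pi : Rd -> Rm) n v : Rd -> R :=
  iter n (fun w z => stepP M h (pi z) w z) v.

(** Without repetitions, since [jump_prob] already adds the weights of coinciding neighbours. *)
Let nbs h y : seq Rd := undup ([seq y + h *: delta_mx 0 i | i <- enum 'I_d]
                            ++ [seq y - h *: delta_mx 0 i | i <- enum 'I_d]).

Let sum_delta (s : seq Rd) (g : Rd -> R) c : uniq s -> c \in s ->
  \sum_(z <- s) (z == c)%:R * g z = g c.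
Proof.
move=> us cs; rewrite (bigD1_seq c)//= eqxx mul1r big1 ?addr0// => z /negbTE->.
by rewrite mul0r.
Qed.

Lemma jump_prob_sum h pi y (g : Rd -> R) :
  \sum_(z <- nbs h y) jump_prob M h pi y z * g z = stepP M h (pi y) g y.
Proof.
rewrite /jump_prob /stepP; under eq_bigr do rewrite mulr_suml.
rewrite exchange_big; apply: eq_bigr => i _ /=.
under eq_bigr do rewrite mulrDl -!mulrA.
have in1 : y + h *: delta_mx 0 i \in nbs h y.
  by rewrite mem_undup mem_cat (map_f (fun i => y + h *: delta_mx 0 i))// mem_enum.
have in2 : y - h *: delta_mx 0 i \in nbs h y.
  by rewrite mem_undup mem_cat orbC (map_f (fun i => y - h *: delta_mx 0 i))// mem_enum.
by rewrite big_split/= !sum_delta ?undup_uniq// !mulrA.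
Qed.

Lemma jump_prob_ge0 h pi y z : Act M (pi y) -> 0 <= jump_prob M h pi y z.
Proof.
move=> Ap; apply: sumr_ge0 => i _; have [? ?] := weight_ge0 st y i Ap.
by rewrite addr_ge0// mulr_ge0.
Qed.

Variables (dT : measure_display) (T : measurableType dT) (P : probability T R).
Variables (Y : nat -> T -> Rd) (h : R) (pi : Rd -> Rm) (x : Rd).
Hypotheses (h0 : 0 < h) (pi_policy : policy M pi).
Hypothesis chain : jump_chain M P Y h pi x.

Let Ev k (y : nat -> Rd) : set T := [set w | forall j, (j <= k)%N -> Y j w = y j].

Let Y_meas k : measurable_fun setT (Y k : T -> Borel Rd) := let: And3 a _ _ := chain in a k.

Let set1_borel z : measurable ([set z] : set (Borel Rd)).
Proof.
rewrite -[X in measurable X]setCK; apply: measurableC; apply: open_borel.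
apply: closed_openC => y /closure_enorm H; apply/eqP; rewrite -subr_eq0; apply/eqP.
apply: enorm_eq0; apply/eqP; rewrite eq_le enorm_ge0 andbT.
by apply/ler_addgt0Pr => e e0; rewrite add0r; have [_ -> /ltW] := H e e0.
Qed.

Let Ev_meas k y : measurable (Ev k y).
Proof.
elim: k => [|k IH].
  rewrite (_ : Ev 0 y = Y 0%N @^-1` [set y 0%N]).
    by rewrite -[X in measurable X]setTI; exact: Y_meas.
  apply/seteqP; split=> w /=; first exact.
  by move=> Yw j; rewrite leqn0 => /eqP->.
rewrite (_ : Ev k.+1 y = Ev k y `&` Y k.+1 @^-1` [set y k.+1]).
  apply: measurableI => //.
  by rewrite -[X in measurable X]setTI; exact: Y_meas.
apply/seteqP; split=> w /=.
  by move=> H; split=> [j jk|]; apply: H => //; exact: leqW.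
by move=> [H1 H2] j; rewrite leq_eqVlt => /predU1P[->//|]; exact: H1.
Qed.

Lemma iterP_ge0 n v : (forall z, 0 <= v z) -> forall z, 0 <= iterP h pi n v z.
Proof.
move=> v0; elim: n => [//|n IH] z; rewrite /iterP iterS.
by apply: stepP_lb => // [|y _]; [exact: pi_policy.2|exact: IH].
Qed.

Let phiY_meas phi k D : borel_fun phi -> measurable_fun D (fun w => (phi (Y k w))%:E).
Proof.
move=> mphi; apply: measurable_funTS; apply/measurable_EFinP.
exact: (@measurableT_comp _ _ _ _ (Borel Rd) R phi).
Qed.

(** Induction on the number [n] of further steps, for all prefixes: the event that the path follows
    [y] up to time [k] splits according to the next state among finitely many neighbours. What
    remains is a null set because the jump probabilities sum to 1. *)
Lemma integral_path phi n : borel_fun phi -> (forall z, 0 <= phi z) -> forall k y,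
  (\int[P]_(w in Ev k y) (phi (Y (k + n)%N w))%:E
   = P (Ev k y) * (iterP h pi n phi (y k))%:E)%E.
Proof.
move=> mphi phi0; elim: n => [|n IH] k y.
  rewrite addn0 muleC -integral_cst//; apply: eq_integral => w.
  by rewrite inE /= => ->.
pose yz z j := if (j <= k)%N then y j else z.
have Evz z : Ev k (yz z) = Ev k y.
  by apply/seteqP; split=> w H j jk; have := H j jk; rewrite /yz jk.
pose F z := Ev k.+1 (yz z).
have PF z : P (F z) = (P (Ev k y) * (jump_prob M h pi (y k) z)%:E)%E.
  by case: chain => _ _ /(_ k (yz z)); rewrite -/(Ev k _) Evz /yz leqnn ltnn.
pose s := nbs h (y k).
have tF : trivIset [set` s] F.
  move=> z1 z2 _ _ [w [/(_ k.+1 (leqnn _)) H1 /(_ k.+1 (leqnn _)) H2]].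
  by move: H1 H2; rewrite /yz ltnn => -> ->.
pose D' := \big[setU/set0]_(z <- s) F z.
have mD' : measurable D' by apply: bigsetU_measurable => z _; exact: Ev_meas.
have D'D : D' `<=` Ev k y.
  rewrite /D' -bigcup_seq => w [z _ Fw] j jk.
  by have := Fw j (leqW jk); rewrite /yz jk.
have int_D' g : (forall w, (0 <= g w)%E) -> measurable_fun setT g ->
    (\int[P]_(w in D') g w = \sum_(z <- s) \int[P]_(w in F z) g w)%E.
  move=> g0 mg; apply: ge0_integral_bigsetU => [z||||w _]; last exact: g0.
  - exact: Ev_meas.
  - exact: undup_uniq.
  - exact: tF.
  - exact: measurable_funTS.
have PD' : P D' = P (Ev k y).
  rewrite -[LHS]mul1e -integral_cst// int_D'; last 2 first.
  - by move=> w; exact: lee01.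
  - exact: measurable_cst.
  rewrite (eq_bigr (fun z => (P (Ev k y) * (jump_prob M h pi (y k) z)%:E)%E)); last first.
    move=> z _; rewrite -PF -[RHS]mul1e -integral_cst//.
    exact: Ev_meas.
  rewrite -ge0_sume_distrr; last first.
    by move=> z _; rewrite lee_fin jump_prob_ge0//; exact: pi_policy.2.
  rewrite sumEFin (_ : \sum_(z <- s) _ = 1) ?mule1//.
  rewrite -[RHS](stepP_cst d_gt0 st h (pi (y k)) (y k) 1) -jump_prob_sum.
  by apply: eq_bigr => z _; rewrite mulr1.
have N0 : P (Ev k y `\` D') = 0%E.
  have Poo : (P (Ev k y) < +oo)%E by rewrite (le_lt_trans (probability_le1 _ _)) ?ltry.
  have PI : P (Ev k y `&` D') = P (Ev k y) by rewrite setIidr.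
  apply: (etrans (@measureD _ _ _ P _ _ (Ev_meas k y) mD' Poo)).
  transitivity (P (Ev k y) - P (Ev k y))%E; last by rewrite subee ?fin_num_measure.
  by congr (_ - _)%E; exact: PI.
rewrite (ge0_negligible_integral (measurableD (Ev_meas k y) mD') (Ev_meas k y)
  (@phiY_meas phi (k + n.+1) _ mphi) _ N0); last by move=> w _; rewrite lee_fin.
rewrite setDD setIidr// int_D'; last 2 first.
- by move=> w; rewrite lee_fin.
- exact: phiY_meas.
rewrite addnS -addSn.
rewrite (eq_bigr (fun z => (P (Ev k y) *
    (jump_prob M h pi (y k) z * iterP h pi n phi z)%:E)%E)); last first.
  by move=> z _; rewrite IH PF -muleA -EFinM /yz ltnn.
rewrite -ge0_sume_distrr => [|z _]; first by rewrite sumEFin jump_prob_sum.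
rewrite lee_fin mulr_ge0//; first by apply: jump_prob_ge0; exact: pi_policy.2.
exact: iterP_ge0.
Qed.

Lemma expectation_chain phi n : borel_fun phi -> (forall z, 0 <= phi z) ->
  (\int[P]_w (phi (Y n w))%:E = (iterP h pi n phi x)%:E)%E.
Proof.
move=> mphi phi0; have PE : P (Ev 0 (fun=> x)) = 1%E.
  case: chain => _ <- _; congr (P _); apply/seteqP; split=> w /=; first exact.
  by move=> Yw j; rewrite leqn0 => /eqP->.
have N0 : P (~` Ev 0 (fun=> x)) = 0%E by rewrite probability_setC// PE subee.
rewrite (ge0_negligible_integral (measurableC (Ev_meas 0 (fun=> x))) measurableT
  (@phiY_meas phi n _ mphi) _ N0); last by move=> w _; rewrite lee_fin.
rewrite setDE setCK setTI.
by have := integral_path n mphi phi0 0 (fun=> x); rewrite add0n PE mul1e.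
Qed.

Local Notation mu := (muh M h).
Local Notation gam := (gamh M h).
Let mu0 : 0 < mu := muh_gt0 d_gt0 st h0.
Let gam0 : 0 <= gam := gamh_ge0 d_gt0 st h0.

Lemma discountedE phi : borel_fun phi -> (forall z, 0 <= phi z) ->
  discounted M P Y h phi =
  ((mu^-1)%:E * \sum_(k <oo) (gam ^+ k * iterP h pi k phi x)%:E)%E.
Proof.
move=> mphi phi0; rewrite /discounted integral_nneseries//; first last.
- by move=> k w _; rewrite lee_fin mulr_ge0// exprn_ge0.
- move=> k; apply/measurable_EFinP; apply: measurable_funM => //.
  exact: (@measurableT_comp _ _ _ _ (Borel Rd) R phi).
congr (_ * _)%E; apply: eq_eseriesr => k _; under eq_integral do rewrite EFinM.
rewrite ge0_integralZl//; last 3 first.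
- exact: phiY_meas.
- by move=> w _; rewrite lee_fin.
- by rewrite lee_fin exprn_ge0.
by rewrite expectation_chain.
Qed.

Let iterPS n v z : iterP h pi n.+1 v z = iterP h pi n (fun z => stepP M h (pi z) v z) z.
Proof. by rewrite /iterP iterSr. Qed.

Let iterP_le n u v : (forall z, u z <= v z) -> forall z, iterP h pi n u z <= iterP h pi n v z.
Proof.
move=> uv; elim: n => [//|n IH] z; rewrite /iterP !iterS.
by apply: stepP_le => // [|y _]; [exact: pi_policy.2|exact: IH].
Qed.

Let iterP_lin n (a c : R) u v z : iterP h pi n (fun z => a * u z + c * v z) z =
  a * iterP h pi n u z + c * iterP h pi n v z.
Proof.
elim: n z => [//|n IH] z; rewrite /iterP !iterS -!/(iterP h pi n _).
rewrite -!(stepPZ M h (pi z)) -stepPD.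
by rewrite (_ : iterP h pi n _ = fun z => a * iterP h pi n u z + c * iterP h pi n v z)//;
  apply/funext.
Qed.

Let partial phi n : R := \sum_(0 <= k < n) gam ^+ k * iterP h pi k phi x.

(** Dynkin's formula over [n] steps, as an inequality for supersolutions. *)
Let unroll_ge phi V n : (forall z, phi z <= opA M h pi V z) ->
  mu^-1 * partial phi n + gam ^+ n * iterP h pi n V x <= V x.
Proof.
move=> HV; elim: n => [|n IH]; first by rewrite /partial big_geq// mulr0 add0r mul1r.
rewrite (le_trans _ IH)// /partial big_nat_recr// mulrDr -addrA lerD2l.
rewrite mulrCA exprSr -mulrA -mulrDr ler_wpM2l ?exprn_ge0//.
rewrite iterPS -iterP_lin; apply: iterP_le => z.
rewrite [leRHS](opA_stepE d_gt0 st h0 pi) lerD2r mulrC ler_pM2r ?invr_gt0//.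
Qed.

Let unroll_le phi V n : (forall z, opA M h pi V z <= phi z) ->
  V x <= mu^-1 * partial phi n + gam ^+ n * iterP h pi n V x.
Proof.
move=> HV; elim: n => [|n IH]; first by rewrite /partial big_geq// mulr0 add0r mul1r.
rewrite (le_trans IH)// /partial big_nat_recr// mulrDr -addrA lerD2l.
rewrite mulrCA exprSr -mulrA -mulrDr ler_wpM2l ?exprn_ge0//.
rewrite iterPS -iterP_lin; apply: iterP_le => z.
rewrite [leLHS](opA_stepE d_gt0 st h0 pi) lerD2r mulrC ler_pM2l ?invr_gt0//.
Qed.

Let term_ge0 phi : (forall z, 0 <= phi z) ->
  forall k, (0 <= (gam ^+ k * iterP h pi k phi x)%:E)%E.
Proof. by move=> phi0 k; rewrite lee_fin mulr_ge0 ?exprn_ge0// iterP_ge0. Qed.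

(** The remainder in the unrolled inequality is nonnegative and is dropped. *)
Lemma discounted_le phi V : borel_fun phi -> (forall z, 0 <= phi z) ->
  (forall z, 0 <= V z) -> (forall z, phi z <= opA M h pi V z) ->
  (discounted M P Y h phi <= (V x)%:E)%E.
Proof.
move=> mphi phi0 V0 HV; rewrite discountedE//.
rewrite lee_pdivrMl//; apply: lime_le.
  by apply: is_cvg_nneseries => k _ _; exact: term_ge0.
apply: nearW => n; rewrite sumEFin -EFinM lee_fin -ler_pdivrMl//.
rewrite (le_trans _ (unroll_ge n HV))// lerDl mulr_ge0 ?exprn_ge0//.
exact: iterP_ge0.
Qed.

(** The converse passage, from an expectation to a pointwise bound on a subsolution: here the
    remainder is at most gam^n B, which tends to 0. *)
Lemma le_discounted phi V c B : borel_fun phi -> (forall z, 0 <= phi z) ->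
  (forall z, V z <= B) -> (forall z, opA M h pi V z <= phi z) ->
  (discounted M P Y h phi <= c%:E)%E -> V x <= c.
Proof.
move=> mphi phi0 VB HV; rewrite discountedE// => dc; rewrite -subr_le0.
apply: (le_geometric d_gt0 st h0 (c2 := B)) => n.
have pc : mu^-1 * partial phi n <= c.
  rewrite -lee_fin (le_trans _ dc)// EFinM lee_pmul2l ?lte_fin ?invr_gt0//.
  by rewrite -sumEFin; apply: nneseries_lim_ge => k _ _; exact: term_ge0.
have := unroll_le n HV; have : iterP h pi n V x <= B.
  elim: n x {pc} => [//|n IH] z; rewrite /iterP iterS.
  by apply: stepP_ub => // [|y _]; [exact: pi_policy.2|exact: IH].
by move=> /(ler_wpM2l (exprn_ge0 n gam0)); lra.
Qed.

End JumpChain.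

Section Occupation.
Context {R : realType} {d m : nat} (M : model R d m).
Hypotheses (d_gt0 : (0 < d)%N) (st : standing M).
Local Notation Rd := 'rV[R]_d.
Local Notation lm := (lam M).
Variables (h : R) (pi : Rd -> 'rV[R]_m).
Hypotheses (h0 : 0 < h) (pi_act : forall x, Act M (pi x)).
Implicit Types (x y z w : Rd).
Local Notation mu := (muh M h).
Local Notation Lam := (Lamh M h).
Local Notation gam := (gamh M h).

Let lm0 : 0 < lm := lam_gt0 st.
Let mu0 : 0 < mu := muh_gt0 d_gt0 st h0.
Let gam0 : 0 <= gam := gamh_ge0 d_gt0 st h0.

(** The chain needs at least [k] jumps to reach [G], and the discounted time of the first [k] steps
    is (1 - gam^k) / lam. *)
Lemma occupation_lower (V : Rd -> R) (G : set Rd) :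
  (forall y, 0 <= V y) -> (forall y, ~ G y -> 1 <= opA M h pi V y) ->
  forall k x, (forall w, G w -> k%:R * h - h < enorm (w - x)) ->
    1 - gam ^+ k <= lm * V x.
Proof.
move=> V0 GV; elim=> [|k IH] x Gx; first by rewrite expr0 subrr mulr_ge0// ltW.
have xG : ~ G x.
  move=> /Gx; rewrite subrr enorm0 -natr1 mulrDl mul1r addrK ltNge.
  by rewrite mulr_ge0// ltW.
have Vy y : nbr h x y -> (1 - gam ^+ k) / lm <= V y.
  move=> xy; rewrite ler_pdivrMr// mulrC; apply: IH => w Gw.
  have := Gx w Gw; have := enorm_triangle y w x.
  by rewrite (enormB y x) (nbr_dist (ltW h0) xy) -natr1; lra.
have := opA_lb d_gt0 st h0 (pi_act x) (GV x xG) Vy.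
have -> : 1 / mu = (1 - gam) * (1 / lm) := divr_muh d_gt0 st h0 1.
move=> /(ler_wpM2l (ltW lm0)); apply: le_trans.
rewrite exprS le_eqVlt; apply/orP; left; apply/eqP; field.
by rewrite gt_eqF.
Qed.

(* Let [tau] be the exit time from [D], and suppose that [D] is left in more than
   [n] steps from any point of [near].  The function [chi n] below plays the role
   of [E gam^(max(tau - n, 0))]; it is a subsolution of the equation of the
   occupation time of the complement of [near], and it equals
   [gam^(-n) E gam^tau] at points from which leaving [D] takes [n] steps. *)
Lemma occupation_decay (D near : set Rd) (Oc U : Rd -> R) (B : R) (n : nat) :
  (forall x, `|U x| <= B) -> (forall x, 0 <= Oc x <= lm^-1) ->
  (forall x, D x -> opA M h pi Oc x = 0) ->
  (forall x, D x -> 0 <= opA M h pi U x) ->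
  (forall x, D x -> ~ near x -> 1 <= opA M h pi U x) ->
  (forall x, ~ D x -> (2 * lm)^-1 <= U x) ->
  (forall x, D x -> near x -> forall z, ~ D z -> n%:R * h < enorm (x - z)) ->
  forall x, (forall z, ~ D z -> n%:R * h < enorm (x - z)) ->
    Oc x <= 2 * gam ^+ n * U x.
Proof.
move=> UB Oc1 OcD UD Ufar Uout near_deep.
pose psi x := lm * Oc x.
have psi01 x : 0 <= psi x <= 1.
  have /andP[q0 q1] := Oc1 x; rewrite mulr_ge0 ?(ltW lm0)//=.
  by rewrite -ler_pdivlMl// mulr1.
have psiD x : D x -> gam * stepP M h (pi x) psi x = psi x.
  move=> Dx; have := opA_stepE d_gt0 st h0 pi psi x.
  by rewrite /psi opAZ// OcD// mulr0 mul0r add0r.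
(* Each iteration replaces one discounted step inside [D] by an undiscounted one. *)
pose chi k := iter k (fun (w : Rd -> R) x => if `[< D x >] then stepP M h (pi x) w x else 1) psi.
have chiD k x : D x -> chi k.+1 x = stepP M h (pi x) (chi k) x.
  by move=> Dx; rewrite /chi iterS; case: asboolP.
have chi_out k x : ~ D x -> chi k.+1 x = 1 by move=> Dx; rewrite /chi iterS; case: asboolP.
have chi1 k x : 0 <= chi k x <= 1.
  elim: k x => [|k IH] x; first exact: psi01.
  have [Dx|/chi_out->] := pselect (D x); last by rewrite ler01 lexx.
  rewrite chiD// stepP_ub//=; last by move=> y _; have /andP[] := IH y.
  by rewrite stepP_lb// => y _; have /andP[] := IH y.
have chi_mono k x : chi k x <= chi k.+1 x.
  elim: k x => [|k IH] x; have [Dx|Dx] := pselect (D x).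
  - rewrite chiD// -[leLHS]/(psi x) -(psiD _ Dx) ler_piMl//.
      by apply: stepP_lb => // y _; have /andP[] := psi01 y.
    exact/ltW/gamh_lt1.
  - by rewrite chi_out//; have /andP[] := psi01 x.
  - by rewrite (chiD k.+1)// chiD//; apply: stepP_le => // y _; exact: IH.
  - by rewrite !chi_out.
have chi_deep k x : (forall z, ~ D z -> k%:R * h - h < enorm (x - z)) ->
    gam ^+ k * chi k x = psi x.
  elim: k x => [|k IH] x deep; first by rewrite mul1r.
  have Dx : D x.
    apply: contrapT => /deep; rewrite subrr enorm0 -natr1 mulrDl mul1r addrK ltNge.
    by rewrite mulr_ge0// ltW.
  rewrite chiD// exprS -mulrA -stepPZ -[RHS]psiD//; congr (_ * _).
  apply: stepP_eq => // y xy; apply: IH => z /deep.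
  by have := enorm_triangle y x z; rewrite (nbr_dist (ltW h0) xy) -natr1; lra.
(* Since [chi] increases with its index, chi k <= P (chi k) in [D], so the operator is at most (mu -
   Lam) P (chi k) <= lam. *)
have chi_A k x : D x -> opA M h pi (chi k) x <= lm.
  move=> Dx; rewrite opA_step//; have := chi_mono k x; rewrite chiD// => H.
  have := ler_wpM2l (ltW mu0) H.
  have P1 : stepP M h (pi x) (chi k) x <= 1.
    by apply: stepP_ub => // y _; have /andP[] := chi1 k y.
  have := ler_wpM2l (ltW lm0) P1.
  have : mu * stepP M h (pi x) (chi k) x = lm * stepP M h (pi x) (chi k) x
      + Lam * stepP M h (pi x) (chi k) x by rewrite /muh mulrDl.
  lra.
have chi_deepA x : D x -> (forall z, ~ D z -> n%:R * h < enorm (x - z)) ->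
    opA M h pi (chi n) x = 0.
  move=> Dx deep; have gn : 0 < gam ^+ n by rewrite exprn_gt0// gamh_gt0.
  apply: (mulfI (lt0r_neq0 gn)); rewrite mulr0 -opAZ// opA_step// chi_deep; last first.
    by move=> z /deep; apply: lt_trans; rewrite ltrBlDr ltrDl.
  rewrite (stepP_eq st (v := psi))//; last first.
    move=> y xy; apply: chi_deep => z /deep.
    by have := enorm_triangle y x z; rewrite (nbr_dist (ltW h0) xy); lra.
  by rewrite -gamh_mu// mulrAC -(psiD _ Dx) (mulrC mu) subrr.
(* The factor 1 / (2 lam) is the lower bound for [U] outside [D]. In [D] off [near], the operator
   applied to the left side is at most 1/2; in [near] it vanishes. *)
have chiU x : chi n x / (2 * lm) <= U x.
  have l2 : 0 < 2 * lm by rewrite mulr_gt0.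
  rewrite -subr_le0.
  apply: (@walk_max _ _ _ M d_gt0 st h h0 (fun y => chi n y / (2 * lm) - U y)
    ((2 * lm)^-1 + B)) => [y|y C C0 zC].
    have /andP[_ c1] := chi1 n y; have := UB y; rewrite ler_norml => /andP[+ _].
    have : chi n y / (2 * lm) <= (2 * lm)^-1 by rewrite ler_piMl// invr_ge0 ltW.
    lra.
  have [Dy|Dy] := pselect (D y); last first.
    apply: (@le_trans _ _ 0); last exact: mulr_ge0.
    rewrite subr_le0 (le_trans _ (Uout _ Dy))//.
    by rewrite ler_piMl ?invr_ge0 ?(ltW l2)//; have /andP[] := chi1 n y.
  have H : opA M h pi (fun y => chi n y / (2 * lm) - U y) y <= 0.
    have -> : opA M h pi (fun y => chi n y / (2 * lm) - U y) y =
        (2 * lm)^-1 * opA M h pi (chi n) y - opA M h pi U y.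
      rewrite opAB//; congr (_ - _); rewrite -opAZ//; congr opA.
      by apply/funext => w; rewrite mulrC.
    have [ny|ny] := pselect (near y).
      by rewrite chi_deepA ?mulr0 ?sub0r ?oppr_le0 ?UD//; exact: near_deep.
    have := Ufar y Dy ny; have := chi_A n y Dy.
    have il2 : 0 < (2 * lm)^-1 by rewrite invr_gt0.
    move=> /(ler_wpM2l (ltW il2)); have -> : (2 * lm)^-1 * lm = 2^-1.
      by field; rewrite gt_eqF.
    lra.
  by have := opA_ub d_gt0 st h0 (pi_act y) H (fun w _ => zC w); rewrite mul0r add0r.
move=> x deep; have gn : 0 <= gam ^+ n by rewrite exprn_ge0.
have : gam ^+ n * chi n x = psi x 
  by apply: chi_deep => z /deep; apply: lt_trans; rewrite ltrBlDr ltrDl.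
rewrite /psi => psix; have := ler_wpM2l gn (chiU x); rewrite mulrA psix.
have -> : lm * Oc x / (2 * lm) = Oc x / 2 by field; rewrite gt_eqF.
lra.
Qed.

Lemma gamh_ge_half : lm * h <= 2 * d%:R * Nv M -> 2^-1 <= gam.
Proof.
move=> lh; have Lam0 := Lamh_gt0 d_gt0 st h0.
have lL : lm <= Lam by rewrite /Lamh ler_pdivlMr.
by rewrite /gamh ler_pdivlMr// /muh; lra.
Qed.

End Occupation.

(** * The truncated distance penalty and its square *)

Section Penalty.
Context {R : realType} {d m : nat} (M : model R d m).
Hypotheses (d_gt0 : (0 < d)%N) (st : standing M).
Local Notation Rd := 'rV[R]_d.
Local Notation clO := (closure (Om M)).
Local Notation borel_fun v := (measurable_fun setT ((v : Rd -> R) : Borel Rd -> R)).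
Variables (rad : R).
Hypotheses (rad_gt0 : 0 < rad).
Implicit Types (x y : Rd) (delta : R).

Let clO0 : clO !=set0.
Proof. by have [x Ox] := dom_nonempty st; exists x; exact: subset_closure. Qed.

Lemma pen_dist_ge0 x : 0 <= pen_dist M rad x.
Proof. by rewrite le_min dist_ge0//= ltW. Qed.

Lemma pen_dist_le x : pen_dist M rad x <= rad.
Proof. by rewrite ge_min lexx orbT. Qed.

Lemma pen_dist_lipschitz x y : `|pen_dist M rad x - pen_dist M rad y| <= enorm (x - y).
Proof.
have := dist_lipschitz clO0 x y; rewrite /pen_dist.
set u := dist x _; set v := dist y _; have := enorm_ge0 (x - y).
rewrite !ler_norml /Order.min; case: ifP; case: ifP; lra.
Qed.

Lemma pen_dist_eq0 x : pen_dist M rad x = 0 <-> clO x.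
Proof.
have H := dist_eq0 clO0 x.
rewrite -((closure_id clO).1 (@closed_closure _ _)) in H.
rewrite -H /pen_dist; split=> [|->]; last by rewrite min_l// ltW.
by rewrite /Order.min; case: ifP => // _ r0; move: rad_gt0; rewrite r0 ltxx.
Qed.

Lemma pen_dist_borel : borel_fun (pen_dist M rad).
Proof.
apply: continuous_borel_real; apply: (lipschitz_continuous (k := 1)) => // x y.
by rewrite mul1r; exact: pen_dist_lipschitz.
Qed.

Lemma pen_sq_ge0 x : 0 <= pen_sq M rad x.
Proof. exact: sqr_ge0. Qed.

Lemma pen_sq_le x : pen_sq M rad x <= rad ^+ 2.
Proof. by rewrite lerXn2r ?nnegrE ?pen_dist_le ?pen_dist_ge0// ltW. Qed.

Lemma pen_sq_le_dist x : pen_sq M rad x <= rad * pen_dist M rad x.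
Proof. by rewrite /pen_sq expr2 ler_wpM2r ?pen_dist_ge0// pen_dist_le. Qed.

Lemma pen_sq_lipschitz : lipschitz_in setT (2 * rad) (pen_sq M rad).
Proof.
move=> x y _ _; rewrite /pen_sq subr_sqr normrM mulrC.
apply: ler_pM => //; last exact: pen_dist_lipschitz.
have := pen_dist_le x; have := pen_dist_le y; have := pen_dist_ge0 x.
by have := pen_dist_ge0 y; rewrite ler_norml; lra.
Qed.

Lemma pen_sq_eq0 x : pen_sq M rad x = 0 <-> clO x.
Proof.
rewrite -pen_dist_eq0; split=> [/eqP|H]; last by rewrite /pen_sq H expr0n.
by rewrite sqrf_eq0 => /eqP.
Qed.

Lemma pen_sq_borel : borel_fun (pen_sq M rad).
Proof. by apply: measurable_funX; exact: pen_dist_borel. Qed.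

Lemma cdel_gt0 delta : 0 < delta -> 0 < cdel rad delta.
Proof. by move=> d0; rewrite exprn_gt0// lt_min d0. Qed.

Lemma cdel_le_pen_sq delta x : 0 < delta -> delta <= dist x clO ->
  cdel rad delta <= pen_sq M rad x.
Proof.
move=> d0 dx; rewrite lerXn2r ?nnegrE ?pen_dist_ge0//; first by rewrite le_min !ltW.
by rewrite le_min /pen_dist !ge_min dx lexx orbT.
Qed.

Lemma dist_ge_closed delta : closed [set x | delta <= dist x clO].
Proof.
have := @closed_comp _ _ (fun x => dist x clO) [set t | delta <= t].
apply => [x _|]; last exact: closed_ge.
apply: (lipschitz_continuous (k := 1)) => // y z.
by rewrite mul1r; exact: dist_lipschitz.
Qed.

Lemma dist_indic_borel delta :
  borel_fun (\1_[set x | delta <= dist x clO] : Rd -> R).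
Proof.
apply: (@measurable_indic _ (Borel Rd)).
rewrite -[X in measurable X]setCK; apply: measurableC; apply: open_borel.
exact/closed_openC/dist_ge_closed.
Qed.

End Penalty.

(** * Localization for the squared penalty *)

Section SquaredPenalty.
Context {R : realType} {d m : nat} (M : model R d m).
Hypotheses (d_gt0 : (0 < d)%N) (st : standing M).
Variables (rad : R).
Hypothesis rad_gt0 : 0 < rad.
Local Notation Rd := 'rV[R]_d.
Local Notation Rm := 'rV[R]_m.
Local Notation clO := (closure (Om M)).
Local Notation lm := (lam M).
Local Notation dR := (d%:R : R).
Local Notation f := (rcost M).
Local Notation q := (pen_sq M rad).
Local Notation S := (polval M q).
Local Notation vF := (discval M q).
Implicit Types (x y z w : Rd) (eps h delta : R).

Let lm0 : 0 < lm := lam_gt0 st.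
Let clO0 : clO !=set0.
Proof. by have [x Ox] := dom_nonempty st; exists x; exact: subset_closure. Qed.
Let q0 : forall x, 0 <= q x := @pen_sq_ge0 _ _ _ M rad.
Let q1 : forall x, q x <= rad ^+ 2 := pen_sq_le st rad_gt0.
Let qB := pen_sq_borel st rad.

(** Where the indicator is 1, the penalty alone contributes at least c / eps to the operator applied
    to [S]. In this pointwise form the bound serves both the expectation in (ii) and the resolvent
    in (LOC). *)
Lemma far_indic_le eps h pi delta y : 0 < eps -> 0 < h -> policy M pi -> 0 < delta ->
  \1_[set y | delta <= dist y clO] y <=
  opA M h pi (fun y => eps / cdel rad delta * S eps h pi y) y.
Proof.
move=> e0 h0 mpi d0; have c0 := cdel_gt0 rad_gt0 d0.
rewrite opAZ// (polval_opA d_gt0 st q0 q1 qB e0 h0)// mulrDr.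
rewrite (_ : eps / cdel rad delta * (q y / eps) = q y / cdel rad delta); last first.
  by field; rewrite !gt_eqF.
have f0 : 0 <= eps / cdel rad delta * f y (pi y).
  apply: mulr_ge0; first by rewrite divr_ge0// ltW.
  exact: rcost_ge0 st _ _ (mpi.2 y).
have [yd|yd] := pselect (delta <= dist y clO).
  rewrite indicE mem_set//= (@le_trans _ _ (q y / cdel rad delta))// ?lerDr//.
  by rewrite ler_pdivlMr// mul1r; exact: cdel_le_pen_sq.
by rewrite indicE memNset//= addr_ge0// divr_ge0// ltW.
Qed.

Lemma Cext_gt0 : 0 < Cext M rad.
Proof.
have b0 := supb_gt0 d_gt0 st; have f0 := supf_ge0 d_gt0 st.
have s0 : 0 < Num.sqrt dR by rewrite sqrtr_gt0 ltr0n.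
have r0 : 0 < rad ^+ 2 by rewrite exprn_gt0.
by rewrite /Cext ltr_pwDl ?mulr_ge0// divr_gt0// !mulr_gt0// ltr_wpDl.
Qed.

Section Chain.
Variables (dT : measure_display) (T : measurableType dT) (P : probability T R).
Variables (Y : nat -> T -> Rd) (h : R) (pi : Rd -> Rm) (x : Rd).
Hypotheses (h0 : 0 < h) (pi_policy : policy M pi).
Hypothesis chain : jump_chain M P Y h pi x.

Lemma occupation_far eps C0 delta : 0 < eps -> S eps h pi x <= C0 -> 0 < delta ->
  (discounted M P Y h (\1_[set y | (delta <= dist y clO)%R] : Rd -> R)
    <= (eps * C0 / cdel rad delta)%:E)%E.
Proof.
move=> e0 SC d0; have c0 := cdel_gt0 rad_gt0 d0.
apply: (@le_trans _ _ (eps / cdel rad delta * S eps h pi x)%:E); last first.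
  by rewrite lee_fin mulrAC ler_pM2r ?invr_gt0// ler_pM2l.
apply: (discounted_le d_gt0 st h0 pi_policy chain (V := fun y => _ * S eps h pi y)).
- exact: dist_indic_borel.
- by move=> y; rewrite indicE.
- move=> y; apply: mulr_ge0; first by rewrite divr_ge0// ltW.
  exact: (polval_ge0 d_gt0 st q0 q1 qB e0 h0).
- by move=> y; exact: far_indic_le.
Qed.

(** The leakage hypothesis concerns an expectation at the single point [x]. It bounds the resolvent
    [V] of [pen_dist] at [x], and both conclusions are comparisons with multiples of [V], plus a
    constant in the second. *)
Lemma leakage_sq c eps : 0 < eps ->
  (discounted M P Y h (pen_dist M rad) <= c%:E)%E ->
  (discounted M P Y h q <= (rad * c)%:E)%E /\
  S eps h pi x <= supf M / lm + rad * c / eps.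
Proof.
move=> e0 dc; have pB := pen_dist_borel st rad.
have [V [[_ [B VB]] VA]] := resolvent d_gt0 st h0 pi_policy pB
  (fun x => introT andP (conj (pen_dist_ge0 st rad_gt0 x) (pen_dist_le M rad x))).
have Vc : V x <= c.
  apply: (le_discounted d_gt0 st h0 pi_policy chain (B := B)) dc => //.
  - exact: pen_dist_ge0.
  - by move=> z; rewrite (le_trans (ler_norm _)).
  - by move=> z; rewrite VA.
have V0 z : 0 <= V z.
  apply: (@opA_comparison _ _ _ M d_gt0 st h h0 pi (fun=> 0) V B pi_policy.2) => // y.
    by rewrite normr0 (le_trans (normr_ge0 (V y))).
  by rewrite opA_cst// mulr0 VA pen_dist_ge0.
split.
  apply: (@le_trans _ _ (rad * V x)%:E); last by rewrite lee_fin ler_pM2l.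
  apply: (discounted_le d_gt0 st h0 pi_policy chain (V := fun y => rad * V y)) => // z.
    by rewrite mulr_ge0// ltW.
  by rewrite opAZ// VA pen_sq_le_dist.
rewrite (@le_trans _ _ (supf M / lm + rad / eps * V x))//; last first.
  by rewrite lerD2l mulrAC ler_pM2r ?invr_gt0// ler_pM2l.
have [[_ [c' Sc]] _] := polval_spec d_gt0 st q0 q1 qB e0 h0 pi_policy.
rewrite -subr_le0.
apply: (@opA_max _ _ _ M d_gt0 st h h0 pi
  (fun y => S eps h pi y - (supf M / lm + rad / eps * V y)) c' pi_policy.2) => y.
  have := Sc y; rewrite ler_norml => /andP[_].
  have : 0 <= supf M / lm by rewrite divr_ge0 ?supf_ge0// ltW.
  have : 0 <= rad / eps * V y by apply: mulr_ge0 => //; rewrite divr_ge0// ltW.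
  lra.
have E : opA M h pi (fun y => supf M / lm + rad / eps * V y) y =
    supf M + rad / eps * pen_dist M rad y.
  rewrite (opAD d_gt0 st h0 pi (fun=> supf M / lm) (fun y => rad / eps * V y)).
  by rewrite opA_cst// opAZ// VA mulrCA divff ?gt_eqF// mulr1.
rewrite opAB// E (polval_opA d_gt0 st q0 q1 qB e0 h0)//.
have := supf_ub st y (pi_policy.2 y).
have : q y / eps <= rad / eps * pen_dist M rad y.
  rewrite [leRHS]mulrAC ler_pM2r ?invr_gt0//.
  exact: pen_sq_le_dist.
lra.
Qed.

End Chain.

Section Localization.
Variables (pib : Rd -> Rm) (h0' eps h L delta DL : R) (K : set Rd).
Hypotheses (pib_policy : policy M pib) (h0_le1 : h0' <= 1).
Hypothesis loc : localization M rad h0' eps h L delta DL K.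
Local Notation gam := (gamh M h).
Local Notation vL := (locval M q eps pib h L).
Local Notation Kn := (supf M + rad ^+ 2).

Let h0 : 0 < h. Proof. by have [] := loc_box loc. Qed.
Let eps0 : 0 < eps. Proof. by have /andP[] := loc_eps loc. Qed.
Let eps1 : eps <= 1. Proof. by have /andP[] := loc_eps loc. Qed.
Let h1 : h <= 1.
Proof.
by have := loc_h loc; rewrite le_min => /andP[hh _]; exact: le_trans hh h0_le1.
Qed.
Let delta0 : 0 < delta. Proof. by have /andP[] := loc_delta loc. Qed.
Let D2 : 0 < delta / 2. Proof. by rewrite divr_gt0. Qed.
Let c := cdel rad (delta / 2).
Let c0 : 0 < c. Proof. exact: cdel_gt0. Qed.
Let gam0 : 0 <= gam := gamh_ge0 d_gt0 st h0.

(** Origin of [Cext]: the discrete value lies between 0 and [Me], so its discrete gradient is at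
    most sqrt(d) Me / (2 h), and eps <= 1 gives eps Me <= (supf + rad^2) / lam. The cost term is
    absorbed by h eps <= 1. *)
Let Cext_gap pi x : policy M pi ->
  gap M q eps h (vF eps h) pi x <= Cext M rad / (h * eps).
Proof.
move=> mpi; set Me := (supf M + rad ^+ 2 / eps) / lm.
have vF0 y : 0 <= vF eps h y := discval_ge0 d_gt0 st q0 q1 qB eps0 h0 mpi y.
have vF1 y : vF eps h y <= Me := discval_le d_gt0 st q0 q1 qB eps0 h0 L mpi y.
have Me0 : 0 <= Me := le_trans (vF0 0) (vF1 0).
have gb : enorm (gradh h (vF eps h) x) <= Num.sqrt dR * (Me / (2 * h)).
  apply: gradh_bound => // y z _ _; rewrite ler_norml.
  by have := vF0 y; have := vF1 y; have := vF0 z; have := vF1 z; lra.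
have b0 := supb_gt0 d_gt0 st; have f0 := supf_ge0 d_gt0 st.
rewrite (le_trans (gap_ub d_gt0 st q eps h (vF eps h) (mpi.2 x)))//.
have he : 0 < h * eps by rewrite mulr_gt0.
have MeK : Me * eps <= Kn / lm.
  rewrite /Me mulrAC ler_pM2r ?invr_gt0// mulrDl divfK ?gt_eqF// lerD2r.
  by rewrite ler_piMr.
rewrite ler_pdivlMr// mulrDl /Cext lerD//; last first.
  have : h * eps <= 1 by rewrite -[leRHS]mulr1 ler_pM// ltW.
  by move=> /(ler_wpM2l f0); lra.
apply: (@le_trans _ _ (2 * supb M * (Num.sqrt dR * (Me / (2 * h))) * (h * eps))).
  by rewrite ler_wpM2r ?(ltW he)// ler_wpM2l// mulr_ge0// ltW.
have -> : 2 * supb M * (Num.sqrt dR * (Me / (2 * h))) * (h * eps) =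
  Num.sqrt dR * supb M * (Me * eps) by field; rewrite gt_eqF.
have sb : 0 <= Num.sqrt dR * supb M by rewrite mulr_ge0 ?sqrtr_ge0// ltW.
have KL : 0 <= Kn / lm by rewrite divr_ge0 ?addr_ge0 ?sqr_ge0// ltW.
have := ler_wpM2l sb MeK; have := mulr_ge0 sb KL.
have -> : 2 * Num.sqrt dR * supb M * Kn / lm = 2 * (Num.sqrt dR * supb M * (Kn / lm)).
  by ring.
lra.
Qed.

(** The margin condition measures distances to the complement of Q_L, while policies are frozen
    outside Q_L^h. The passage costs [h], whence the [DL + h] in that condition. *)
Let out_cube z : ~ cube (L - h) z -> exists2 w, ~ cube L w & enorm (z - w) = h.
Proof.
move=> /existsNP[i /negP]; rewrite negb_and -!ltNge => /orP[zi|zi].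
  exists (z - h *: delta_mx 0 i) => [/(_ i)|].
    by rewrite !mxE !eqxx mulr1 => /andP[]; lra.
  by apply: nbr_dist; [exact: ltW|exists i; right].
exists (z + h *: delta_mx 0 i) => [/(_ i)|].
  by rewrite !mxE !eqxx mulr1 => /andP[]; lra.
by apply: nbr_dist; [exact: ltW|exists i; left].
Qed.

Let n := Num.truncn (DL / h).

Let DLn : n%:R * h <= DL.
Proof.
rewrite -ler_pdivlMr// truncn_le divr_ge0// ltW//.
exact: loc_DL loc.
Qed.

(** Rounding DL / h down loses at most one factor gam >= 1/2, hence the 2. *)
Let decay_n : gam ^+ n <= 2 * decay M DL.
Proof.
have DLn1 : DL <= n.+1%:R * h by rewrite -ler_pdivrMr// ltW// truncnS_gt.
have := gamhX_le_decay d_gt0 st h0 (loc_lamh loc) DLn1.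
have := gamh_ge_half d_gt0 st h0 (loc_lamh loc).
have gn : 0 <= gam ^+ n by rewrite exprn_ge0.
by move=> /(ler_wpM2r gn); rewrite exprS; lra.
Qed.

Let far_strip x : DL + h < dist x (~` cube L) ->
  forall z, ~ cube (L - h) z -> n%:R * h < enorm (x - z).
Proof.
move=> xD z /out_cube[w wL zw]; apply: le_lt_trans DLn _.
have := enorm_triangle z x w; rewrite zw.
have := dist_le x (wL : (~` cube L) w); lra.
Qed.

(** The decay estimate with [D] the inner box and [near] the points closer than delta / 2 to the
    domain. The 4 is the 2 of that estimate times the 2 of the rounding. *)
Let occupation_K pi (Oc U : Rd -> R) x : policy M pi -> bounded_borel Oc -> bounded_borel U ->
  (forall y, opA M h pi Oc y = \1_(~` cube (L - h)) y) ->
  (forall y, opA M h pi U y = \1_[set y | delta / 2 <= dist y clO] y) ->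
  K x -> Oc x <= 4 * decay M DL * U x.
Proof.
move=> mpi [_ [B1 OcB]] [_ [B2 UB]] OcA UA Kx.
have ind01 (D : set Rd) y : 0 <= (\1_D y : R) <= 1.
  by rewrite indicE ler0n lern1 leq_b1.
have ind1 (D : set Rd) y : D y -> \1_D y = 1 :> R by move=> Dy; rewrite indicE mem_set.
have ind0 (D : set Rd) y : ~ D y -> \1_D y = 0 :> R by move=> Dy; rewrite indicE memNset.
have U0 y : 0 <= U y.
  apply: (@opA_comparison _ _ _ M d_gt0 st h h0 pi (fun=> 0) U B2 mpi.2) => // w.
    by rewrite normr0 (le_trans (normr_ge0 (U w))).
  by rewrite opA_cst// mulr0 UA; have /andP[] := ind01 [set y | delta / 2 <= dist y clO] w.
have Oc0 y : 0 <= Oc y.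
  apply: (@opA_comparison _ _ _ M d_gt0 st h h0 pi (fun=> 0) Oc B1 mpi.2) => // w.
    by rewrite normr0 (le_trans (normr_ge0 (Oc w))).
  by rewrite opA_cst// mulr0 OcA; have /andP[] := ind01 (~` cube (L - h)) w.
have Oc1 y : Oc y <= lm^-1.
  rewrite -[leRHS]mul1r.
  apply: (@opA_sup_le _ _ _ M d_gt0 st h h0 pi Oc 1 B1 mpi.2) => w.
    exact: le_trans (ler_norm _) (OcB w).
  by rewrite OcA; have /andP[] := ind01 (~` cube (L - h)) w.
(* From outside the inner box, the set at distance at most delta / 2 from the domain is [DLh] away,
   so the chain first spends about DLh / h steps in the far region; [loc_exp] makes their discounted
   time at least half of 1 / lam. *)
have Uout y : ~ cube (L - h) y -> (2 * lm)^-1 <= U y.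
  move=> yL; set G := [set x | dist x clO <= delta / 2].
  have D0 := loc_DLh loc; have D0' : 0 <= DLh M delta h L by have := h0; lra.
  have [k [_ Dk kD]] := @ceil_nat _ (DLh M delta h L / h) (divr_ge0 D0' (ltW h0)).
  have Gy w : G w -> k%:R * h - h < enorm (w - y).
    move=> Gw; apply: lt_le_trans (@fine_dist_set_le _ _ G (~` cube (L - h)) w y Gw yL).
    by rewrite -/(DLh M delta h L); move: kD; rewrite ltr_pdivlMr// mulrBl mul1r.
  have := @occupation_lower _ _ _ M d_gt0 st h pi h0 mpi.2 U G U0 _ k y Gy.
  have Gfar w : ~ G w -> 1 <= opA M h pi U w.
    by move=> /negP; rewrite -ltNge => /ltW Gw; rewrite UA ind1.
  move=> /(_ Gfar); have : gam ^+ k <= decay M (DLh M delta h L).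
    by apply: gamhX_le_decay (loc_lamh loc) _ => //; rewrite -ler_pdivrMr.
  have : decay M (DLh M delta h L) <= 2^-1.
    have n0 := visc_gt0 st; have dR0 : 0 < dR by rewrite ltr0n.
    rewrite /decay !mulNr expRN lef_pV2 ?posrE ?expR_gt0//.
    rewrite (le_trans (loc_exp loc))// ler_expR ler_pM2r ?invr_gt0 ?mulr_gt0//.
    by rewrite ler_pM2l//; have := h0; lra.
  move=> H1 H2 H3; rewrite invfM -(ler_pM2l lm0).
  by rewrite mulrCA divff ?gt_eqF// mulr1; lra.
(* By the margin condition, points of the box closer than delta to the domain are more than [DL + h]
   away from its complement. *)
have margin_deep y : cube (L - h) y -> dist y clO < delta / 2 ->
    forall z, ~ cube (L - h) z -> n%:R * h < enorm (y - z).
  move=> yL yO; apply: far_strip; rewrite ltNge; apply/negP => yD.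
  have [/(_ y) mg _ _] := loc_margin loc.
  have yL' : cube L y by apply: cube_le yL; have := h0; lra.
  by have := mg yL' yD; have := delta0; lra.
have K_deep : forall z, ~ cube (L - h) z -> n%:R * h < enorm (x - z).
  move=> z /out_cube[w wL zw]; apply: le_lt_trans DLn _.
  have [_ KD _] := loc_margin loc.
  have : DL + h < enorm (x - w).
    rewrite -lte_fin (lt_le_trans KD)//; apply: ereal_inf_lbound.
    by exists x => //; exists w.
  by have := enorm_triangle z x w; rewrite zw; lra.
have := @occupation_decay _ _ _ M d_gt0 st h pi h0 mpi.2 (cube (L - h))
  [set y | dist y clO < delta / 2] Oc U B2 n UB
  (fun y => introT andP (conj (Oc0 y) (Oc1 y))) _ _ _ Uout margin_deep x K_deep.
move=> H; apply: (le_trans (H _ _ _)) => [y yL|y yL|y yL ny|].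
- by rewrite OcA ind0//; apply.
- by rewrite UA; have /andP[] := ind01 [set y | delta / 2 <= dist y clO] y.
- by rewrite UA ind1//=; move/negP: ny; rewrite -leNgt.
- by have := ler_wpM2r (U0 x) decay_n; lra.
Qed.

Lemma locval_sub_discval_le x : K x -> vL x - vF eps h x <= h * vF eps h x.
Proof.
move=> Kx; apply/ler_addgt0Pr => e e0.
have vF0 y : 0 <= vF eps h y := discval_ge0 d_gt0 st q0 q1 qB eps0 h0 pib_policy y.
have [[mF [cF vFc]] F0] := discval_spec d_gt0 st q0 q1 qB eps0 h0.
(* A gap of e lam / 2 contributes e / 2 to the value. *)
have eta0 : 0 < e * lm / 2 by rewrite divr_gt0// mulr_gt0.
have [pi Ppi gapeta] := @greedy_loc_policy _ _ _ M d_gt0 st q eps h qB pib L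
  pib_policy (vF eps h) (e * lm / 2) mF eta0.
have mpi := Ppi.1; have [[_ [cS Sc]] S0] := polval_spec d_gt0 st q0 q1 qB eps0 h0 mpi.
have indB (D : set Rd) (y : Rd) : 0 <= (\1_D y : R) <= 1.
  by rewrite indicE ler0n lern1 leq_b1.
have mO : measurable_fun setT (\1_(~` cube (L - h)) : Borel Rd -> R).
  by apply: measurable_indic; apply: measurableC; exact: cube_borel.
have [Oc [bO OA]] := resolvent d_gt0 st h0 mpi mO (indB _).
have [U [bU UA]] := resolvent d_gt0 st h0 mpi (dist_indic_borel st (delta / 2)) (indB _).
have OU := occupation_K mpi bO bU OA UA Kx.
set kap := Cext M rad / (h * eps).
have kap0 : 0 <= kap.
  by apply: le_trans (Cext_gap 0 mpi); apply: gap_ge0 => //; exact: mpi.2.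
have [[_ [BO OB]] [_ [BU UB]]] := (bO, bU).
have e2 : 0 <= e / 2 by rewrite divr_ge0// ltW.
have BO0 : 0 <= BO := le_trans (normr_ge0 _) (OB 0).
have BU0 : 0 <= BU := le_trans (normr_ge0 _) (UB 0).
have cS0 : 0 <= cS := le_trans (normr_ge0 _) (Sc 0).
have cF0 : 0 <= cF := le_trans (normr_ge0 _) (vFc 0).
have ec0 : 0 <= eps / c by rewrite divr_ge0// ltW.
have US : U x <= eps / c * S eps h pi x.
  apply: (@opA_comparison _ _ _ M d_gt0 st h h0 pi U (fun y => eps / c * S eps h pi y)
    (Num.max BU (eps / c * cS)) mpi.2) => y.
  - by rewrite le_max UB.
  - by rewrite normrM ger0_norm// le_max (ler_wpM2l ec0 (Sc y)) orbT.
  - by rewrite UA; exact: far_indic_le.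
have err : S eps h pi x <= vF eps h x + e / 2 + kap * Oc x.
  have H := @opA_comparison _ _ _ M d_gt0 st h h0 pi
    (fun y => S eps h pi y - vF eps h y) (fun y => e / 2 + kap * Oc y)
    (Num.max (cS + cF) (e / 2 + kap * BO)) mpi.2 _ _ _ x.
  suff: S eps h pi x - vF eps h x <= e / 2 + kap * Oc x by lra.
  apply: H => y.
  - by rewrite le_max (le_trans (ler_normB _ _))// lerD.
  - rewrite le_max; apply/orP; right; apply: le_trans (ler_normD _ _) _.
    apply: lerD; first by rewrite ger0_norm.
    by rewrite normrM ger0_norm// ler_wpM2l.
  - rewrite -(opLB d_gt0 st q eps h0) S0 sub0r opAD// opA_cst// opAZ// OA.
    have -> : - opL M q eps h pi (vF eps h) y = gap M q eps h (vF eps h) pi y.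
      by rewrite /gap F0 sub0r.
    have [yL|yL] := pselect (cube (L - h) y).
      rewrite indicE memNset ?mulr0 ?addr0; last by apply.
      by have := gapeta y yL; lra.
    rewrite indicE mem_set//= mulr1 (le_trans (Cext_gap y mpi))// lerDr.
    by apply: mulr_ge0; [exact: ltW|rewrite divr_ge0// ltW].
have Sx0 : 0 <= S eps h pi x := polval_ge0 d_gt0 st q0 q1 qB eps0 h0 x mpi.
have kS : kap * Oc x <= h / 3 * S eps h pi x.
  rewrite (le_trans (ler_wpM2l kap0 OU))//.
  have d4 : 0 <= 4 * decay M DL by rewrite mulr_ge0// expR_ge0.
  rewrite (le_trans (ler_wpM2l kap0 (ler_wpM2l d4 US)))//.
  have C0 := Cext_gt0.
  (* The identity behind (SM): [Cext], [eps] and [c] cancel and 4 / 12 of [h] is left. *)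
  have -> : h / 3 * S eps h pi x =
      kap * (4 * (c * h ^+ 2 / (12 * Cext M rad)) * (eps / c * S eps h pi x)).
    by rewrite /kap; field; rewrite !gt_eqF.
  apply: ler_wpM2l => //; apply: ler_wpM2r; first exact: mulr_ge0.
  by apply: ler_wpM2l => //; exact: loc_SM loc.
have vLS : vL x <= S eps h pi x := locval_le_polval d_gt0 st q0 q1 qB eps0 h0 x Ppi.
(* From S <= v + e/2 + (h/3) S with h <= 1 and v >= 0 it follows that S - v <= h v + e. *)
have hv := mulr_ge0 (ltW h0) (vF0 x).
have := vF0 x; have := h0; have := h1; nra.
Qed.

End Localization.
End SquaredPenalty.

(** * Continuous values *)

(* Monotonicity, homogeneity and a form of subadditivity of the integral of
   nonnegative functions that hold without measurability, the integral being the
   supremum over the simple functions below the integrand. *)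
Section NonnegIntegral.
Local Open Scope ereal_scope.
Import HBNNSimple.
Context d0 (T : measurableType d0) (R : realType) (mu : {measure set T -> \bar R}).
Implicit Types (D : set T) (f g : T -> \bar R).

Lemma nn_integral_le D f g : (forall x, D x -> 0 <= f x) ->
  (forall x, D x -> f x <= g x) ->
  \int[mu]_(x in D) f x <= \int[mu]_(x in D) g x.
Proof.
move=> f0 fg; rewrite !ge0_integralE//; last first.
  by move=> x Dx; exact: le_trans (f0 x Dx) (fg x Dx).
apply: ge_ereal_sup => _ [h hf <-]; apply: ereal_sup_ubound.
exists h => // x; rewrite (le_trans (hf x))// /patch.
by case: ifPn => //; rewrite inE => /fg.
Qed.

Let nn_integralZ_ge D f (c : R) : (0 < c)%R -> (forall x, D x -> 0 <= f x) ->
  c%:E * \int[mu]_(x in D) f x <= \int[mu]_(x in D) (c%:E * f x).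
Proof.
move=> c0 f0; rewrite !ge0_integralE//; last first.
  by move=> x Dx; rewrite mule_ge0// ?f0// lee_fin ltW.
rewrite -lee_pdivlMl//; apply: ge_ereal_sup => _ [h hf <-].
rewrite lee_pdivlMl// -sintegralrM; apply: ereal_sup_ubound.
exists (scale_nnsfun h (ltW c0)) => // x /=; have := hf x.
rewrite /patch; case: ifPn => _ hx; first by rewrite EFinM lee_pmul2l ?lte_fin.
rewrite lee_fin in hx; rewrite lee_fin.
by apply: mulr_ge0_le0 => //; exact: ltW.
Qed.

Lemma nn_integralZ D f (c : R) : (0 < c)%R -> (forall x, D x -> 0 <= f x) ->
  \int[mu]_(x in D) (c%:E * f x) = c%:E * \int[mu]_(x in D) f x.
Proof.
move=> c0 f0; apply/eqP; rewrite eq_le nn_integralZ_ge// andbT.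
have ci : (0 < c^-1)%R by rewrite invr_gt0.
have cf0 x : D x -> 0 <= c%:E * f x by move=> Dx; rewrite mule_ge0 ?f0// lee_fin ltW.
rewrite -lee_pdivrMl//; apply: le_trans (nn_integralZ_ge ci cf0) _.
apply: nn_integral_le => x Dx; rewrite muleA -EFinM mulVf ?gt_eqF// mul1e//.
exact: f0.
Qed.

(** A simple function h below f + g is at most max(h - g, 0) + g. The first summand is measurable
    and lies below [f], so measurability is asked of [g] alone; in the application [g] is a
    discounted constant. *)
Lemma nn_integral_subadd D f (g : T -> R) : measurable D -> measurable_fun D g ->
  (forall x, D x -> 0 <= f x) -> (forall x, D x -> (0 <= g x)%R) ->
  \int[mu]_(x in D) (f x + (g x)%:E) <=
  \int[mu]_(x in D) f x + \int[mu]_(x in D) (g x)%:E.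
Proof.
move=> mD mg f0 g0.
have fg0 x : D x -> 0 <= f x + (g x)%:E by move=> Dx; rewrite adde_ge0 ?f0 ?lee_fin ?g0.
rewrite (ge0_integralE mu fg0); apply: ge_ereal_sup => _ [h hfg <-].
pose G := g \_ D; have mG : measurable_fun setT G by apply/(measurable_restrictT _ _).1.
have G0 x : (0 <= G x)%R by rewrite /G /patch; case: ifPn => //; rewrite inE => /g0.
pose k x := Num.max (h x - G x)%R 0%R.
have mk : measurable_fun setT k by apply: measurable_maxr => //; apply: measurable_funB.
have k0 x : (0 <= k x)%R by rewrite le_max lexx orbT.
have -> : sintegral mu h = \int[mu]_x (h x)%:E.
  by rewrite integral_nnsfun// patch_setT.
apply: (@le_trans _ _ (\int[mu]_x ((k x)%:E + (G x)%:E))).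
  apply: nn_integral_le => x _; first by rewrite lee_fin.
  by rewrite -EFinD lee_fin -lerBlDr le_max lexx.
rewrite ge0_integralD//; last 4 first.
- by move=> x _; rewrite lee_fin.
- exact/measurable_EFinP.
- by move=> x _; rewrite lee_fin.
- exact/measurable_EFinP.
apply: leeD.
  rewrite [leRHS]integral_mkcond; apply: nn_integral_le => x _; first by rewrite lee_fin.
  have := hfg x; rewrite /k /G /patch; case: ifPn => xD hx.
    rewrite EFin_max EFinB ge_max leeBlDr//; apply/andP; split => //.
    by apply: f0; rewrite inE in xD.
  by rewrite lee_fin subr0 ge_max lexx andbT -lee_fin.
rewrite [leRHS]integral_mkcond.
by apply: nn_integral_le => x _; rewrite /G /patch; case: ifPn; rewrite ?lee_fin// inE => /g0.
Qed.

(** A simple function below the constant is supported in a measurable subset of [D], and only such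
    subsets have to be measured. *)
Lemma nn_integral_cst_le D (c v : R) : (0 <= c)%R ->
  (forall A, measurable A -> A `<=` D -> mu A <= v%:E) ->
  \int[mu]_(x in D) c%:E <= (c * v)%:E.
Proof.
move=> c0 Dv; rewrite ge0_integralE//; apply: ge_ereal_sup => _ [h hc <-].
pose A := [set x | h x != 0%R].
have mA : measurable A.
  rewrite (_ : A = h @^-1` (~` [set 0%R])); last by apply/seteqP; split=> x /= /eqP.
  by rewrite -[X in measurable X]setTI; apply: measurable_funP => //; exact: measurableC.
have AD : A `<=` D.
  move=> x /= hx; apply: contrapT => xD; have := hc x; rewrite /patch memNset//.
  rewrite lee_fin => hx0; move/eqP: hx; apply.
  by apply/eqP; rewrite eq_le hx0 fun_ge0.
have -> : sintegral mu h = \int[mu]_x (h x)%:E.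
  by rewrite integral_nnsfun// patch_setT.
apply: (@le_trans _ _ (\int[mu]_x (c * \1_A x)%:E)).
  apply: nn_integral_le => x _; first by rewrite lee_fin.
  rewrite lee_fin indicE; have [xA|xA] := boolP (x \in A).
    rewrite mulr1; have := hc x; rewrite /patch; case: ifPn => _; rewrite lee_fin//.
    by move=> /le_trans; apply.
  rewrite mulr0; move: xA; rewrite notin_setE /A /= => /negP; rewrite negbK.
  by move=> /eqP->.
under eq_integral do rewrite EFinM.
rewrite ge0_integralZl//; last exact/measurable_EFinP/measurable_indic.
rewrite integral_indic// setIT EFinM lee_wpmul2l ?lee_fin//.
exact: Dv.
Qed.

End NonnegIntegral.

Section UniformConvergence.
Context {R : realType} {U : choiceType}.

Lemma uniform_cvgP (T : Type) (F : set_system T) (FF : Filter F) (A : set U)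
    (g : T -> U -> R) (u : U -> R) :
  {uniform A, g @ F --> u} <->
  forall e, 0 < e -> \forall t \near F, forall x, A x -> `|u x - g t x| < e.
Proof.
split=> [gu e e0|H P].
  have := gu [set h | forall x, A x -> `|u x - h x| < e]; apply.
  apply/uniform_nbhs; exists [set xy | ball xy.1 e xy.2]; split => //.
  by rewrite -entourage_ballE; exists e.
move=> /uniform_nbhs[E [entE EP]].
move: entE; rewrite -entourage_ballE => -[e /= e0 eE].
have := H e e0; apply: filterS => t Ht; apply: EP => x Ax.
by apply: eE; exact: Ht.
Qed.

End UniformConvergence.

Section ContinuousValues.
Context {R : realType} {d m : nat} (M : model R d m).
Hypotheses (d_gt0 : (0 < d)%N) (st : standing M).
Local Notation Rd := 'rV[R]_d.
Local Notation Rm := 'rV[R]_m.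
Local Notation lm := (lam M).
Local Notation f := (rcost M).
Local Notation clO := (closure (Om M)).
Local Notation leb1 := (@lebesgue_measure R).
Local Notation half := (`[0, +oo[%classic : set R).
Implicit Types (x y : Rd) (al : R -> Rm) (X : R -> Rd) (g : Rd -> Rm -> R)
  (p : Rd -> R) (c C eps : R).

Let lm0 : 0 < lm := lam_gt0 st.

Let integrand g al X t := expR (- lm * t) * g (X t) (al t).

Let half_ge0 (t : R) : half t -> 0 <= t.
Proof. by rewrite /= in_itv/= andbT. Qed.

(** Up to the factor lam the integrand is the exponential density, of mass 1. *)
Lemma integral_discount :
  (\int[leb1]_(t in half) (expR (- lm * t))%:E = (lm^-1)%:E)%E.
Proof.
have H := integral_exponential_pdf lm0.
have E : (fun t => (exponential_pdf lm t)%:E) =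
    (fun t => lm%:E * (expR (- lm * t))%:E)%E \_ half.
  by apply/funext => t; rewrite /exponential_pdf /patch; case: ifPn.
have e0 t : half t -> (0 <= (expR (- lm * t))%:E)%E by rewrite lee_fin expR_ge0.
have Z : (\int[leb1]_(t in half) (lm%:E * (expR (- lm * t))%:E) =
    lm%:E * \int[leb1]_(t in half) (expR (- lm * t))%:E)%E.
  by apply: nn_integralZ.
rewrite E -integral_mkcond Z in H.
by rewrite -[LHS]mul1e -(mulVf (lt0r_neq0 lm0)) EFinM -muleA H mule1.
Qed.

Let integral_discountZ c : 0 <= c ->
  (\int[leb1]_(t in half) (c * expR (- lm * t))%:E = (c / lm)%:E)%E.
Proof.
rewrite le_eqVlt => /predU1P[<-|c0].
  by under eq_integral do rewrite mul0r; rewrite integral0 mul0r.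
under eq_integral do rewrite EFinM.
by rewrite nn_integralZ// ?integral_discount.
Qed.

Section Bounds.
Variables (g : Rd -> Rm -> R) (al : R -> Rm) (X : R -> Rd) (C : R).
Hypothesis gC : forall t, 0 <= t -> 0 <= g (X t) (al t) <= C.

Let integrand_ge0 t : half t -> (0 <= (integrand g al X t)%:E)%E.
Proof.
by move=> /half_ge0 t0; rewrite lee_fin mulr_ge0 ?expR_ge0//; have /andP[] := gC t0.
Qed.

Let integral_le : (\int[leb1]_(t in half) (integrand g al X t)%:E <= (C / lm)%:E)%E.
Proof.
have C0 : 0 <= C by have /andP[] := gC (lexx 0); exact: le_trans.
rewrite -integral_discountZ//; apply: nn_integral_le => // t /half_ge0 t0.
by rewrite lee_fin /integrand mulrC ler_wpM2r ?expR_ge0//; have /andP[] := gC t0.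
Qed.

Lemma cost_fin : (\int[leb1]_(t in half) (integrand g al X t)%:E)%E \is a fin_num.
Proof.
rewrite ge0_fin_numE; last exact: integral_ge0.
by rewrite (le_lt_trans integral_le)// ltry.
Qed.

Lemma cost_ge0 : 0 <= cost M g al X.
Proof. by rewrite fine_ge0// integral_ge0. Qed.

Lemma cost_le : cost M g al X <= C / lm.
Proof. by rewrite -lee_fin fineK// cost_fin. Qed.

End Bounds.

Lemma cost_le_add g1 g2 al X C1 C2 c : 0 <= c ->
  (forall t, 0 <= t -> 0 <= g1 (X t) (al t) <= C1) ->
  (forall t, 0 <= t -> 0 <= g2 (X t) (al t) <= C2) ->
  (forall t, 0 <= t -> g1 (X t) (al t) <= g2 (X t) (al t) + c) ->
  cost M g1 al X <= cost M g2 al X + c / lm.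
Proof.
move=> c0 g1C g2C g12.
rewrite -lee_fin EFinD !fineK; [|exact: cost_fin g2C|exact: cost_fin g1C].
rewrite -integral_discountZ//.
apply: (@le_trans _ _ (\int[leb1]_(t in half)
    ((integrand g2 al X t)%:E + (c * expR (- lm * t))%:E))%E).
  apply: nn_integral_le => t /half_ge0 t0.
    by rewrite lee_fin mulr_ge0 ?expR_ge0//; have /andP[] := g1C t t0.
  rewrite -EFinD lee_fin (mulrC c) -mulrDr ler_wpM2l ?expR_ge0//.
  exact: g12.
apply: nn_integral_subadd => //.
- apply: measurable_funTS; apply: measurable_funM => //.
  by apply: measurableT_comp => //; exact: measurable_funM.
- by move=> t /half_ge0 t0; rewrite lee_fin mulr_ge0 ?expR_ge0//; have /andP[] := g2C t t0.
- by move=> t _; rewrite mulr_ge0 ?expR_ge0.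
Qed.

Lemma sc_value_bounds x : 0 <= sc_value M x <= supf M / lm.
Proof.
have fC al X : control M al -> forall t, 0 <= t -> 0 <= f (X t) (al t) <= supf M.
  by move=> [_ alA] t t0; rewrite (rcost_ge0 st) ?supf_ub//=; exact: alA.
rewrite /sc_value; set E := [set J | _]; have E0 J : E J -> 0 <= J.
  by move=> [al [X [cal _ _ ->]]]; exact: cost_ge0 (fC al X cal).
(* If no control keeps the trajectory in the closed domain, the value is the infimum of the empty
   set, which is 0. *)
have [[J EJ]|nE] := pselect (E !=set0); last first.
  have -> : E = set0 by apply/seteqP; split=> // J EJ; case: nE; exists J.
  by rewrite inf0 lexx divr_ge0 ?supf_ge0// ltW.
rewrite lb_le_inf//=; last by exists J.
case: (EJ) => al [X [cal _ _ Je]]; apply: (@le_trans _ _ J).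
  by apply: ge_inf => //; exists 0 => ? /E0.
by rewrite Je; exact: cost_le (fC al X cal).
Qed.

Section PenalizedValues.
Variables (p : Rd -> R) (Bp eps : R).
Hypotheses (p_ge0 : forall y, 0 <= p y) (p_le : forall y, p y <= Bp) (eps0 : 0 < eps).

Let gp y a := f y a + eps^-1 * p y.

Lemma pen_cost_bounds al X : control M al ->
  forall t, 0 <= t -> 0 <= gp (X t) (al t) <= supf M + Bp / eps.
Proof.
move=> [_ alA] t t0; have Aa := alA t t0.
have := rcost_ge0 st (X t) Aa; have := supf_ub st (X t) Aa; rewrite /gp => f1 f0.
have p0 : 0 <= eps^-1 * p (X t) by rewrite mulr_ge0 ?invr_ge0// ltW.
have p1 : eps^-1 * p (X t) <= Bp / eps by rewrite mulrC ler_pM2r ?invr_gt0.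
lra.
Qed.

Lemma pen_value_bounds x : 0 <= pen_value M p eps x <= (supf M + Bp / eps) / lm.
Proof.
rewrite /pen_value; set E := [set J | _]; have E0 J : E J -> 0 <= J.
  by move=> [al [X [cal _ ->]]]; exact: cost_ge0 (@pen_cost_bounds al X cal).
have [[J EJ]|nE] := pselect (E !=set0); last first.
  have -> : E = set0 by apply/seteqP; split=> // J EJ; case: nE; exists J.
  rewrite inf0 lexx divr_ge0 ?(ltW lm0)// addr_ge0 ?supf_ge0//.
  by rewrite divr_ge0 ?(ltW eps0)// (le_trans (p_ge0 0)).
rewrite lb_le_inf//=; last by exists J.
case: (EJ) => al [X [cal _ Je]]; apply: (@le_trans _ _ J).
  by apply: ge_inf => //; exists 0 => ? /E0.
by rewrite Je; exact: cost_le (@pen_cost_bounds al X cal).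
Qed.

End PenalizedValues.

Lemma pen_value_le_add p1 p2 (B1 B2 e1 e2 c : R) x :
  (forall y, 0 <= p1 y <= B1) -> (forall y, 0 <= p2 y <= B2) ->
  0 < e1 -> 0 < e2 -> 0 <= c ->
  (forall y, p1 y / e1 <= p2 y / e2 + c) ->
  pen_value M p1 e1 x <= pen_value M p2 e2 x + c / lm.
Proof.
move=> p1B p2B e10 e20 c0 p12.
have p1_ge0 y : 0 <= p1 y by have /andP[] := p1B y.
have p1_le y : p1 y <= B1 by have /andP[] := p1B y.
have p2_ge0 y : 0 <= p2 y by have /andP[] := p2B y.
have p2_le y : p2 y <= B2 by have /andP[] := p2B y.
have b1 al X := @pen_cost_bounds p1 B1 e1 p1_ge0 p1_le e10 al X.
have b2 al X := @pen_cost_bounds p2 B2 e2 p2_ge0 p2_le e20 al X.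
rewrite /pen_value; set E1 := [set J | _]; set E2 := [set J | _].
have E10 J : E1 J -> 0 <= J by move=> [al [X [cal _ ->]]]; exact: cost_ge0 (b1 al X cal).
(* Both problems range over the same controls and trajectories, so their sets of costs are empty
   together, and then both infima are 0. *)
have [[J EJ]|nE] := pselect (E2 !=set0); last first.
  have -> : E2 = set0 by apply/seteqP; split=> // J EJ; case: nE; exists J.
  suff -> : E1 = set0 by rewrite inf0 add0r divr_ge0// ltW.
  apply/seteqP; split=> // J [al [X [cal tr _]]]; case: nE.
  by exists (cost M (fun y a => f y a + e2^-1 * p2 y) al X), al, X.
rewrite -lerBlDr; apply: lb_le_inf; first by exists J.
move=> _ [al [X [cal tr ->]]]; rewrite lerBlDr.
apply: (@le_trans _ _ (cost M (fun y a => f y a + e1^-1 * p1 y) al X)).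
  by apply: ge_inf; [exists 0 => ? /E10|exists al, X].
apply: (cost_le_add c0 (b1 al X cal) (b2 al X cal)) => t t0.
by rewrite -addrA lerD2l mulrC [e2^-1 * _]mulrC.
Qed.

Lemma pen_sq_value_cvg rad : 0 < rad ->
  {uniform clO, (fun eps => pen_value M (pen_dist M rad) eps) @ 0^'+ --> sc_value M} ->
  {uniform clO, (fun eps => pen_value M (pen_sq M rad) eps) @ 0^'+ --> sc_value M}.
Proof.
move=> rad0 /uniform_cvgP H; apply/uniform_cvgP => e e0.
have e2 : 0 < e / 2 by rewrite divr_gt0.
have pdB y : 0 <= pen_dist M rad y <= rad by rewrite pen_dist_ge0//= pen_dist_le.
have psB y : 0 <= pen_sq M rad y <= rad ^+ 2 by rewrite pen_sq_ge0/= pen_sq_le.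
have [r /= r0 Hr] := H (e / 2) e2.
have {}Hr t x : 0 < t < r -> clO x ->
    `|sc_value M x - pen_value M (pen_dist M rad) t x| < e / 2.
  move=> /andP[t0 tr]; apply: (Hr t) => //.
  by rewrite /= sub0r normrN gtr0_norm.
pose t := r / 2; have t0 : 0 < t by rewrite divr_gt0.
have tr : t < r by rewrite /t; lra.
(* Below this threshold for [eps], the error term eps / (4 t^2 lam) of the lower estimate is at most
   e / 2. *)
have c0 : 0 < 4 * t ^+ 2 * lm * (e / 2) by rewrite !mulr_gt0// exprn_gt0.
near=> eps.
have eps0 : 0 < eps by near: eps; exact: nbhs_right_gt.
have epsr : eps < r * rad by near: eps; apply: nbhs_right_lt; rewrite mulr_gt0.
have epsc : eps < 4 * t ^+ 2 * lm * (e / 2) by near: eps; apply: nbhs_right_lt.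
move=> x Ox.
have up : pen_value M (pen_sq M rad) eps x <=
    pen_value M (pen_dist M rad) (eps / rad) x + 0 / lm.
  apply: (pen_value_le_add x psB pdB) => //; first by rewrite divr_gt0.
  move=> y; rewrite addr0.
  have -> : pen_dist M rad y / (eps / rad) = rad * pen_dist M rad y / eps.
    by field; rewrite !gt_eqF.
  by rewrite ler_pM2r ?invr_gt0//; exact: pen_sq_le_dist.
(* [q >= 2 s p - s^2] with [s = eps / (2 t)] *)
have lo : pen_value M (pen_dist M rad) t x <=
    pen_value M (pen_sq M rad) eps x + eps / (4 * t ^+ 2) / lm.
  apply: (pen_value_le_add x pdB psB) => //.
    by rewrite divr_ge0 ?(ltW eps0)// mulr_ge0// sqr_ge0.
  move=> y; rewrite -(ler_pM2r eps0) mulrDl divfK ?gt_eqF//.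
  have -> : eps / (4 * t ^+ 2) * eps = (eps / (2 * t)) ^+ 2 by field; rewrite gt_eqF.
  have -> : pen_dist M rad y / t * eps = 2 * pen_dist M rad y * (eps / (2 * t)).
    by field; rewrite gt_eqF.
  have := sqr_ge0 (pen_dist M rad y - eps / (2 * t)).
  by rewrite /pen_sq; set s := eps / (2 * t); nra.
have h1 := Hr t x ltac:(by rewrite t0) Ox.
have er : 0 < eps / rad < r by rewrite divr_gt0//= ltr_pdivrMr.
have h2 := Hr (eps / rad) x er Ox.
have h3 : eps / (4 * t ^+ 2) / lm <= e / 2.
  rewrite -mulrA -invfM ler_pdivrMr ?mulr_gt0 ?exprn_gt0//.
  by rewrite mulrC ltW.
move: h1 h2 up lo; rewrite mul0r addr0 !ltr_norml; lra.
Unshelve. all: by end_near. Qed.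

End ContinuousValues.

(** * Total error and refinement *)

Section Residuals.
Context {R : realType} {d m : nat} (M : model R d m).
Hypotheses (d_gt0 : (0 < d)%N) (st : standing M).
Variables (rad : R).
Hypothesis rad_gt0 : 0 < rad.
Local Notation Rd := 'rV[R]_d.
Local Notation Rm := 'rV[R]_m.
Local Notation clO := (closure (Om M)).
Local Notation lm := (lam M).
Local Notation dR := (d%:R : R).
Local Notation q := (pen_sq M rad).
Local Notation S := (polval M q).
Local Notation vF := (discval M q).
Implicit Types (x y z w : Rd) (delta : R) (v : Rd -> R).

Let lm0 : 0 < lm := lam_gt0 st.
Let q0 : forall x, 0 <= q x := @pen_sq_ge0 _ _ _ M rad.
Let q1 : forall x, q x <= rad ^+ 2 := pen_sq_le st rad_gt0.
Let qB := pen_sq_borel st rad.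

Variables (eps h : R).
Hypotheses (eps0 : 0 < eps) (h0 : 0 < h).
Local Notation gam := (gamh M h).
Local Notation Mq := (Meps M rad eps).

Let gam0 : 0 <= gam := gamh_ge0 d_gt0 st h0.

Lemma Meps_ge0 : 0 <= Mq.
Proof.
rewrite divr_ge0 ?(ltW lm0)// addr_ge0 ?supf_ge0//.
by rewrite divr_ge0 ?sqr_ge0// ltW.
Qed.

Lemma residual_policy v pi L (E : set Rd) x : bounded_borel v -> policy M pi ->
  0 <= L -> E `<=` cube L -> E x ->
  `|v x - S eps h pi x| <= lm^-1 * supn (cube (L - h)) (opL M q eps h pi v)
    + gam ^ Num.ceil (fine (dist_set E (strip h L)) / h)
      * supn (strip h L) (v \- S eps h pi).
Proof.
move=> [_ [c vc]] mpi L0 EL Ex; set r := supn (cube (L - h)) _.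
have [[_ [cS Sc]] S0] := polval_spec d_gt0 st q0 q1 qB eps0 h0 mpi.
have zc y : `|v y - S eps h pi y| <= c + cS by rewrite (le_trans (ler_normB _ _))// lerD.
have [c' rc] := opL_bounded d_gt0 st q0 q1 eps0 h0 mpi.2 vc.
have r0 : 0 <= r := supn_ge0 _ _.
apply: (@propagation_set _ _ _ M d_gt0 st h h0 L (lm^-1 * r) _ (c + cS)
  (fun y => v y - S eps h pi y)) => //.
- by rewrite mulr_ge0// invr_ge0 ltW.
- exact: supn_ge0.
- move=> y C yL zC; have := divr_muh d_gt0 st h0 r; rewrite (mulrC r lm^-1) => <-.
  apply: (@mixR_local_norm _ _ _ M d_gt0 st q eps h h0 set0 pi _ _ _ _ _ (mpi.2 y)) => //.
  rewrite /mixR; case: asboolP => // _; rewrite S0 subr0.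
  exact: (@le_supn _ _ _ _ c').
- by move=> y yS; apply: (@le_supn _ _ _ (v \- S eps h pi) (c + cS)) => // w _; exact: zc.
Qed.

Lemma residual_box v pi L L' : bounded_borel v -> policy M pi -> 0 <= L' ->
  (cube L : set Rd) `<=` cube L' -> lm * h <= 2 * dR * Nv M ->
  supn (cube L) (v \- S eps h pi)
    <= lm^-1 * supn (cube (L' - h)) (opL M q eps h pi v)
       + decay M (fine (dist_set (cube L) (strip h L' : set Rd)))
         * (supn (strip h L') v + Mq).
Proof.
move=> bv mpi L0 LL lh; have [_ [c vc]] := bv.
have sS : supn (strip h L') (v \- S eps h pi) <= supn (strip h L') v + Mq.
  apply: supn_le => [|x Sx /=]; first by rewrite addr_ge0 ?supn_ge0 ?Meps_ge0.
  rewrite (le_trans (ler_normB _ _))// lerD//.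
    exact: (@le_supn _ _ _ _ c).
  exact: polval_norm_le.
apply: supn_le => [|x xL].
  apply: addr_ge0; first by rewrite mulr_ge0 ?invr_ge0 ?(ltW lm0)// supn_ge0.
  by rewrite mulr_ge0 ?expR_ge0// addr_ge0 ?supn_ge0 ?Meps_ge0.
rewrite (le_trans (residual_policy bv mpi L0 LL xL))// lerD2l.
apply: ler_pM => //; [|exact: supn_ge0|exact: gamh_ceil_le_decay].
by rewrite exprz_ge0.
Qed.

Lemma residual_locval pib v L L' (E : set Rd) x : policy M pib -> bounded_borel v ->
  0 <= L' -> E `<=` cube L' -> E x ->
  `|v x - locval M q eps pib h L x|
    <= lm^-1 * supn (cube (L' - h)) (opR M q eps pib h L v)
       + gam ^ Num.ceil (fine (dist_set E (strip h L')) / h)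
         * (supn (strip h L') v + Mq).
Proof.
move=> mpib [_ [c vc]] L0 EL Ex; set r := supn (cube (L' - h)) _.
have [_ v0] := locval_spec d_gt0 st q0 q1 qB eps0 h0 L mpib.
have Sc := locval_norm_le d_gt0 st q0 q1 qB eps0 h0 L mpib.
set cS := (supf M + rad ^+ 2 / eps) / lm in Sc.
set w := locval M q eps pib h L in v0 Sc *.
have zc y : `|v y - w y| <= c + cS by rewrite (le_trans (ler_normB _ _))// lerD.
have [c' rc] := mixR_bounded d_gt0 st q0 q1 eps0 h0 (cube (L - h)) mpib.2 vc.
have r0 : 0 <= r := supn_ge0 _ _.
apply: (@propagation_set _ _ _ M d_gt0 st h h0 L' (lm^-1 * r) _ (c + cS)
  (fun y => v y - w y)) => //.
- by rewrite mulr_ge0// invr_ge0 ltW.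
- by rewrite addr_ge0 ?supn_ge0 ?Meps_ge0.
- move=> y C yL zC; have := divr_muh d_gt0 st h0 r; rewrite (mulrC r lm^-1) => <-.
  apply: (@mixR_local_norm _ _ _ M d_gt0 st q eps h h0 (cube (L - h)) pib _ _ _ _ _
    (mpib.2 y)) => //.
  have -> : mixR M q eps h (cube (L - h)) pib w y = 0 := v0 y.
  rewrite subr0; apply: (@le_supn _ _ _ (opR M q eps pib h L v) c') => // y' _.
  exact: rc.
- move=> y yS; rewrite (le_trans (ler_normB _ _))// lerD//.
  by apply: (@le_supn _ _ _ _ c).
Qed.

End Residuals.

Section TotalError.
Context {R : realType} {d m : nat} (M : model R d m).
Hypotheses (d_gt0 : (0 < d)%N) (st : standing M).
Variables (rad : R) (pib : 'rV[R]_d -> 'rV[R]_m) (h0 Cb : R).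
Hypotheses (rad_gt0 : 0 < rad) (pib_policy : policy M pib) (h0_le1 : h0 <= 1).
Local Notation Rd := 'rV[R]_d.
Local Notation Rm := 'rV[R]_m.
Local Notation clO := (closure (Om M)).
Local Notation lm := (lam M).
Local Notation dR := (d%:R : R).
Local Notation q := (pen_sq M rad).
Local Notation S := (polval M q).
Local Notation vF := (discval M q).
Implicit Types (x y z w : Rd).

Hypothesis pib_bound : forall (eps h : R) x, 0 < eps -> 0 < h <= h0 -> h <= eps -> clO x ->
  S eps h pib x <= Cb.

Let q0 : forall x, 0 <= q x := @pen_sq_ge0 _ _ _ M rad.
Let q1 : forall x, q x <= rad ^+ 2 := pen_sq_le st rad_gt0.
Let qB := pen_sq_borel st rad.

(** The relative error [h * vF] becomes absolute through vF <= S pib <= Cb on the closed domain. *)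
Lemma locval_error eps h L delta DL K : localization M rad h0 eps h L delta DL K ->
  forall x, K x -> 0 <= locval M q eps pib h L x - vF eps h x <= h * Cb.
Proof.
move=> loc x Kx; have [hh0 _ _] := loc_box loc; have /andP[e0 _] := loc_eps loc.
have := loc_h loc; rewrite le_min => /andP[h1 he].
rewrite subr_ge0 (discval_le_locval d_gt0 st q0 q1 qB e0 hh0 L pib_policy)/=.
rewrite (le_trans (locval_sub_discval_le d_gt0 st rad_gt0 pib_policy h0_le1 loc Kx))//.
rewrite ler_pM2l// (le_trans (discval_le_polval d_gt0 st q0 q1 qB e0 hh0 pib_policy x pib_policy))//.
by apply: pib_bound => //; [rewrite hh0|exact: loc_KOm loc _ Kx].
Qed.

Lemma total_error eps h L delta DL K (pis : nat -> Rd -> Rm) (vs : nat -> Rd -> R) n :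
  localization M rad h0 eps h L delta DL K ->
  (forall j, (j <= n)%N -> loc_policy M pib h L (pis j)) ->
  (forall j, (j <= n)%N -> bounded_borel (vs j)) ->
  supn K (sc_value M \- vs n)
    <= supn K (sc_value M \- pen_value M q eps)
       + supn K (pen_value M q eps \- vF eps h)
       + h * Cb + gamh M h ^+ n * opt_err M q eps pib h L (pis 0%N)
       + lm^-1 * \sum_(0 <= j < n) gamh M h ^+ (n - 1 - j) *
           (sup_gap M q eps h L (vs j) (pis j.+1)
            + 2 * Num.sqrt dR * supb M / h * eval_err M q eps h L (pis j) (vs j))
       + eval_err M q eps h L (pis n) (vs n).
Proof.
move=> loc Ppi bv; have [hh0 hL OL] := loc_box loc; have /andP[e0 _] := loc_eps loc.
have PIE := policy_iteration_error d_gt0 st q0 q1 qB e0 hh0 pib_policy hL Ppi bv.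
set W := _ + lm^-1 * _ in PIE.
have -> a b c e : a + b + c + gamh M h ^+ n * opt_err M q eps pib h L (pis 0%N)
  + lm^-1 * \sum_(0 <= j < n) gamh M h ^+ (n - 1 - j) *
           (sup_gap M q eps h L (vs j) (pis j.+1)
            + 2 * Num.sqrt dR * supb M / h * eval_err M q eps h L (pis j) (vs j))
  + e = a + b + c + W + e by rewrite /W !addrA.
set Mq := (supf M + rad ^+ 2 / eps) / lm.
have ub x := sc_value_bounds d_gt0 st x.
have pb x : 0 <= pen_value M q eps x <= Mq := pen_value_bounds d_gt0 st q0 q1 e0 x.
have v0 x := discval_ge0 d_gt0 st q0 q1 qB e0 hh0 pib_policy x.
have v1 x : vF eps h x <= Mq := discval_le d_gt0 st q0 q1 qB e0 hh0 L pib_policy x.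
have [_ [c vc]] := bv n (leqnn n).
have Sc x : `|S eps h (pis n) x| <= Mq :=
  polval_norm_le d_gt0 st q0 q1 qB e0 hh0 x (Ppi n (leqnn n)).1.
have xi0 : 0 <= eval_err M q eps h L (pis n) (vs n) := supn_ge0 _ _.
have oe0 : 0 <= opt_err M q eps pib h L (pis n) := supn_ge0 _ _.
have T1 : 0 <= supn K (sc_value M \- pen_value M q eps) := supn_ge0 _ _.
have T2 : 0 <= supn K (pen_value M q eps \- vF eps h) := supn_ge0 _ _.
have Kpt x : K x -> `|sc_value M x - vs n x| <=
    supn K (sc_value M \- pen_value M q eps) + supn K (pen_value M q eps \- vF eps h)
    + h * Cb + W + eval_err M q eps h L (pis n) (vs n).
  move=> Kx.
  have t1 : `|sc_value M x - pen_value M q eps x| <= supn K (sc_value M \- pen_value M q eps).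
    apply: (@le_supn _ _ _ (sc_value M \- pen_value M q eps) (supf M / lm + Mq)) => // y _ /=.
    by have := ub y; have := pb y; rewrite ler_norml; lra.
  have t2 : `|pen_value M q eps x - vF eps h x| <= supn K (pen_value M q eps \- vF eps h).
    apply: (@le_supn _ _ _ (pen_value M q eps \- vF eps h) (Mq + Mq)) => // y _ /=.
    by have := pb y; have := v0 y; have := v1 y; rewrite ler_norml; lra.
  have t3 := locval_error loc Kx.
  have t4 := opt_err_ub d_gt0 st q0 q1 qB e0 hh0 pib_policy x (Ppi n (leqnn n)).
  have t5 : `|vs n x - S eps h (pis n) x| <= eval_err M q eps h L (pis n) (vs n).
    apply: (@le_supn _ _ _ (vs n \- S eps h (pis n)) (c + Mq)) => [y _ /=|].
      by rewrite (le_trans (ler_normB _ _))// lerD// Sc.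
    exact: (interior_subset (OL x (loc_KOm loc Kx))).
  move: t1 t2 t3 t4 t5 PIE; rewrite !ler_norml; clearbody W.
  move=> /andP[? ?] /andP[? ?] /andP[? ?] /andP[? ?] /andP[? ?] ?.
  by apply/andP; split; lra.
have [[x Kx]|K0] := pselect (K !=set0).
  by apply: supn_le => [|y Ky]; [exact: le_trans (normr_ge0 _) (Kpt x Kx)|exact: Kpt].
have -> : supn K (sc_value M \- vs n) = 0.
  apply/eqP; rewrite eq_le supn_ge0 andbT; apply: supn_le => // x Kx.
  by case: K0; exists x.
(* For empty [K] the left side is 0 and the right side must be shown nonnegative; for [Cb] the sign
   is read off at a point of the domain. *)
have Cb0 : 0 <= Cb.
  have [x Ox] := dom_nonempty st; have := loc_h loc; rewrite le_min => /andP[h1 he].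
  apply: le_trans (polval_ge0 d_gt0 st q0 q1 qB e0 hh0 x pib_policy) _.
  by apply: pib_bound => //; [rewrite hh0|exact: subset_closure].
have hC := mulr_ge0 (ltW hh0) Cb0.
by have := le_trans oe0 PIE; clearbody W; lra.
Qed.

End TotalError.

(** * Lebesgue measure and Lipschitz functions on cubes *)

Section LebesgueBounds.
Context {R : realType} {d : nat}.
Local Notation Rd := 'rV[R]_d.
Local Notation cubeE l := (cube l : set Rd).
Implicit Types (r : Rd -> R) (x y : Rd).

Lemma leb_le_cube (A : set Rd) (l : R) : 0 <= l -> A `<=` cube l ->
  (leb R d A <= ((2 * l) ^+ d)%:E)%E.
Proof.
move=> l0 Al; pose B : Rd * Rd := (const_mx (- l), const_mx l).
apply: (@le_trans _ _ (\esum_(k in [set 0%N]) box_vol B)%E).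
  apply: ereal_inf_lbound; exists ([set 0%N], fun=> B) => //=.
  by move=> x /Al xl; exists 0%N => // i /=; rewrite !mxE; exact: xl.
rewrite esum_set1; last exact: box_vol_ge0.
rewrite lee_fin (eq_bigr (fun=> 2 * l)); first by rewrite prodr_const card_ord.
by move=> i _ /=; rewrite !mxE max_r; lra.
Qed.

Section LipschitzBox.
Variables (l : R) (k : R) (r : Rd -> R).
Hypotheses (d_gt0 : (0 < d)%N) (l_gt0 : 0 < l).
Local Notation D := (cubeE l)°.
Hypothesis r_lip : lipschitz_in (closure D) k r.

Lemma cube_interior_scale x t : cube l x -> 0 <= t < 1 -> D (t *: x).
Proof.
move=> /cube_norm xl /andP[t0 t1]; apply/nbhs_ballP; exists ((1 - t) * l) => /=.
  by rewrite mulr_gt0// subr_gt0.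
move=> y; rewrite mx_norm_ball /ball_ /= => xy; apply/cube_norm => i.
have := le_lt_trans (normr_coord_le (t *: x - y) i) xy; rewrite !mxE => h1.
have h2 : `|t * x 0 i| <= t * l by rewrite normrM ger0_norm// ler_wpM2l.
rewrite -(subKr (t * x 0 i) (y 0 i)) (le_trans (ler_normB _ _))//; lra.
Qed.

Lemma cube_closure x : cube l x -> closure D x.
Proof.
move=> xl; apply/closure_enorm => e e0; pose s := e / (e + enorm x).
have n0 := enorm_ge0 x; have ex : 0 < e + enorm x by rewrite ltr_pwDl.
have s0 : 0 < s by rewrite divr_gt0.
have s1 : s <= 1 by rewrite ler_pdivrMr// mul1r lerDl.
exists ((1 - s) *: x).
  by apply: cube_interior_scale => //; apply/andP; split; lra.
rewrite scalerBl scale1r opprB addrC subrK enormZ gtr0_norm//.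
by rewrite mulrAC ltr_pdivrMr// ltr_pM2l// ltrDr.
Qed.

Lemma lipschitz_const_ge0 : 0 <= k.
Proof.
have c0 : cube l (0 : Rd) := cube0 (ltW l_gt0).
have cl : cube l (const_mx l : Rd) := cube_const (ltW l_gt0).
have n0 : 0 < enorm ((0 : Rd) - const_mx l).
  rewrite lt_neqAle enorm_ge0 andbT eq_sym; apply/eqP => /enorm_eq0/rowP/(_ (Ordinal d_gt0)).
  by rewrite !mxE; have := l_gt0; lra.
rewrite -(pmulr_lge0 _ n0).
exact: le_trans (normr_ge0 _) (r_lip (cube_closure c0) (cube_closure cl)).
Qed.

Lemma lipschitz_cube_bounded : exists c, forall x, cube l x -> `|r x| <= c.
Proof.
exists (`|r 0| + k * (Num.sqrt d%:R * l)) => x xl.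
have c0 : cube l (0 : Rd) := cube0 (ltW l_gt0).
have := r_lip (cube_closure xl) (cube_closure c0); rewrite subr0.
have := enorm_le_coord (ltW l_gt0) ((cube_norm l x).1 xl).
move=> /(ler_wpM2l lipschitz_const_ge0); have := ler_normD (r x - r 0) (r 0).
by rewrite subrK; lra.
Qed.

(** The lifting constant controls the open cube, whereas the residual estimates use the closed one.
    Shrinking a point towards the centre moves it inside, at a cost that the Lipschitz bound makes
    small. *)
Lemma supn_cube_interior : supn (cube l) r <= supn D r.
Proof.
have [c rc] := lipschitz_cube_bounded.
have k0 := lipschitz_const_ge0.
apply: supn_le => [|x xl]; first exact: supn_ge0.
apply/ler_addgt0Pr => e e0.
pose t := e / (e + (k * enorm x + 1)).
have n0 : 0 <= k * enorm x by rewrite mulr_ge0// enorm_ge0.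
have en : 0 < e + (k * enorm x + 1) by rewrite addr_gt0// ltr_wpDl.
have t0 : 0 < t by rewrite divr_gt0.
have t1 : t <= 1 by rewrite ler_pdivrMr// mul1r lerDl ltW// ltr_wpDl.
have Dx : D ((1 - t) *: x).
  by apply: cube_interior_scale => //; apply/andP; split; lra.
have rD : `|r ((1 - t) *: x)| <= supn D r.
  by apply: (@le_supn _ _ _ _ c) => // y /interior_subset/rc.
have := r_lip (cube_closure xl) (subset_closure Dx).
rewrite scalerBl scale1r opprB [x + _]addrC subrK enormZ (gtr0_norm t0) => rx.
have te : k * (t * enorm x) <= e.
  rewrite mulrCA /t mulrAC ler_pdivrMr// ler_pM2l//; lra.
move: rD; rewrite scalerBl scale1r => rD.
have := ler_normD (r x - r (x - t *: x)) (r (x - t *: x)); rewrite subrK; lra.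
Qed.

(** Tested on the constant function 1, which is 0-Lipschitz, the inequality says that C times a
    nonnegative norm is at least 1. *)
Lemma lifting_constant_ge0 C : lifting_constant D C -> 0 <= C.
Proof.
have lip1 : lipschitz_in (closure D) 0 (fun=> 1 : R).
  by move=> x y _ _; rewrite subrr normr0 mul0r.
move=> /(_ _ _ (lexx 0) lip1); rewrite powR0; last first.
  by rewrite mulf_neq0// ?invr_eq0 pnatr_eq0// -lt0n.
rewrite mulr0 mul0r add0r; set L2 := L2norm _ _ => H.
have D0 : D 0.
  by rewrite -(scale0r (0 : Rd)); apply: cube_interior_scale; [exact/cube0/ltW|rewrite lexx ltr01].
have s1 : 1 <= supn D (fun=> 1).
  have := @le_supn _ _ D (fun=> 1) 1 0 _ D0; rewrite normr1; apply=> x _ /=.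
  by rewrite ?normr1.
have CL : 0 < C * L2 by rewrite (lt_le_trans ltr01)// (le_trans s1).
rewrite leNgt; apply/negP => C0; move: CL; apply/negP; rewrite -leNgt.
by apply: mulr_le0_ge0; [exact: ltW|exact: sqrtr_ge0].
Qed.

(** Integrate rmin r^2 <= r^2 rho. Since a real-valued integral sends infinity to 0, both integrals
    must be shown finite: boundedness of [r] and the unit mass of [rho] give this. *)
Lemma L2norm_le_density (rho : Rd -> R) (rmin : R) : sampling_density D rho ->
  0 < rmin -> (forall x, D x -> rmin <= rho x) ->
  L2norm D r <= (Num.sqrt rmin)^-1 *
    Num.sqrt (\int[leb R d]_(x in D) (r x ^+ 2 * rho x)).
Proof.
move=> [_ rho0 rho1] rmin0 rho_ge.
have [c0 rc] := lipschitz_cube_bounded; pose c := `|c0| + 1.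
have c_gt0 : 0 < c by rewrite ltr_wpDl.
have {}rc x : D x -> r x ^+ 2 <= c ^+ 2.
  move=> /interior_subset/rc H; rewrite -[leLHS]real_normK ?num_real//.
  rewrite lerXn2r ?nnegrE ?(ltW c_gt0)// (le_trans H)// /c.
  by have := ler_norm c0; lra.
set I1 := (\int[leb R d]_(x in D) (r x ^+ 2)%:E)%E.
set I2 := (\int[leb R d]_(x in D) (r x ^+ 2 * rho x)%:E)%E.
have I10 : (0 <= I1)%E by apply: integral_ge0 => x _; rewrite lee_fin sqr_ge0.
have I20 : (0 <= I2)%E.
  by apply: integral_ge0 => x Dx; rewrite lee_fin mulr_ge0 ?sqr_ge0// rho0.
have I12 : (rmin%:E * I1 <= I2)%E.
  have Z : (\int[leb R d]_(x in D) (rmin%:E * (r x ^+ 2)%:E) = rmin%:E * I1)%E.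
    by apply: nn_integralZ => // x _; rewrite lee_fin sqr_ge0.
  rewrite -Z; apply: nn_integral_le => x Dx.
    by rewrite -EFinM lee_fin mulr_ge0 ?sqr_ge0// ltW.
  by rewrite -EFinM lee_fin mulrC ler_wpM2l ?sqr_ge0// rho_ge.
have I2c : (I2 <= (c ^+ 2)%:E)%E.
  have Z : (\int[leb R d]_(x in D) ((c ^+ 2)%:E * (rho x)%:E) =
      (c ^+ 2)%:E * \int[leb R d]_(x in D) (rho x)%:E)%E.
    by apply: nn_integralZ => [|x Dx]; rewrite ?exprn_gt0// lee_fin rho0.
  rewrite -[leRHS]mule1 -rho1 -Z.
  apply: nn_integral_le => x Dx; first by rewrite lee_fin mulr_ge0 ?sqr_ge0// rho0.
  by rewrite -EFinM lee_fin ler_wpM2r ?rc// rho0.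
have I2f : I2 \is a fin_num by rewrite ge0_fin_numE// (le_lt_trans I2c)// ltry.
have I1f : I1 \is a fin_num.
  rewrite ge0_fin_numE// (@le_lt_trans _ _ ((rmin^-1)%:E * I2)%E)//.
    by rewrite -lee_pdivrMl ?invr_gt0// invrK.
  by rewrite -(fineK I2f) -EFinM ltry.
rewrite /L2norm /Rintegral -/I1 -/I2; have rmin1 := ltW rmin0.
have -> : (Num.sqrt rmin)^-1 * Num.sqrt (fine I2) = Num.sqrt (rmin^-1 * fine I2).
  by rewrite sqrtrM ?invr_ge0// sqrtrV.
rewrite ler_sqrt; last by rewrite mulr_ge0 ?invr_ge0 ?fine_ge0.
by rewrite ler_pdivlMl// -lee_fin EFinM !fineK.
Qed.

End LipschitzBox.
End LebesgueBounds.

(** * Finite suprema and geometric sums *)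

Section Sequences.
Context {R : realType}.

Lemma le_sup_II (u : nat -> R) n j : (j < n)%N ->
  u j <= sup [set u i | i in `I_n].
Proof.
move=> jn; apply: ub_le_sup; last by exists j.
exists (\sum_(i < n) `|u i|) => _ [i /= i_n <-].
rewrite (le_trans (ler_norm _))// (bigD1 (Ordinal i_n))//= lerDl.
by apply: sumr_ge0.
Qed.

Lemma sup_II_le (u : nat -> R) n c : 0 <= c ->
  (forall j, (j < n)%N -> u j <= c) -> sup [set u i | i in `I_n] <= c.
Proof.
move=> c0 uc; have [n0|n0] := posnP n.
  have -> : [set u i | i in `I_n] = set0 by apply/seteqP; split=> // t [i /=]; rewrite n0.
  by rewrite sup0.
by apply: ge_sup; [exists (u 0%N), 0%N|move=> _ [i /= i_n <-]; exact: uc].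
Qed.

Lemma sum_geometric_le (g : R) n : 0 <= g < 1 ->
  \sum_(0 <= j < n) g ^+ (n - 1 - j) <= (1 - g)^-1.
Proof.
move=> /andP[g0 g1]; have g1' : 0 < 1 - g by rewrite subr_gt0.
suff -> : \sum_(0 <= j < n) g ^+ (n - 1 - j) = (1 - g ^+ n) / (1 - g).
  by rewrite ler_pdivrMr// mulVf ?gt_eqF// gerBl exprn_ge0.
elim: n => [|n IH]; first by rewrite big_geq// expr0 subrr mul0r.
rewrite big_nat_recl// subn1 subn0 /=.
have -> : \sum_(0 <= i < n) g ^+ (n - i.+1) = \sum_(0 <= i < n) g ^+ (n - 1 - i).
  by apply: eq_bigr => i _; rewrite -subnDA add1n.
by rewrite IH exprS; field; rewrite gt_eqF.
Qed.

End Sequences.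

(** * Limits along refining sequences *)

Section Refinement.
Context {R : realType} {d m : nat} (M : model R d m).
Hypotheses (d_gt0 : (0 < d)%N) (st : standing M).
Variables (rad : R) (pib : 'rV[R]_d -> 'rV[R]_m) (h0 Cb : R).
Hypotheses (rad_gt0 : 0 < rad) (pib_policy : policy M pib) (h0_le1 : h0 <= 1).
Local Notation Rd := 'rV[R]_d.
Local Notation Rm := 'rV[R]_m.
Local Notation clO := (closure (Om M)).
Local Notation lm := (lam M).
Local Notation dR := (d%:R : R).
Local Notation N := (Nv M).
Local Notation q := (pen_sq M rad).
Local Notation S := (polval M q).
Local Notation vF := (discval M q).
Implicit Types (x y z w : Rd).

Hypothesis pib_bound : forall (eps h : R) x, 0 < eps -> 0 < h <= h0 -> h <= eps -> clO x ->
  S eps h pib x <= Cb.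

Variables (eps h L DL : nat -> R) (n : nat -> nat) (delta : R) (K : set Rd).
Variables (pis : nat -> nat -> Rd -> Rm) (vs : nat -> nat -> Rd -> R).
Hypotheses (eps_gt0 : forall k, 0 < eps k) (eps_cvg : eps @ \oo --> (0 : R))
  (h_cvg : h @ \oo --> (0 : R)) (L_cvg : L @ \oo --> +oo) (n_cvg : n @ \oo --> \oo)
  (box_k : forall k, good_box M (h k) (L k)) (delta_range : 0 < delta <= rad)
  (K_compact : compact K) (KO : K `<=` clO)
  (margin_k : \forall k \near \oo, margin M delta (DL k) (h k) (L k) K)
  (pis_loc : forall k j, (j <= n k)%N -> loc_policy M pib (h k) (L k) (pis k j))
  (vs_borel : forall k j, (j <= n k)%N -> bounded_borel (vs k j)).
Hypothesis R1 : forall k, h k <= Num.min h0 (eps k) /\ lm * h k <= 2 * dR * N.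
Hypothesis R2 : forall k, 4 * dR * N / lm *
  ln (12 * Cext M rad / (cdel rad (delta / 2) * h k ^+ 2)) <= DL k.

Let h_gt0 k : 0 < h k. Proof. by have [] := box_k k. Qed.
Let lm0 : 0 < lm := lam_gt0 st.
Let dR0 : 0 < dR. Proof. by rewrite ltr0n. Qed.
Let N0 : 0 < N := visc_gt0 st.
Let hle k : h k <= h0 /\ h k <= eps k.
Proof. by have [] := R1 k; rewrite le_min => /andP[]. Qed.
Let h1 k : h k <= 1. Proof. by have [hh _] := hle k; exact: le_trans hh h0_le1. Qed.
Let gam01 k : 0 <= gamh M (h k) < 1.
Proof. by rewrite (gamh_ge0 d_gt0 st (h_gt0 k)) (gamh_lt1 d_gt0 st (h_gt0 k)). Qed.

Let clO0 : clO !=set0.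
Proof. by have [x Ox] := dom_nonempty st; exists x; exact: subset_closure. Qed.

Let cd := cdel rad (delta / 2).
Let cd0 : 0 < cd.
Proof. by apply: cdel_gt0 => //; rewrite divr_gt0//; have /andP[] := delta_range. Qed.

(** Half-side of a fixed cube containing the delta / 2 neighbourhood of the domain: the box at k = 0
    contains the domain, and the 1 is slack because the distance is an infimum. *)
Let r0 := L 0%N + delta / 2 + 1.

Let near_Omega x : dist x clO <= delta / 2 -> forall i, `|x 0 i| <= r0.
Proof.
move=> xd i; have hi : has_inf [set enorm (x - y) | y in clO].
  split; first by have [a Oa] := clO0; exists (enorm (x - a)), a.
  by exists 0 => _ [z _ <-]; exact: enorm_ge0.
have [_ [y Oy <-]] := inf_adherent ltr01 hi; rewrite -/(dist x clO) => xy.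
have [_ _ OL] := box_k 0; have := OL y Oy => /interior_subset/cube_norm/(_ i) yi.
rewrite -(subrK y x) mxE (le_trans (ler_normD _ _))//.
by have := ler_coord_enorm (x - y) i; rewrite /r0; lra.
Qed.

(** [DLh] grows with [L k], so that [loc_DLh] and [loc_exp] hold for all large k. *)
Let DLh_ge k : L k - h k - r0 <= DLh M delta (h k) (L k).
Proof.
set G := [set x | dist x clO <= delta / 2].
have G0 : G !=set0.
  have [x Ox] := clO0; exists x; rewrite /G /=.
  have -> : dist x clO = 0.
    by apply/(dist_eq0 clO0); exact: subset_closure.
  by rewrite divr_ge0//; have /andP[/ltW] := delta_range.
have O0 : (~` cube (L k - h k) : set Rd) !=set0.
  exists (const_mx (`|L k - h k| + 1)) => /(_ (Ordinal d_gt0)); rewrite mxE.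
  by have := ler_norm (L k - h k); lra.
have [df _] := dist_set_fin G0 O0.
rewrite -lee_fin fineK//; apply: le_ereal_inf_tmp => _ [x Gx [z zL <-]].
rewrite lee_fin; move: zL => /cube_norm/existsNP[i /negP]; rewrite -ltNge => zi.
have := near_Omega Gx i; have := ler_coord_enorm (x - z) i; rewrite !mxE => e1 e2.
have := ler_normB (x 0 i) (x 0 i - z 0 i); rewrite subKr; lra.
Qed.

Lemma localization_near :
  \forall k \near \oo, localization M rad h0 (eps k) (h k) (L k) delta (DL k) K.
Proof.
pose y k := 12 * Cext M rad / (cd * h k ^+ 2).
have C0 := Cext_gt0 d_gt0 st rad_gt0.
have y0 k : 0 < y k by apply: divr_gt0; rewrite mulr_gt0// exprn_gt0.
have dN0 : 0 < 4 * dR * N by rewrite !mulr_gt0.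
have c12 : 0 < 12 * Cext M rad / cd by rewrite divr_gt0// mulr_gt0.
near=> k; have e1 : eps k <= 1 by near: k; exact: (cvgr_le _ eps_cvg _ ltr01).
(* This makes the argument of the logarithm in (R2) exceed 1, so that DL > 0. *)
have hc : h k < 12 * Cext M rad / cd by near: k; exact: (cvgr_lt _ h_cvg _ c12).
(* With h <= 1 this gives DLh - 2 h >= 4 d N / lam, so the exponent in [loc_exp] is at least 1, and
   exp(1) >= 2. *)
have Lc : r0 + 3 + 4 * dR * N / lm <= L k by near: k; by move/cvgryPge: L_cvg; exact.
have hk := h_gt0 k; have hk1 := h1 k; have := DLh_ge k => Dk.
have tN : 0 < 4 * dR * N / lm by rewrite divr_gt0.
have y1 : 1 < y k.
  have ch : 0 < cd * h k ^+ 2 by rewrite mulr_gt0// exprn_gt0.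
  rewrite ltr_pdivlMr// mul1r mulrC -ltr_pdivlMr//.
  by rewrite (le_lt_trans _ hc)// expr2 ler_piMr// ltW.
split.
- exact: box_k.
- by rewrite eps_gt0.
- by have [] := R1 k.
- by have [] := R1 k.
- exact: delta_range.
- by apply: lt_le_trans (R2 k); rewrite mulr_gt0// ln_gt0.
- exact: K_compact.
- exact: KO.
- by near: k.
- lra.
- rewrite (le_trans _ (expR_ge1Dx _))// -[2]/(1 + 1) lerD2l.
  rewrite ler_pdivlMr// mul1r -ler_pdivrMl// [lm^-1 * _]mulrC; lra.
- rewrite -/cd (_ : _ / _ = (y k)^-1); last by rewrite /y invf_div.
  rewrite -[leRHS]lnK ?posrE ?invr_gt0// ler_expR lnV ?posrE//.
  rewrite !mulNr lerN2 ler_pdivlMr// mulrC -ler_pdivrMl//.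
  by rewrite mulrA [_^-1 * _]mulrC; exact: R2.
Unshelve. all: by end_near. Qed.

Let xi k j := eval_err M q (eps k) (h k) (L k) (pis k j) (vs k j).
Let G k j := sup_gap M q (eps k) (h k) (L k) (vs k j) (pis k j.+1).
Let e0 k := opt_err M q (eps k) pib (h k) (L k) (pis k 0%N).
Let T1 k := supn K (sc_value M \- pen_value M q (eps k)).
Let T2 k := supn K (pen_value M q (eps k) \- vF (eps k) (h k)).
Let B k := (h k ^+ 2)^-1 * sup [set xi k j | j in `I_(n k).+1].
Let A k := (h k)^-1 * sup [set G k j | j in `I_(n k)].
(** The geometric sum is at most 1 / (1 - gam) = mu / lam, and mu h <= 4 d N by the mesh condition.
    Hence gaps are amplified by 1 / h, and evaluation errors, already divided by h in policy
    iteration, by 1 / h^2: these are the weights in [A] and [B]. *)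
Let c1 := 4 * dR * N / lm ^+ 2.
Let c2 := 2 * Num.sqrt dR * supb M.
Let Z k := T1 k + T2 k + h k * Cb + gamh M (h k) ^+ n k * e0 k
  + c1 * (A k + c2 * B k) + B k.

Lemma refinement_bound : \forall k \near \oo, supn K (sc_value M \- vs k (n k)) <= Z k.
Proof.
near=> k; have loc : localization M rad h0 (eps k) (h k) (L k) delta (DL k) K.
  by near: k; exact: localization_near.
have n1 : (0 < n k)%N by near: k; by move/cvgnyPge: n_cvg; exact.
have TE := total_error d_gt0 st rad_gt0 pib_policy h0_le1 pib_bound loc
  (@pis_loc k) (@vs_borel k).
apply: (le_trans TE); rewrite -/(T1 k) -/(T2 k) -/(e0 k).
have hk := h_gt0 k; have hk2 : 0 < h k ^+ 2 by rewrite exprn_gt0.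
have xiB j : (j <= n k)%N -> xi k j <= h k ^+ 2 * B k.
  move=> jn; rewrite /B mulrA divff ?gt_eqF// mul1r.
  by apply: (@le_sup_II _ (xi k)); rewrite ltnS.
have GA j : (j < n k)%N -> G k j <= h k * A k.
  move=> jn; rewrite /A mulrA divff ?gt_eqF// mul1r.
  exact: (@le_sup_II _ (G k)).
have xi_ge0 j : 0 <= xi k j := supn_ge0 _ _.
have B0 : 0 <= B k.
  by rewrite -(pmulr_rge0 _ hk2) (le_trans (xi_ge0 0%N))// xiB.
have G0 : 0 <= G k 0%N.
  have [_ [c vc]] := vs_borel (leq0n (n k)).
  have [_ hL _] := box_k k; have [[_ Ap] _] := pis_loc n1.
  exact: (sup_gap_ge0 d_gt0 st (@pen_sq_ge0 _ _ _ M rad) (pen_sq_le st rad_gt0)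
    (eps_gt0 k) hk hL Ap vc).
have A0 : 0 <= A k by rewrite -(pmulr_rge0 _ hk) (le_trans G0)// GA.
have c20 : 0 <= c2 by rewrite mulr_ge0 ?mulr_ge0 ?sqrtr_ge0// ltW// supb_gt0.
apply: lerD; last first.
  rewrite (le_trans (xiB _ (leqnn _)))// ler_piMl// expr2.
  by rewrite mulr_ile1 ?(ltW hk)// h1.
apply: lerD => //.
have ABk : 0 <= A k + c2 * B k by rewrite addr_ge0// mulr_ge0.
have sumle : \sum_(0 <= j < n k) gamh M (h k) ^+ (n k - 1 - j) *
    (G k j + 2 * Num.sqrt dR * supb M / h k * xi k j) <=
    (1 - gamh M (h k))^-1 * (h k * (A k + c2 * B k)).
  rewrite (@le_trans _ _ ((\sum_(0 <= j < n k) gamh M (h k) ^+ (n k - 1 - j)) *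
    (h k * (A k + c2 * B k))))//; last first.
    by rewrite ler_wpM2r ?sum_geometric_le// mulr_ge0// ltW.
  rewrite mulr_suml ler_sum_nat// => j /andP[_ jn].
  have /andP[g0 _] := gam01 k; rewrite ler_wpM2l ?exprn_ge0// mulrDr lerD ?GA//.
  rewrite -/c2; have := xiB j (ltnW jn) => /(ler_wpM2l (divr_ge0 c20 (ltW hk))).
  move=> /le_trans; apply; rewrite le_eqVlt; apply/orP; left; apply/eqP.
  by field; rewrite gt_eqF.
rewrite (le_trans (ler_wpM2l _ sumle)) ?invr_ge0 ?(ltW lm0)//.
rewrite onesub_gamh// invf_div.
have mul : muh M (h k) * h k <= 4 * dR * N.
  rewrite /muh /Lamh mulrDl divfK ?gt_eqF//; have [_] := R1 k; lra.
have -> : lm^-1 * (muh M (h k) / lm * (h k * (A k + c2 * B k))) =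
    (lm ^+ 2)^-1 * (A k + c2 * B k) * (muh M (h k) * h k) by field; rewrite gt_eqF.
have -> : c1 * (A k + c2 * B k) = (lm ^+ 2)^-1 * (A k + c2 * B k) * (4 * dR * N).
  by rewrite /c1; field; rewrite gt_eqF.
by rewrite ler_wpM2l// mulr_ge0// invr_ge0 sqr_ge0.
Unshelve. all: by end_near. Qed.

Hypothesis R3 : (fun k => gamh M (h k) ^+ n k * e0 k) @ \oo --> (0 : R).
Hypothesis R4B : B @ \oo --> (0 : R).
Hypothesis R4A : A @ \oo --> (0 : R).
Hypothesis R5a : T1 @ \oo --> (0 : R).
Hypothesis R5b : T2 @ \oo --> (0 : R).

Lemma refinement_Z_cvg : Z @ \oo --> (0 : R).
Proof.
have -> : (0 : R) = 0 + 0 + 0 * Cb + 0 + c1 * (0 + c2 * 0) + 0 by ring.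
apply: cvgD => //; apply: cvgD.
  by apply: cvgD => //; apply: cvgD; [exact: cvgD|apply: cvgM => //; exact: cvg_cst].
apply: cvgM; first exact: cvg_cst.
by apply: cvgD => //; apply: cvgM => //; exact: cvg_cst.
Qed.

Lemma refinement_uniform : {uniform K, (fun k => vs k (n k)) @ \oo --> sc_value M}.
Proof.
apply/uniform_cvgP => e e_gt0; near=> k => x Kx.
have Ze : Z k < e by near: k; exact: (cvgr_lt _ refinement_Z_cvg _ e_gt0).
apply: le_lt_trans Ze; apply: (@le_trans _ _ (supn K (sc_value M \- vs k (n k)))).
  have [_ [c vc]] := vs_borel (leqnn (n k)).
  apply: (@le_supn _ _ _ (sc_value M \- vs k (n k)) (supf M / lm + c)) => // y _ /=.
  rewrite (le_trans (ler_normB _ _))// lerD//.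
  by have /andP[u0 u1] := sc_value_bounds d_gt0 st y; rewrite ger0_norm.
by near: k; exact: refinement_bound.
Unshelve. all: by end_near. Qed.

(** [K] lies in the box at k = 0, so the square of the uniform bound [Z k] is integrated over a set
    of bounded measure. *)
Lemma refinement_L2 :
  ((fun k => \int[leb R d]_(x in K) ((vs k (n k) x - sc_value M x) ^+ 2)%:E)%E
    @ \oo --> (0 : \bar R)).
Proof.
pose V := (2 * L 0%N) ^+ d; have [_ hL0 OL] := box_k 0%N.
have L0 : 0 <= L 0%N by have := h_gt0 0%N; lra.
have KV (D : set Rd) : D `<=` K -> (leb R d D <= V%:E)%E.
  by move=> DK; apply: leb_le_cube => // x /DK/KO/OL; exact: interior_subset.
apply: (@squeeze_cvge _ _ _ _ (fun=> 0%E) _ (fun k => (Z k ^+ 2 * V)%:E)); last 2 first.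
- exact: cvg_cst.
- apply: cvg_EFin; first by apply: nearW.
  rewrite [X in _ --> X](_ : _ = 0 * 0 * V); last by ring.
  by apply: cvgM; [apply: cvgM; exact: refinement_Z_cvg|exact: cvg_cst].
near=> k; apply/andP; split; first by apply: integral_ge0 => x _; rewrite lee_fin sqr_ge0.
have Zk : supn K (sc_value M \- vs k (n k)) <= Z k by near: k; exact: refinement_bound.
apply: (@le_trans _ _ (\int[leb R d]_(x in K) (Z k ^+ 2)%:E)%E); last first.
  by apply: nn_integral_cst_le => [|D _]; [exact: sqr_ge0|exact: KV].
apply: nn_integral_le => x Kx; first by rewrite lee_fin sqr_ge0.
have [_ [c vc]] := vs_borel (leqnn (n k)).
have H : `|sc_value M x - vs k (n k) x| <= Z k.
  apply: le_trans Zk.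
  apply: (@le_supn _ _ _ (sc_value M \- vs k (n k)) (supf M / lm + c)) => // y _ /=.
  rewrite (le_trans (ler_normB _ _))// lerD//.
  by have /andP[u0 u1] := sc_value_bounds d_gt0 st y; rewrite ger0_norm.
rewrite lee_fin -[leLHS]real_normK ?num_real// distrC lerXn2r ?nnegrE//.
exact: le_trans (normr_ge0 _) H.
Unshelve. all: by end_near. Qed.

End Refinement.

Theorem proposition6p11 (R : realType) (d m : nat) (M : model R d m)
  (d_gt0 : (0 < d)%N) (M_standing : standing M)
  (* inward feedback *)
  (r1 nu0 COm : R) (dt : 'rV[R]_d -> R) (pib : 'rV[R]_d -> 'rV[R]_m)
  (pib_feedback : feedback M r1 nu0 COm dt pib)
  (* the jump chain (Y_k) with its laws Pr h pi x *)
  (dT : measure_display) (T : measurableType dT) (Y : nat -> T -> 'rV[R]_d)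
  (Pr : R -> ('rV[R]_d -> 'rV[R]_m) -> 'rV[R]_d -> probability T R)
  (Pr_chain : forall h pi x, 0 < h -> policy M pi ->
     jump_chain M (Pr h pi x) Y h pi x)
  (* truncation radius and leakage constants for the distance penalty *)
  (rad : R) (rad_gt0 : 0 < rad)
  (Cst h0 : R) (Cst_ge1 : 1 <= Cst) (h0_range : 0 < h0 <= 1)
  (leakage : forall h x, 0 < h <= h0 -> closure (Om M) x ->
     (discounted M (Pr h pib x) Y h (pen_dist M rad) <= (Cst * h)%:E)%E)
  (* the known convergence theorem for the truncated distance penalty *)
  (dist_penalty_cvg :
     {uniform closure (Om M),
       (fun eps => pen_value M (pen_dist M rad) eps) @ 0^'+ --> sc_value M}) :
  let u := sc_value M in
  let q := pen_sq M rad in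
  let S := polval M q in
  let vF := discval M q in
  let vL := fun eps h L => locval M q eps pib h L in
  let PiL := loc_policy M pib in
  let lm := lam M in
  let N := Nv M in
  let dR := d%:R : R in
  let gam := gamh M in
  let Mq := Meps M rad in
  let LOC_bound := fun h => h * (supf M / lm + rad * Cst) in
  (* q_R is bounded, Lipschitz and vanishes exactly on the closure of Om *)
  ((exists c, forall x, `|q x| <= c) /\
   (exists k, lipschitz_in setT k q) /\
   (forall x, q x = 0 <-> closure (Om M) x)) /\
  (* (i) *)
  {uniform closure (Om M), (fun eps => pen_value M q eps) @ 0^'+ --> u} /\
  (* (ii) *)
  (forall eps h pi x C0 delta,
     0 < eps -> 0 < h <= h0 -> policy M pi -> S eps h pi x <= C0 -> 0 < delta ->
     (discounted M (Pr h pi x) Y h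
        (\1_[set y | (delta <= dist y (closure (Om M)))%R] : 'rV[R]_d -> R)
      <= (eps * C0 / cdel rad delta)%:E)%E) /\
  (* (iii) *)
  (forall eps h x, 0 < eps -> 0 < h <= h0 -> closure (Om M) x ->
     (discounted M (Pr h pib x) Y h q <= (rad * Cst * h)%:E)%E /\
     S eps h pib x <= supf M / lm + rad * Cst * h / eps) /\
  (* (LOC) *)
  (forall eps h L delta DL K, localization M rad h0 eps h L delta DL K ->
     forall x, K x -> 0 <= vL eps h L x - vF eps h x <= LOC_bound h) /\
  (* (a) *)
  (forall eps h L, 0 < eps -> good_box M h L ->
     (forall pi x, policy M pi -> 0 <= S eps h pi x <= Mq eps) /\
     (forall x, [/\ 0 <= vF eps h x, vF eps h x <= vL eps h L x &
                    vL eps h L x <= Mq eps]) /\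
     (forall pi z g, policy M pi -> bounded_borel z ->
        (forall x, opA M h pi z x <= g x) -> has_ubound (range g) ->
        sup (range z) <= lm^-1 * sup (range g)) /\
     (forall pi pi', PiL h L pi -> PiL h L pi' ->
        supn setT (S eps h pi \- S eps h pi')
          <= lm^-1 * supn (cube (L - h)) (opL M q eps h pi (S eps h pi')) /\
        supn setT (S eps h pi \- S eps h pi')
          = supn (cube L) (S eps h pi \- S eps h pi')) /\
     (forall pi, PiL h L pi ->
        supn setT (S eps h pi \- vL eps h L)
          <= lm^-1 * supn (cube (L - h)) (opL M q eps h pi (vL eps h L)) /\
        supn setT (S eps h pi \- vL eps h L)
          = supn (cube L) (S eps h pi \- vL eps h L))) /\
  (* (b) *)
  (forall eps h L (pis : nat -> 'rV[R]_d -> 'rV[R]_m) (vs : nat -> 'rV[R]_d -> R),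
     0 < eps -> good_box M h L ->
     (forall j, PiL h L (pis j)) -> (forall j, bounded_borel (vs j)) ->
     let e := fun j => opt_err M q eps pib h L (pis j) in
     let xi := fun j => eval_err M q eps h L (pis j) (vs j) in
     let g := fun j => sup_gap M q eps h L (S eps h (pis j)) (pis j.+1) in
     let G := fun j => sup_gap M q eps h L (vs j) (pis j.+1) in
     (forall j, g j <= G j + 2 * Num.sqrt dR * supb M / h * xi j) /\
     (forall j, e j.+1 <= gam h * e j + g j / lm) /\
     (forall n, (1 <= n)%N ->
        e n <= gam h ^+ n * e 0%N
          + lm^-1 * \sum_(0 <= j < n) gam h ^+ (n - 1 - j) *
              (G j + 2 * Num.sqrt dR * supb M / h * xi j))) /\
  (* (c) *)
  (forall eps h L v, 0 < eps -> good_box M h L -> bounded_borel v ->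
     (forall pi E, policy M pi -> compact E -> E `<=` (cube (L - h))° ->
        let dE := fine (dist_set E (strip h L)) in
        supn E (v \- S eps h pi)
          <= lm^-1 * supn (cube (L - h)) (opL M q eps h pi v)
             + gam h ^ Num.ceil (dE / h) * supn (strip h L) (v \- S eps h pi) /\
        (lm * h <= 2 * dR * N -> gam h ^ Num.ceil (dE / h) <= decay M dE)) /\
     (forall pi L', policy M pi -> cube L `<=` (cube (L' - h) : set 'rV[R]_d)° ->
        lm * h <= 2 * dR * N ->
        let dLL' := fine (dist_set (cube L) (strip h L' : set 'rV[R]_d)) in
        supn (cube L) (v \- S eps h pi)
          <= lm^-1 * supn (cube (L' - h)) (opL M q eps h pi v)
             + decay M dLL' * (supn (strip h L') v + Mq eps)) /\
     (forall L' E, L < L' -> compact E -> E `<=` (cube (L' - h))° ->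
        let dE' := fine (dist_set E (strip h L')) in
        supn E (v \- vL eps h L)
          <= lm^-1 * supn (cube (L' - h)) (opR M q eps pib h L v)
             + gam h ^ Num.ceil (dE' / h) * (supn (strip h L') v + Mq eps))) /\
  (* (d) *)
  (forall eps h L delta DL K
     (pis : nat -> 'rV[R]_d -> 'rV[R]_m) (vs : nat -> 'rV[R]_d -> R),
     localization M rad h0 eps h L delta DL K ->
     (forall j, PiL h L (pis j)) -> (forall j, bounded_borel (vs j)) ->
     let e := fun j => opt_err M q eps pib h L (pis j) in
     let xi := fun j => eval_err M q eps h L (pis j) (vs j) in
     let G := fun j => sup_gap M q eps h L (vs j) (pis j.+1) in
     forall n, (1 <= n)%N ->
       supn K (u \- vs n)
         <= supn K (u \- pen_value M q eps)
            + supn K (pen_value M q eps \- vF eps h)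
            + LOC_bound h + gam h ^+ n * e 0%N
            + lm^-1 * \sum_(0 <= j < n) gam h ^+ (n - 1 - j) *
                (G j + 2 * Num.sqrt dR * supb M / h * xi j)
            + xi n) /\
  (* (e) *)
  (forall (eps h L DL : nat -> R) (n : nat -> nat) (delta : R) (K : set 'rV[R]_d)
     (pis : nat -> nat -> 'rV[R]_d -> 'rV[R]_m) (vs : nat -> nat -> 'rV[R]_d -> R),
     (forall k, 0 < eps k) -> eps @ \oo --> (0 : R) -> h @ \oo --> (0 : R) ->
     L @ \oo --> +oo -> n @ \oo --> \oo ->
     (forall k, good_box M (h k) (L k)) ->
     0 < delta <= rad -> compact K -> K `<=` closure (Om M) ->
     (\forall k \near \oo, margin M delta (DL k) (h k) (L k) K) ->
     (forall k j, (j <= n k)%N -> PiL (h k) (L k) (pis k j)) ->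
     (forall k j, (j <= n k)%N -> bounded_borel (vs k j)) ->
     let e0 := fun k => opt_err M q (eps k) pib (h k) (L k) (pis k 0%N) in
     let xi := fun k j => eval_err M q (eps k) (h k) (L k) (pis k j) (vs k j) in
     let G := fun k j => sup_gap M q (eps k) (h k) (L k) (vs k j) (pis k j.+1) in
     let r := fun k j => opL M q (eps k) (h k) (pis k j) (vs k j) in
     let R3 := (fun k => gam (h k) ^+ n k * e0 k) @ \oo --> (0 : R) in
     (* the two replacements for the first condition in (R4), with E the bound
        on the residuals *)
     let strip_cond := fun (L' E : nat -> R) =>
       (fun k => (h k ^+ 2)^-1 *
          (E k / lm
           + decay M (fine (dist_set (cube (L k)) (strip (h k) (L' k) : set 'rV[R]_d)))
             * (sup [set supn (strip (h k) (L' k)) (vs k j) | j in `I_(n k).+1]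
                + Mq (eps k)))) @ \oo --> (0 : R) in
     let nested := fun L' : nat -> R =>
       forall k, cube (L k) `<=` (cube (L' k - h k) : set 'rV[R]_d)° in
     let R4_eval :=
       (fun k => (h k ^+ 2)^-1 * sup [set xi k j | j in `I_(n k).+1])
         @ \oo --> (0 : R) in
     let R4_eval_sup := exists L' : nat -> R, nested L' /\
       strip_cond L' (fun k =>
         sup [set supn (cube (L' k - h k)) (r k j) | j in `I_(n k).+1]) in
     let R4_eval_L2 :=
       exists (L' Lip rmin CD : nat -> R) (rho : nat -> 'rV[R]_d -> R),
       let D := fun k => (cube (L' k - h k) : set 'rV[R]_d)° in
       let a := fun k => (Num.sqrt (rmin k))^-1 *
         sup [set Num.sqrt (\int[leb R d]_(x in D k) (r k j x ^+ 2 * rho k x))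
             | j in `I_(n k).+1] in
       [/\ nested L',
           forall k j, (j <= n k)%N ->
             lipschitz_in (closure (D k)) (Lip k) (r k j),
           forall k, sampling_density (D k) (rho k) /\ 0 < rmin k /\
             (forall x, D k x -> rmin k <= rho k x),
           forall k, lifting_constant (D k) (CD k) &
           strip_cond L' (fun k => CD k *
             ((Lip k `^ (d%:R / d.+2%:R)) * (a k `^ (2 / d.+2%:R)) + a k))] in
     ((fun k => gam (h k) ^+ n k / eps k) @ \oo --> (0 : R) -> R3) /\
     ((* (R1) *)
      (forall k, h k <= Num.min h0 (eps k) /\ lm * h k <= 2 * dR * N) ->
      (* (R2) *)
      (forall k, 4 * dR * N / lm *
         ln (12 * Cext M rad / (cdel rad (delta / 2) * h k ^+ 2)) <= DL k) ->
      (* (R3) *)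
      R3 ->
      (* (R4) *)
      R4_eval \/ R4_eval_sup \/ R4_eval_L2 ->
      (fun k => (h k)^-1 * sup [set G k j | j in `I_(n k)]) @ \oo --> (0 : R) ->
      (* (R5) *)
      (fun k => supn K (u \- pen_value M q (eps k))) @ \oo --> (0 : R) ->
      (fun k => supn K (pen_value M q (eps k) \- vF (eps k) (h k)))
        @ \oo --> (0 : R) ->
      {uniform K, (fun k => vs k (n k)) @ \oo --> u} /\
      (fun k => \int[leb R d]_(x in K) ((vs k (n k) x - u x) ^+ 2)%:E)%E
        @ \oo --> (0 : \bar R))).
Proof.
move=> u q S vF vL PiL lm N dR gam Mq LOC_bound.
have pibP : policy M pib := fb_policy pib_feedback.
have h01 : h0 <= 1 by have /andP[] := h0_range.
have lm0 : 0 < lm := lam_gt0 M_standing.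
have q0 : forall x, 0 <= q x := @pen_sq_ge0 _ _ _ M rad.
have q1 : forall x, q x <= rad ^+ 2 := pen_sq_le M_standing rad_gt0.
have qB := pen_sq_borel M_standing rad.
pose Cb := supf M / lm + rad * Cst.
have iii eps h x : 0 < eps -> 0 < h <= h0 -> closure (Om M) x ->
    (discounted M (Pr h pib x) Y h q <= (rad * Cst * h)%:E)%E /\
    S eps h pib x <= supf M / lm + rad * Cst * h / eps.
  move=> e0 hh Ox; have /andP[h_gt0 _] := hh.
  rewrite -mulrA; apply: (leakage_sq d_gt0 M_standing rad_gt0 h_gt0 pibP) => //.
  - exact: Pr_chain.
  - exact: leakage.
(* For h <= eps the leakage term rad Cst h / eps is at most rad Cst, uniformly in both
   parameters. *)
have pib_bound (eps h : R) x : 0 < eps -> 0 < h <= h0 -> h <= eps ->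
    closure (Om M) x -> S eps h pib x <= Cb.
  move=> e0 hh he Ox; have [_ H] := iii eps h x e0 hh Ox.
  rewrite (le_trans H)// lerD2l -mulrA ler_piMr//.
    by rewrite mulr_ge0// ltW// (lt_le_trans ltr01).
  by rewrite ler_pdivrMr// mul1r.
have box0 h L : good_box M h L -> 0 < h /\ h < L by move=> [].
split.
  split; first by exists (rad ^+ 2) => x; rewrite ger0_norm.
  split; first by exists (2 * rad); exact: pen_sq_lipschitz.
  exact: pen_sq_eq0.
split; first exact: pen_sq_value_cvg.
split.
  move=> eps h pi x C0 delta e0 /andP[h_gt0 _] mpi SC d0.
  exact: (occupation_far d_gt0 M_standing rad_gt0 h_gt0 mpi (Pr_chain h pi x h_gt0 mpi) e0 SC d0).
split; first exact: iii.
split.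
  move=> eps h L delta DL K loc.
  exact: (locval_error d_gt0 M_standing rad_gt0 pibP h01 pib_bound loc).
split.
  move=> eps h L e0 /[dup] bx /box0[h_gt0 hL]; split; [|split; [|split; [|split]]].
  - move=> pi x mpi; rewrite (polval_ge0 d_gt0 M_standing q0 q1 qB e0 h_gt0)//=.
    exact: (polval_le d_gt0 M_standing q0 q1 qB e0 h_gt0).
  - move=> x; split.
    + exact: (discval_ge0 d_gt0 M_standing q0 q1 qB e0 h_gt0 pibP).
    + exact: (discval_le_locval d_gt0 M_standing q0 q1 qB e0 h_gt0 L pibP).
    + exact: (locval_le d_gt0 M_standing q0 q1 qB e0 h_gt0 L pibP).
  - move=> pi z g mpi [_ [c zc]] Az gub; apply: ge_sup; first by exists (z 0), 0.
    move=> _ [x _ <-]; rewrite mulrC.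
    apply: (@opA_sup_le _ _ _ M d_gt0 M_standing h h_gt0 pi z _ c mpi.2) => y.
      exact: le_trans (ler_norm _) (zc y).
    by rewrite (le_trans (Az y))// ub_le_sup//; exists y.
  - move=> pi pi' Ppi Ppi'; have Sc y := polval_norm_le d_gt0 M_standing q0 q1 qB e0 h_gt0 y Ppi'.1.
    have Sc' y := polval_norm_le d_gt0 M_standing q0 q1 qB e0 h_gt0 y Ppi.1.
    have [_ S0] := polval_spec d_gt0 M_standing q0 q1 qB e0 h_gt0 Ppi.1.
    have [_ S0'] := polval_spec d_gt0 M_standing q0 q1 qB e0 h_gt0 Ppi'.1.
    have [c' rc] := opL_bounded d_gt0 M_standing q0 q1 e0 h_gt0 Ppi.1.2 Sc.
    (* Outside the inner box both policies equal [pib], so the residual there is that of [pi'] at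
       its own value, which is 0. *)
    have out y : ~ cube (L - h) y -> opL M q eps h pi (S eps h pi') y = 0.
      by move=> yL; rewrite -(S0' y) /opL /opA (Ppi.2 y yL) (Ppi'.2 y yL).
    split.
      apply: supn_le => [|x _ /=]; first by rewrite mulr_ge0 ?invr_ge0 ?(ltW lm0)// supn_ge0.
      rewrite mulrC; apply: (polval_error d_gt0 M_standing q0 q1 qB e0 h_gt0 Ppi.1 Sc) => y.
      have [yL|/out->] := pselect (cube (L - h) y); last by rewrite normr0 supn_ge0.
      by apply: (@le_supn _ _ _ _ c').
    apply: (supn_setT_cube d_gt0 M_standing h_gt0 (z := S eps h pi \- S eps h pi') Ppi.1.2
      (c := (supf M + rad ^+ 2 / eps) / lm + (supf M + rad ^+ 2 / eps) / lm)) => x /=.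
      by apply: le_trans (ler_normB _ _) _; apply: lerD; [exact: Sc'|exact: Sc].
    move=> xL; rewrite -(opLB d_gt0 M_standing q eps h_gt0) S0 out ?subr0//.
    by apply: contra_not xL; apply: cube_le; rewrite gerBl ltW.
  - move=> pi Ppi.
    have Sc y := locval_norm_le d_gt0 M_standing q0 q1 qB e0 h_gt0 L pibP y.
    have Sc' y := polval_norm_le d_gt0 M_standing q0 q1 qB e0 h_gt0 y Ppi.1.
    have [_ S0] := polval_spec d_gt0 M_standing q0 q1 qB e0 h_gt0 Ppi.1.
    have [_ v0] := locval_spec d_gt0 M_standing q0 q1 qB e0 h_gt0 L pibP.
    have [c' rc] := opL_bounded d_gt0 M_standing q0 q1 e0 h_gt0 Ppi.1.2 Sc.
    have out y : ~ cube (L - h) y -> opL M q eps h pi (vL eps h L) y = 0.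
      by move=> yL; rewrite -(v0 y) /opR; case: asboolP => // _; rewrite /opL /opA (Ppi.2 y yL).
    split.
      apply: supn_le => [|x _ /=]; first by rewrite mulr_ge0 ?invr_ge0 ?(ltW lm0)// supn_ge0.
      rewrite mulrC; apply: (polval_error d_gt0 M_standing q0 q1 qB e0 h_gt0 Ppi.1 Sc) => y.
      have [yL|/out->] := pselect (cube (L - h) y); last by rewrite normr0 supn_ge0.
      by apply: (@le_supn _ _ _ _ c').
    apply: (supn_setT_cube d_gt0 M_standing h_gt0 (z := S eps h pi \- vL eps h L) Ppi.1.2
      (c := (supf M + rad ^+ 2 / eps) / lm + (supf M + rad ^+ 2 / eps) / lm)) => x /=.
      by apply: le_trans (ler_normB _ _) _; apply: lerD; [exact: Sc'|exact: Sc].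
    move=> xL; rewrite -(opLB d_gt0 M_standing q eps h_gt0) S0 out ?subr0//.
    by apply: contra_not xL; apply: cube_le; rewrite gerBl ltW.
split.
  move=> eps h L pis vs e0 /box0[h_gt0 hL] Ppi bv e xi g G; split; [|split].
  - move=> j; have [_ [c vc]] := bv j.
    exact: (sup_gap_lipschitz d_gt0 M_standing q0 q1 e0 h_gt0 hL (Ppi j.+1).1.2
      (fun y => polval_norm_le d_gt0 M_standing q0 q1 qB e0 h_gt0 y (Ppi j).1) vc).
  - move=> j.
    exact: (policy_improvement d_gt0 M_standing q0 q1 qB e0 h_gt0 pibP hL (Ppi j) (Ppi j.+1)).
  - move=> n _.
    exact: (policy_iteration_error d_gt0 M_standing q0 q1 qB e0 h_gt0 pibP hL
      (fun j _ => Ppi j) (fun j _ => bv j)).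
split.
  move=> eps h L v e0 /box0[h_gt0 hL] bv; have L0 : 0 <= L by rewrite ltW// (lt_trans h_gt0).
  have gX0 z : 0 <= gamh M h ^ z by rewrite exprz_ge0// gamh_ge0.
  split; [|split].
  - move=> pi E mpi _ EL dE.
    have EL' : E `<=` cube L.
      by move=> x /EL/interior_subset; apply: cube_le; rewrite gerBl ltW.
    split; last by move=> lh; apply: gamh_ceil_le_decay.
    apply: supn_le => [|x Ex]; last exact: (residual_policy d_gt0 M_standing rad_gt0 e0 h_gt0).
    apply: addr_ge0; apply: mulr_ge0; rewrite ?supn_ge0//.
    by rewrite invr_ge0 ltW.
  - move=> pi L' mpi LL' lh /=.
    (* Read off at a corner of the cube. *)
    have LL : L <= L' - h.
      have /LL'/interior_subset/(_ (Ordinal d_gt0)) := @cube_const R d L L0.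
      by rewrite mxE => /andP[].
    apply: (residual_box d_gt0 M_standing rad_gt0 e0 h_gt0) => //.
      by rewrite (le_trans L0)// (le_trans LL)// gerBl ltW.
    by apply: cube_le; rewrite (le_trans LL)// gerBl ltW.
  - move=> L' E LL' _ EL /=.
    have L0' : 0 <= L' by rewrite (le_trans L0)// ltW.
    have EL' : E `<=` cube L'.
      by move=> x /EL/interior_subset; apply: cube_le; rewrite gerBl ltW.
    apply: supn_le => [|x Ex]; last exact: (residual_locval d_gt0 M_standing rad_gt0 e0 h_gt0).
    apply: addr_ge0; apply: mulr_ge0.
    + by rewrite invr_ge0 ltW.
    + exact: supn_ge0.
    + exact: gX0.
    + by rewrite addr_ge0 ?supn_ge0// (Meps_ge0 d_gt0 M_standing).
split.
  move=> eps h L delta DL K pis vs loc Ppi bv e xi G n _.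
  exact: (total_error d_gt0 M_standing rad_gt0 pibP h01 pib_bound loc
    (fun j _ => Ppi j) (fun j _ => bv j)).
move=> eps h L DL n delta K pis vs eps_gt0 eps_cvg h_cvg L_cvg n_cvg bx drange Kc KO
  mg Ppi bv e0 xi G r R3 strip_cond nested R4_eval R4_eval_sup R4_eval_L2.
have h_gt0 k : 0 < h k by have [] := bx k.
have L_ge0 k : 0 <= L k by have [? ? _] := bx k; rewrite ltW// (lt_trans (h_gt0 k)).
split.
  (* The initial error is at most M_eps, hence at most C / eps as soon as eps <= 1. *)
  move=> ge; pose C := (supf M + rad ^+ 2) / lm.
  have C0 : 0 <= C by rewrite divr_ge0 ?addr_ge0 ?sqr_ge0 ?supf_ge0// ltW.
  apply: (@squeeze_cvgr _ _ _ _ (fun=> 0) (fun k => C * (gam (h k) ^+ n k / eps k)));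
    last 2 first.
  - exact: cvg_cst.
  - by rewrite -[X in _ --> X](mulr0 C); apply: cvgM => //; exact: cvg_cst.
  near=> k; have e1 : eps k <= 1 by near: k; exact: (cvgr_le _ eps_cvg _ ltr01).
  have gn : 0 <= gam (h k) ^+ n k by rewrite exprn_ge0// gamh_ge0.
  rewrite mulr_ge0 ?supn_ge0//= mulrCA ler_wpM2l//.
  apply: le_trans (opt_err_le d_gt0 M_standing q0 q1 qB (eps_gt0 k) (h_gt0 k) pibP
    (Ppi k 0%N (leq0n _))) _.
  rewrite /C [leRHS]mulrAC ler_pM2r ?invr_gt0// mulrDl lerD2r.
  by rewrite ler_pdivlMr// ler_piMr// supf_ge0.
move=> R1 R2 R3_holds R4 R4G R5a R5b.
(* Both replacements in (R4) provide a bound [E] for the residuals on the larger box; [residual_box]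
   converts it into one for the evaluation errors. *)
have strip_suff (L' E : nat -> R) : nested L' ->
    (forall k j, (j <= n k)%N -> supn (cube (L' k - h k)) (r k j) <= E k) ->
    strip_cond L' E -> R4_eval.
  move=> nL' rE sc.
  apply: (squeeze_cvgr _ (cvg_cst (0 : R)) sc).
  apply: nearW => k; have hk2 : 0 < (h k ^+ 2)^-1 by rewrite invr_gt0 exprn_gt0.
  have xi0 j : 0 <= xi k j := supn_ge0 _ _.
  have s0 : 0 <= sup [set xi k j | j in `I_(n k).+1].
    by apply: le_trans (xi0 0%N) _; apply: (@le_sup_II _ (xi k)).
  rewrite mulr_ge0 ?(ltW hk2)//= ler_pM2l//.
  have LL : L k <= L' k - h k.
    have /nL'/interior_subset/(_ (Ordinal d_gt0)) := @cube_const R d (L k) (L_ge0 k).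
    by rewrite mxE => /andP[].
  have LL' : L k <= L' k by rewrite (le_trans LL)// gerBl ltW.
  have xile j : (j <= n k)%N -> xi k j <= E k / lm + decay M
      (fine (dist_set (cube (L k)) (strip (h k) (L' k) : set 'rV[R]_d)))
      * (sup [set supn (strip (h k) (L' k)) (vs k j) | j in `I_(n k).+1] + Mq (eps k)).
    move=> jn; apply: le_trans (residual_box d_gt0 M_standing rad_gt0 (eps_gt0 k) (h_gt0 k)
      (bv k j jn) (Ppi k j jn).1 (le_trans (L_ge0 k) LL') (cube_le LL') (R1 k).2) _.
    apply: lerD; first by rewrite mulrC ler_pM2r ?invr_gt0// rE.
    rewrite ler_wpM2l ?expR_ge0// lerD2r.
    by apply: (@le_sup_II _ (fun j => supn (strip (h k) (L' k)) (vs k j))); rewrite ltnS.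
  by apply: sup_II_le => [|j]; [exact: le_trans (xi0 0%N) (xile 0%N (leq0n _))|exact: xile].
have R4B : R4_eval.
  case: R4 => [//|[[L' [nL' sc]]|]].
    apply: (strip_suff _ _ nL' _ sc) => k j jn.
    by apply: (@le_sup_II _ (fun j => supn (cube (L' k - h k)) (r k j))); rewrite ltnS.
  move=> [L' [Lip [rmin [CD [rho /= []]]]]] nL' lip dens lift sc.
  apply: (strip_suff _ _ nL' _ sc) => k j jn.
  have l0 : 0 < L' k - h k.
    have /nL'/interior_subset/(_ (Ordinal d_gt0)) := @cube_const R d (L k) (L_ge0 k).
    have [? ? _] := bx k; rewrite mxE => /andP[_]; apply: lt_le_trans.
    by rewrite (lt_trans (h_gt0 k)).
  have lipj := lip k j jn; have [sd [rm0 rmin_le]] := dens k.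
  have C0 := lifting_constant_ge0 d_gt0 l0 (lift k).
  have k0 := lipschitz_const_ge0 d_gt0 l0 lipj.
  set a := (Num.sqrt (rmin k))^-1 * _.
  have La : L2norm ((cube (L' k - h k) : set 'rV[R]_d)°) (r k j) <= a.
    apply: le_trans (L2norm_le_density d_gt0 l0 lipj sd rm0 rmin_le) _.
    rewrite ler_wpM2l ?invr_ge0 ?sqrtr_ge0//.
    apply: (@le_sup_II _ (fun j => Num.sqrt (\int[leb R d]_(x in
      (cube (L' k - h k) : set 'rV[R]_d)°) (r k j x ^+ 2 * rho k x)))).
    by rewrite ltnS.
  apply: le_trans (supn_cube_interior d_gt0 l0 lipj) _.
  apply: le_trans (lift k _ _ k0 lipj) _.
  have L20 : 0 <= L2norm ((cube (L' k - h k) : set 'rV[R]_d)°) (r k j) := sqrtr_ge0 _.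
  rewrite -mulrA -mulrDr ler_wpM2l// lerD// ler_wpM2l ?powR_ge0//.
  by rewrite ge0_ler_powR ?nnegrE ?divr_ge0// (le_trans L20).
split.
  exact: (refinement_uniform d_gt0 M_standing rad_gt0 pibP h01 pib_bound eps_gt0 eps_cvg
    h_cvg L_cvg n_cvg bx drange Kc KO mg Ppi bv R1 R2 R3_holds R4B R4G R5a R5b).
exact: (refinement_L2 d_gt0 M_standing rad_gt0 pibP h01 pib_bound eps_gt0 eps_cvg
  h_cvg L_cvg n_cvg bx drange Kc KO mg Ppi bv R1 R2 R3_holds R4B R4G R5a R5b).
Unshelve. all: by end_near. Qed.
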